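(* For every fixed integer $r \ge 2$ and every $\varepsilon > 0$ there exists $d_0 = d_0(r,\varepsilon)$ such that for every fixed integer $d \ge d_0$, with probability tending to $1$ as $n \to \infty$ (over $n$ with $r \mid nd$), the random $r$-uniform $d$-regular hypergraph $\mathcal{H}_r(n,d)$ on $n$ vertices satisfies \[ \left| \frac{\chi(\mathcal{H}_r(n,d)) - \left(\frac{(r-1)d}{r\log d}\right)^{\frac{1}{r-1}}}{\left(\frac{(r-1)d}{r\log d}\right)^{\frac{1}{r-1}}} \right| \le \varepsilon \qquad\text{and}\qquad \left| \frac{\alpha(\mathcal{H}_r(n,d)) - \left(\frac{r\log d}{(r-1)d}\right)^{\frac{1}{r-1}} n}{\left(\frac{r\log d}{(r-1)d}\right)^{\frac{1}{r-1}} n} \right| \le \varepsilon . \]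
   Context: $\mathcal{H}_r(n,d)$ denotes a hypergraph chosen uniformly at random from all $r$-uniform hypergraphs on vertex set $\{1,\dots,n\}$ in which every vertex lies in exactly $d$ edges (edges are $r$-element sets of vertices). A vertex coloring of a hypergraph is proper if no edge has all its vertices of the same color; $\chi(H)$ is the minimum number of colors in a proper coloring of $H$. A set of vertices is independent if it contains no edge, and $\alpha(H)$ is the maximum size of an independent set in $H$. $\log$ is the natural logarithm. *)

(* Defs.v *)
From mathcomp Require Import all_boot.
From Stdlib Require Import Reals.
Set Implicit Arguments. Unset Strict Implicit. Unset Printing Implicit Defensive.

Definition hgraph (n : nat) := {set {set 'I_n}}.

Definition uniform n (r : nat) (H : hgraph n) : bool :=
  [forall e in H, #|e| == r].

Definition regular n (d : nat) (H : hgraph n) : bool :=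
  [forall v : 'I_n, #|[set e in H | v \in e]| == d].

Definition Hrnd n r d : {set hgraph n} :=
  [set H : hgraph n | uniform r H && regular d H].

Definition proper_coloring n k (H : hgraph n) (f : {ffun 'I_n -> 'I_k}) : bool :=
  [forall e in H, ~~ [exists c : 'I_k, [forall v in e, f v == c]]].

Definition colorable n (H : hgraph n) (k : nat) : bool :=
  [exists f : {ffun 'I_n -> 'I_k}, proper_coloring H f].

(* chromatic number: least k admitting a proper k-colouring (searched among
   k <= n; n colours always suffice when all edges have >= 2 vertices) *)
Definition chi n (H : hgraph n) : nat :=
  \big[minn/n]_(k < n.+1 | colorable H k) k.

Definition independent n (H : hgraph n) (S : {set 'I_n}) : bool :=
  [forall e in H, ~~ (e \subset S)].

Definition alpha n (H : hgraph n) : nat :=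
  \max_(S : {set 'I_n} | independent H S) #|S|.

Definition prob n r d (P : pred (hgraph n)) : R :=
  (INR #|[set H in Hrnd n r d | P H]| / INR #|Hrnd n r d|)%R.

Definition Rle_b (x y : R) : bool := if Rle_dec x y then true else false.

Definition chi_target (r d : nat) : R :=
  Rpower ((INR r - 1) * INR d / (INR r * ln (INR d)))%R (1 / (INR r - 1))%R.

Definition alpha_target (r d n : nat) : R :=
  (Rpower (INR r * ln (INR d) / ((INR r - 1) * INR d))%R (1 / (INR r - 1))%R
   * INR n)%R.

Definition good_event n r d (eps : R) (H : hgraph n) : bool :=
  Rle_b (Rabs ((INR (chi H) - chi_target r d) / chi_target r d)) eps &&
  Rle_b (Rabs ((INR (alpha H) - alpha_target r d n) / alpha_target r d n)) eps.

(* Main.v *)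
(** The uniform simple hypergraph is the configuration model (a uniform matching of [n * d]
    clones of vertices to the slots of [n * d / r] tuples) conditioned on simplicity, an event
    of probability bounded below, so every estimate may be made for uniform permutations.

    A first moment bound shows that no independent set exceeds [(1 + eps)] times its target;
    by [n <= chi * alpha] it remains to bound [chi] from above.  For [k] slightly above the
    target, the second moment of the number of balanced proper [k]-colourings is at most a
    polynomial in [n] times the square of the first: the excess due to an overlap matrix
    [a] is compared entry by entry with its relative entropy, via
    [A (y^r - r y + r - 1) / k^(r-1) <= y ln y - y + 1] at [y = k^2 a_ij], which holds because
    the factor [(1 + eps)] leaves room in [A < ln k].  Hence a [k]-colouring exists with
    probability at least an inverse polynomial, and concentration of the least number of
    uncoloured vertices upgrades this to: with high probability all but [eta n] vertices are
    coloured.  The rest spans a sparse hypergraph and is coloured greedily with [2 r] new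
    colours. *)

Require Import Defs.
From Stdlib Require Import Reals.
From mathcomp Require Import all_boot all_order all_algebra fingroup perm action.
From mathcomp Require Import Rstruct ring lra zify.
Set Implicit Arguments. Unset Strict Implicit. Unset Printing Implicit Defensive.
Import Order.TTheory GRing.Theory Num.Theory.
Bind Scope ring_scope with R.
Arguments exp _%_ring_scope.
Arguments ln _%_ring_scope.
Local Open Scope ring_scope.

(** Losses polynomial in [n] are affordable because the final concentration step gains a factor
    exponential in [n]; with [r], [d], [k] fixed, constants of any size in these parameters are
    harmless too. So no Laplace method and no sharp Stirling formula is needed: every count goes
    through types. A uniform permutation of the clones turns a fixed colouring into a uniform word
    with prescribed letter counts, and up to the factor [polyfac] an upper bound may treat its
    letters as independent with the same frequencies. This exchange works in one direction only. The
    lower bound on the first moment needs a proper word whose colour counts are exactly right; it is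
    built explicitly, and permuting its tuples produces almost all the words required. The second
    obstacle is to keep the probability of simplicity away from 0 for fixed [d]. Switchings give a
    crude constant, which suffices, since the bad events have probability tending to 0. The fraction
    [eta] of vertices left uncoloured is [1 / (e^3 d^2)]: below this density vertex sets typically
    span fewer than two edges per vertex. *)

(** * Elementary bounds for exponentials, logarithms and factorials *)

Lemma exp_ge1D (x : R) : 1 + x <= exp x.
Proof. apply/RleP; exact: exp_ineq1_le. Qed.

Lemma exp_gt0 (x : R) : 0 < exp x.
Proof. apply/RltP; exact: exp_pos. Qed.

Lemma exp_ge0 (x : R) : 0 <= exp x.
Proof. exact: ltW (exp_gt0 x). Qed.

Lemma expRDE (x y : R) : exp (x + y) = exp x * exp y.
Proof. exact: exp_plus. Qed.

Lemma expRNE (x : R) : exp (- x) = (exp x)^-1.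
Proof. exact: exp_Ropp. Qed.

Lemma ler_exp (x y : R) : (exp x <= exp y) = (x <= y).
Proof.
apply/idP/idP => h.
  rewrite leNgt; apply/negP => /RltP /exp_increasing /RltP.
  by rewrite ltNge h.
move: h; rewrite le_eqVlt => /orP[/eqP-> //|/RltP/exp_increasing/RltP].
exact: ltW.
Qed.

Lemma exprX (x : R) n : exp x ^+ n = exp (n%:R * x).
Proof. by rewrite expRX mulr_natl. Qed.

Lemma exp_sum (I : finType) (P : pred I) (F : I -> R) :
  exp (\sum_(i | P i) F i) = \prod_(i | P i) exp (F i).
Proof.
elim/big_rec2: _ => [|i y x _ <-]; first exact: expR0.
by rewrite expRDE.
Qed.

(** Since [exp (- x) >= 1 - x], [exp x] is at most [1 / (1 - x)], and [(1 + x + 2 x^2) (1 - x) = 1 +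
    x^2 (1 - 2 x)] is at least 1 exactly up to [x = 1/2]; hence the constants. *)
Lemma exp_le_quadratic (x : R) : `|x| <= 1/2 -> exp x <= 1 + x + 2 * x ^+ 2.
Proof.
rewrite ler_norml => /andP[h1 h2].
have h3 : 0 < 1 - x by lra.
have : exp x <= (1 - x)^-1.
  rewrite -{1}[x]opprK expRNE lef_pV2 ?posrE ?exp_gt0 //.
  by apply: le_trans (exp_ge1D _); lra.
move/le_trans; apply; rewrite -div1r ler_pdivrMr //; nra.
Qed.

Lemma lnD (x y : R) : 0 < x -> 0 < y -> ln (x * y) = ln x + ln y.
Proof. by move=> /RltP hx /RltP hy; exact: ln_mult. Qed.

Lemma exp_lnK (x : R) : 0 < x -> exp (ln x) = x.
Proof. by move=> /RltP hx; exact: exp_ln. Qed.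

Lemma lnV (x : R) : 0 < x -> ln x^-1 = - ln x.
Proof. by move=> /RltP hx; exact: ln_Rinv. Qed.

Lemma lnX (x : R) n : 0 < x -> ln (x ^+ n) = n%:R * ln x.
Proof.
move=> hx; apply: exp_inv.
by rewrite exp_lnK ?exprn_gt0 // -exprX exp_lnK.
Qed.

Lemma ler_ln (x y : R) : 0 < x -> x <= y -> ln x <= ln y.
Proof.
by move=> hx hy; rewrite -ler_exp !exp_lnK //; apply: lt_le_trans hy.
Qed.

Lemma ln_le_sub1 (x : R) : 0 < x -> ln x <= x - 1.
Proof. by move=> hx; have := exp_ge1D (ln x); rewrite exp_lnK //; lra. Qed.

Lemma ln_ge1V (x : R) : 0 < x -> 1 - x^-1 <= ln x.
Proof.
by move=> hx; have := @ln_le_sub1 x^-1; rewrite invr_gt0 lnV // => /(_ hx); lra.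
Qed.

Lemma one_sub_exp_le (x : R) n : 0 <= x <= 1 -> (1 - x) ^+ n <= exp (- (n%:R * x)).
Proof.
move=> /andP[h0 h1]; rewrite -mulrN -exprX lerXn2r ?nnegrE ?exp_ge0 //; first lra.
exact: exp_ge1D.
Qed.

Lemma exp_natS n : exp n.+1%:R = exp n%:R * exp 1.
Proof. by rewrite -natr1 expRDE. Qed.

(** Crude half of Stirling's formula; the induction step is [(1 + 1/n)^n <= e]. *)
Lemma factorial_ge (n : nat) : n%:R ^+ n <= n`!%:R * exp n%:R.
Proof.
elim: n => [|n IH]; first by rewrite expr0 fact0 mul1r expR0.
rewrite exprS factS natrM exp_natS -!mulrA ler_wpM2l ?ler0n //.
rewrite mulrA.
case: n IH => [|n] IH.
  by rewrite expr0 fact0 mul1r expR0 mul1r; apply: le_trans (exp_ge1D _); lra.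
apply: (@le_trans _ _ (n.+1%:R ^+ n.+1 * exp 1)); last first.
  by rewrite ler_wpM2r ?exp_ge0.
have hn : (0 : R) < n.+1%:R by rewrite ltr0Sn.
have -> : n.+2%:R = n.+1%:R * (1 + n.+1%:R^-1) :> R.
  by rewrite mulrDr mulr1 mulfV ?gt_eqF // natr1.
rewrite exprMn ler_wpM2l ?exprn_ge0 ?ler0n //.
apply: (@le_trans _ _ (exp (n.+1%:R^-1) ^+ n.+1)).
  by rewrite lerXn2r ?nnegrE ?exp_ge0 ?addr_ge0 ?invr_ge0 ?ler0n // exp_ge1D.
by rewrite exprX mulfV ?gt_eqF.
Qed.

Lemma factorial_le (n : nat) :
  n`!%:R * exp n%:R <= exp 1 * n.+1%:R * n%:R ^+ n.
Proof.
case: n => [|n].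
  rewrite fact0 expR0 expr0 !mulr1; apply: le_trans (exp_ge1D _); lra.
(* The induction runs with the factor [n] in place of [n + 1]; the weaker factor in the statement is
   there to include [n = 0]. *)
suff : n.+1`!%:R * exp n.+1%:R <= exp 1 * n.+1%:R * n.+1%:R ^+ n.+1.
  move/le_trans; apply; rewrite ler_wpM2r ?exprn_ge0 ?ler0n //.
  by rewrite ler_wpM2l ?exp_ge0 // ler_nat.
elim: n => [|n IH]; first by rewrite expr1 !mulr1 mul1r.
rewrite factS natrM exp_natS.
have -> : n.+2%:R * n.+1`!%:R * (exp n.+1%:R * exp 1) =
   n.+2%:R * exp 1 * (n.+1`!%:R * exp n.+1%:R) :> R by ring.
apply: (@le_trans _ _ (n.+2%:R * exp 1 * (exp 1 * n.+1%:R * n.+1%:R ^+ n.+1))).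
  by rewrite ler_wpM2l // mulr_ge0 ?exp_ge0.
have -> : n.+2%:R * exp 1 * (exp 1 * n.+1%:R * n.+1%:R ^+ n.+1) =
   exp 1 * n.+2%:R * (exp 1 * n.+1%:R ^+ n.+2) :> R by rewrite [in RHS]exprS; ring.
rewrite ler_wpM2l ?mulr_ge0 ?exp_ge0 //.
have hn : (0 : R) < n.+2%:R by rewrite ltr0Sn.
have -> : n.+1%:R = n.+2%:R * (1 - n.+2%:R^-1) :> R.
  by rewrite mulrBr mulr1 mulfV ?gt_eqF // -[in RHS]natr1 addrK.
rewrite exprMn mulrCA -[leRHS]mulr1 ler_wpM2l ?exprn_ge0 ?ler0n //.
have h : (1 - n.+2%:R^-1) ^+ n.+2 <= exp (- (n.+2%:R * n.+2%:R^-1)) :> R.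
  apply: one_sub_exp_le; rewrite invr_ge0 ler0n /= invf_le1 //.
  by rewrite ler1n.
move: h; rewrite mulfV ?gt_eqF // => h.
apply: (@le_trans _ _ (exp 1 * exp (-1))); first by rewrite ler_wpM2l ?exp_ge0.
by rewrite -expRDE subrr expR0.
Qed.

(** Method of types: the inverse of a multinomial coefficient is, up to a polynomial factor, at most
    the probability that independent letters with frequencies [c x / N] spell one given word of that
    type. *)
Lemma prod_factorial_le (K : finType) (c : K -> nat) (N : nat) :
  (\sum_x c x)%N = N ->
  \prod_x (c x)`!%:R <=
    (exp 1 * N.+1%:R) ^+ #|K| * N`!%:R * \prod_x ((c x)%:R / N%:R) ^+ c x :> R.
Proof.
move=> hN.
have hc x : (c x <= N)%N by rewrite -hN (bigD1 x) //= leq_addr.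
have h1 : \prod_x (c x)`!%:R * exp N%:R <=
    (exp 1 * N.+1%:R) ^+ #|K| * \prod_x ((c x)%:R ^+ c x) :> R.
  rewrite -hN natr_sum exp_sum -big_split /=.
  rewrite -[in leRHS]prodr_const -big_split /=.
  apply: ler_prod => x _; rewrite mulr_ge0 ?exp_ge0 ?ler0n //=.
  apply: le_trans (factorial_le _) _.
  rewrite ler_wpM2r ?exprn_ge0 ?ler0n // ler_wpM2l ?exp_ge0 // ler_nat ltnS hN.
  exact: hc.
have h2 : \prod_x ((c x)%:R ^+ c x) = N%:R ^+ N * \prod_x ((c x)%:R / N%:R) ^+ c x :> R.
  rewrite -[X in _ ^+ X * _]hN expr_sum -big_split /=; apply: eq_bigr => x _.
  rewrite -exprMn; case: (posnP N) => [N0|N0].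
    by have := hc x; rewrite N0 leqn0 => /eqP ->; rewrite !expr0.
  by rewrite [N%:R * _]mulrC divfK // pnatr_eq0 -lt0n.
have hP : 0 <= \prod_x ((c x)%:R / N%:R) ^+ c x :> R.
  by apply: prodr_ge0 => x _; rewrite exprn_ge0 // divr_ge0.
rewrite -(ler_pM2r (exp_gt0 N%:R)); apply: le_trans h1 _; rewrite h2.
have -> : (exp 1 * N.+1%:R) ^+ #|K| * N`!%:R *
  (\prod_x ((c x)%:R / N%:R) ^+ c x) * exp N%:R =
  (exp 1 * N.+1%:R) ^+ #|K| * (N`!%:R * exp N%:R *
  (\prod_x ((c x)%:R / N%:R) ^+ c x)) :> R by ring.
rewrite ler_wpM2l ?exprn_ge0 ?mulr_ge0 ?exp_ge0 ?ler0n //.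
by rewrite ler_wpM2r // factorial_ge.
Qed.

(** * Colour classes under permutations *)

Section ColorClasses.
Variables (T K : finType).
Implicit Types (f h : {ffun T -> K}) (s u : {perm T}).

Definition cnt f x : nat := #|[set t | f t == x]|.

Definition pcomp f s : {ffun T -> K} := [ffun t => f (s t)].

Definition same_cnt f h := [forall x, cnt f x == cnt h x].

Definition stab f : {set {perm T}} := [set s | pcomp f s == f].

Lemma cnt_pcomp f s x : cnt (pcomp f s) x = cnt f x.
Proof.
rewrite /cnt -[RHS](card_imset _ (@perm_inj _ s^-1)); congr #|pred_of_set _|.
apply/setP => t; rewrite inE ffunE; apply/eqP/imsetP => [h|[y]].
  by exists (s t); rewrite ?inE ?h ?permK.
by rewrite inE => /eqP <- ->; rewrite permKV.
Qed.

Lemma sum_cnt f : (\sum_x cnt f x)%N = #|T|.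
Proof.
rewrite -sum1_card (partition_big f predT) //=; apply: eq_bigr => x _.
by rewrite sum1_card; apply: eq_card => t; rewrite inE.
Qed.

(** Equal counts allow each class of [h] to be matched with the class of [f] of the same colour by
    rank in the enumerations. *)
Lemma same_cnt_pcomp f h : same_cnt f h -> exists s, pcomp f s = h.
Proof.
move=> /forallP hc.
have hsz t : size (enum [set u | f u == h t]) = size (enum [set u | h u == h t]).
  by rewrite -!cardE; apply/eqP/hc.
pose g t := nth t (enum [set u | f u == h t]) (index t (enum [set u | h u == h t])).
have hidx t : (index t (enum [set u | h u == h t]) < size (enum [set u | f u == h t]))%N.
  by rewrite hsz index_mem mem_enum inE.
have hg t : f (g t) = h t.
  have : g t \in enum [set u | f u == h t] by rewrite mem_nth.
  by rewrite mem_enum inE => /eqP.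
have ginj : injective g.
  move=> t u e; have e1 : h t = h u by rewrite -!hg e.
  move: e; rewrite /g -e1 (set_nth_default u) //.
  have hu := hidx u; rewrite -e1 in hu.
  move=> /eqP; rewrite nth_uniq ?enum_uniq // => /eqP e2.
  have ht : t \in enum [set u | h u == h t] by rewrite mem_enum inE.
  have hu' : u \in enum [set u | h u == h t] by rewrite mem_enum inE e1.
  by rewrite -(nth_index t ht) e2 nth_index.
by exists (perm ginj); apply/ffunP => t; rewrite ffunE permE.
Qed.

(** The fibre is the coset [s0 * stab f] of any of its members. *)
Lemma card_pcomp_fiber f h : same_cnt f h ->
  #|[set s | pcomp f s == h]| = #|stab f|.
Proof.
move=> /same_cnt_pcomp [s0 <-].
rewrite -[RHS](card_imset _ (@mulgI _ s0)); congr #|pred_of_set _|.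
apply/setP => s; rewrite !inE; apply/eqP/imsetP => [e|[u]].
  exists (s0^-1 * s)%g; last by rewrite mulKVg.
  rewrite inE; apply/eqP/ffunP => t; rewrite ffunE permM.
  by move/ffunP/(_ (s0^-1%g t)): e; rewrite !ffunE permKV.
rewrite inE => /eqP /ffunP e ->; apply/ffunP => t; rewrite !ffunE permM.
by have := e (s0 t); rewrite ffunE.
Qed.

(** For uniform [s] the word [pcomp f s] is uniform on the words with the counts of [f]; this turns
    counting permutations into counting words. *)
Lemma card_perm_class f (Q : pred {ffun T -> K}) :
  #|[set s | Q (pcomp f s)]| = (#|stab f| * #|[set h | same_cnt f h && Q h]|)%N.
Proof.
rewrite -sum1_card (partition_big (pcomp f) [pred h | same_cnt f h && Q h]) /=.
  rewrite mulnC -sum_nat_const; apply: eq_big => [h|h /andP[hc hQ]].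
    by rewrite inE.
  rewrite -(card_pcomp_fiber hc) sum1_card; apply: eq_card => s.
  by rewrite unfold_in /= !inE; case: eqP => [->|]; rewrite ?hQ ?andbF.
move=> s; rewrite inE => -> ; rewrite andbT.
by apply/forallP => x; rewrite cnt_pcomp.
Qed.

Lemma card_class f :
  (#|stab f| * #|[set h | same_cnt f h]|)%N = #|T|`!.
Proof.
have := card_perm_class f predT.
rewrite (_ : [set s | _] = [set: {perm T}]); last by apply/setP => s; rewrite !inE.
rewrite (_ : [set h | _ && _] = [set h | same_cnt f h]); last first.
  by apply/setP => s; rewrite !inE andbT.
move<-; have := card_perm [set: T]; rewrite !cardsT => <-.
by apply: eq_card => s; rewrite !inE; apply/esym/subsetP => t _; rewrite inE.
Qed.

(* Splitting off one colour class at a time embeds the stabiliser in the product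
   of the symmetric groups of the classes. *)
Lemma stab_le f : (#|stab f| <= \prod_x (cnt f x)`!)%N.
Proof.
pose G (l : seq K) := [set s | (pcomp f s == f) && [forall t, (f t \notin l) ==> (s t == t)]].
suff hG l : (#|G l| <= \prod_(x <- l) (cnt f x)`!)%N.
  have := hG (index_enum K); rewrite (_ : G _ = stab f) //.
  apply/setP => s; rewrite !inE; case: eqP => //= _.
  by apply/forallP => t; rewrite mem_index_enum.
elim: l => [|x l IH].
  rewrite big_nil -(cards1 (1%g : {perm T})); apply: subset_leq_card.
  apply/subsetP => s; rewrite !inE => /andP[_ /forallP h].
  by apply/eqP/permP => t; rewrite perm1; apply/eqP/h.
rewrite big_cons; pose A := [set t | f t == x].
have hcA s t : pcomp f s = f -> (s t \in A) = (t \in A).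
  by move=> e; rewrite !inE -{2}e ffunE.
have hN s : pcomp f s = f -> s \in 'N(A | 'P)%g.
  move=> e; rewrite inE; apply/andP; split; first by rewrite inE.
  rewrite inE; apply/subsetP => t; rewrite inE /= /aperm => ht.
  by move: (hcA s t e); rewrite !inE => ->.
pose phi s := (restr_perm A s, s * (restr_perm A s)^-1)%g.
have phi_inj : injective phi.
  move=> s u [e1 e2]; have := congr1 (fun z => z * restr_perm A s)%g e2.
  by rewrite {3}e1 !mulgKV.
have hsub : phi @: G (x :: l) \subset setX [set s | perm_on A s] (G l).
  apply/subsetP => _ /imsetP[s + ->]; rewrite inE => /andP[/eqP e /forallP hs].
  rewrite !inE restr_perm_on /=.
  have hr t : restr_perm A s t = if t \in A then s t else t.
    case: ifP => ht; first by rewrite restr_permE ?hN.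
    by rewrite (out_perm (restr_perm_on _ _)) // ht.
  have hrV t : (restr_perm A s)^-1%g (s t) = if t \in A then t else s t.
    apply: (@perm_inj _ (restr_perm A s)); rewrite permKV hr; have := hcA s t e.
    by case: (boolP (t \in A)) => ht hh; rewrite ?(negbTE ht) ?ht ?hh.
  apply/andP; split.
    apply/eqP/ffunP => t; rewrite ffunE permM hrV; case: ifP => // _.
    by rewrite -[in RHS]e ffunE.
  apply/forallP => t; apply/implyP => ht; rewrite permM hrV.
  case: ifP => // /negbT; rewrite inE => htA.
  by apply: (implyP (hs t)); rewrite inE negb_or htA.
rewrite -(card_imset _ phi_inj); apply: leq_trans (subset_leq_card hsub) _.
rewrite cardsX leq_mul // cardsE card_perm //.
Qed.

Definition freq f x : R := (cnt f x)%:R / #|T|%:R.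

Definition polyfac : R := (exp 1 * #|T|.+1%:R) ^+ #|K|.

Lemma polyfac_gt0 : 0 < polyfac.
Proof. by rewrite exprn_gt0 // mulr_gt0 ?exp_gt0 ?ltr0Sn. Qed.

Lemma freq_ge0 f x : 0 <= freq f x.
Proof. by rewrite divr_ge0. Qed.

Lemma sum_freq f : (0 < #|T|)%N -> \sum_x freq f x = 1.
Proof.
by move=> h; rewrite -mulr_suml -natr_sum sum_cnt mulfV // pnatr_eq0 -lt0n.
Qed.

Lemma weight_class (a : K -> R) h :
  \prod_t a (h t) = \prod_x a x ^+ cnt h x.
Proof.
rewrite (partition_big h predT) //=; apply: eq_bigr => x _.
rewrite (eq_bigr (fun=> a x)); last by move=> t /eqP ->.
by rewrite prodr_const; congr (_ ^+ _); apply: eq_card => t; rewrite inE.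
Qed.

Lemma stab_le_weight f :
  #|stab f|%:R <= polyfac * #|T|`!%:R * \prod_t freq f (f t) :> R.
Proof.
rewrite weight_class; apply: le_trans (prod_factorial_le (sum_cnt f)).
by rewrite -natr_prod ler_nat stab_le.
Qed.

(** Passage to independent letters: all words with the counts of [f] have the same weight as [f],
    which by [stab_le_weight] pays for their permutations; words with other counts only enlarge the
    right side. *)
Lemma perm_class_le f (Q : pred {ffun T -> K}) :
  #|[set s | Q (pcomp f s)]|%:R <=
    polyfac * #|T|`!%:R * \sum_(h | Q h) \prod_t freq f (h t) :> R.
Proof.
rewrite card_perm_class natrM.
apply: (@le_trans _ _ (polyfac * #|T|`!%:R * \prod_t freq f (f t) *
   #|[set h | same_cnt f h && Q h]|%:R)).
  by rewrite ler_wpM2r ?stab_le_weight.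
rewrite -mulrA ler_wpM2l ?mulr_ge0 ?(ltW polyfac_gt0) //.
rewrite mulr_natr -sumr_const.
rewrite (eq_bigl (fun h => Q h && same_cnt f h)); last first.
  by move=> h; rewrite inE andbC.
rewrite [leRHS](bigID (same_cnt f)) /= -[leLHS]addr0 lerD //.
  apply: ler_sum => h /andP[_ /forallP hc]; rewrite !weight_class.
  by under [leRHS]eq_bigr do rewrite -(eqP (hc _)).
by apply: sumr_ge0 => h _; apply: prodr_ge0 => t _; apply: freq_ge0.
Qed.

(** Used for words of nearly uniform frequencies: their weight is about [#|K|] to the power
    [- #|T|], so their class is all of the words up to a polynomial factor. *)
Lemma class_ge f :
  1 <= polyfac * #|[set h | same_cnt f h]|%:R * \prod_t freq f (f t) :> R.
Proof.
have hN : (0 : R) < #|T|`!%:R by rewrite ltr0n fact_gt0.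
rewrite -(ler_pM2l hN) mulr1 -{1}(card_class f) natrM.
apply: le_trans (ler_wpM2r _ (stab_le_weight f)) _ => //.
by rewrite le_eqVlt; apply/orP; left; apply/eqP; ring.
Qed.

(** Words are grouped by their count vector. Within a group the weight is that of one product
    measure, of total mass 1, and there are at most [#|T|.+1 ^ #|K|] groups. *)
Lemma sum_freq_le :
  \sum_(h : {ffun T -> K}) \prod_t freq h (h t) <= #|T|.+1%:R ^+ #|K| :> R.
Proof.
case: (posnP #|T|) => [T0|Tp].
  rewrite T0 expr1n; apply: (@le_trans _ _ (\sum_(h : {ffun T -> K}) 1)).
    apply: ler_sum => h _; rewrite big1 // => t.
    by move: (card0_eq T0 t); rewrite inE.
  by rewrite sumr_const cardT -cardE card_ffun T0 expn0.
pose typ (h : {ffun T -> K}) : {ffun K -> 'I_#|T|.+1} := [ffun x => inord (cnt h x)].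
have htyp h x : typ h x = cnt h x :> nat.
  by rewrite ffunE inordK // ltnS max_card.
rewrite (partition_big typ predT) //=.
apply: (@le_trans _ _ (\sum_(nu : {ffun K -> 'I_#|T|.+1}) 1)); last first.
  by rewrite sumr_const cardT -cardE card_ffun card_ord natrX.
apply: ler_sum => nu _.
case: (pickP (fun h => typ h == nu)) => [f /eqP hf|h0]; last first.
  by rewrite big_pred0 // ler01.
have hcf h : typ h == nu -> freq h =1 freq f.
  by move=> /eqP hh x; rewrite /freq -!htyp hh hf.
apply: (@le_trans _ _ (\sum_(h : {ffun T -> K}) \prod_t freq f (h t))).
  rewrite [leRHS](bigID (fun h => typ h == nu)) /= -[leLHS]addr0 lerD //.
    by apply: ler_sum => h hh; under eq_bigr do rewrite (hcf h hh).
  by apply: sumr_ge0 => h _; apply: prodr_ge0 => t _; apply: freq_ge0.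
rewrite -(bigA_distr_bigA (fun=> freq f)) /=.
by rewrite big1 // => t _; rewrite sum_freq.
Qed.

End ColorClasses.

(** * Concentration on the symmetric group *)

Section PermConcentration.
Variable T : finType.
Implicit Types (s : {perm T}) (A : {set T}).

(** Coset decomposition over the stabiliser of [a]: the index [b] is the preimage of [a]. *)
Lemma sum_perm_on_split (F : {perm T} -> R) A a : a \in A ->
  \sum_(s | perm_on A s) F s =
  \sum_(b in A) \sum_(s | perm_on (A :\ a) s) F (tperm a b * s)%g.
Proof.
move=> aA; rewrite (partition_big (fun s => (s^-1)%g a) (mem A)) /=; last first.
  by move=> s hs; rewrite -(perm_closed _ hs) permKV.
apply: eq_bigr => b bA; rewrite (reindex_inj (mulgI (tperm a b))) /=.
apply: eq_bigl => s.
have ht : perm_on A (tperm a b).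
  apply/subsetP => x; rewrite inE; case: tpermP => [->|->|]; rewrite ?eqxx //.
have -> : perm_on A (tperm a b * s)%g = perm_on A s.
  apply/idP/idP => h; last exact: perm_onM.
  by rewrite -(mulKg (tperm a b) s) tpermV perm_onM.
have -> : (((tperm a b * s)^-1)%g a == b) = (s a == a).
  rewrite -(inj_eq (@perm_inj _ (tperm a b * s)%g)) permKV permM tpermR eq_sym //.
apply/andP/idP => [[h1 /eqP h2]|h].
  apply/subsetP => x hx; rewrite !inE; apply/andP; split.
    by apply: contraTneq hx => ->; rewrite !inE h2 eqxx.
  exact: (subsetP h1).
split; first by apply: subset_trans h _; exact: subsetDl.
by apply/eqP/(out_perm h); rewrite !inE eqxx.
Qed.

Lemma card_perm_on_split A a : a \in A ->
  #|[set s | perm_on A s]|%:R = #|A|%:R * #|[set s | perm_on (A :\ a) s]|%:R :> R.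
Proof.
move=> aA; have := sum_perm_on_split (fun=> 1) aA.
rewrite !sumr_const -mulr_natl => e.
by rewrite !cardsE; rewrite e mulr1 mulr_natl.
Qed.

(* Hoeffding's argument along the chain of stabilisers: conditioning on the preimage
   of one more point moves the conditional mean by at most [2 * c]. *)
Lemma perm_mgf_le (c : R) A (f : {perm T} -> R) :
  2 * c <= 1 / 2 ->
  (forall a b s, `|f (tperm a b * s)%g - f s| <= c) ->
  \sum_(s | perm_on A s) exp (f s) <=
  #|[set s | perm_on A s]|%:R *
    exp ((\sum_(s | perm_on A s) f s) / #|[set s | perm_on A s]|%:R
         + 8 * c ^+ 2 * #|A|%:R).
Proof.
move=> hc2; elim: {A}#|A| {-2}A (erefl #|A|) f => [|j IH] A hA f hf.
  have h1 s : perm_on A s = (s == 1%g).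
    apply/idP/eqP => [h|->]; last exact: perm_on1.
    apply/permP => t; rewrite perm1 (out_perm h) //.
    by rewrite (card0_eq hA).
  have -> : [set s | perm_on A s] = [set 1%g] by apply/setP => s; rewrite !inE h1.
  rewrite !(eq_bigl _ _ h1) !big_pred1_eq cards1 divr1 hA mulr0 addr0 mul1r //.
have [a aA] : exists a, a \in A by apply/set0Pn; rewrite -card_gt0 hA.
pose A' := A :\ a; have hA' : #|A'| = j.
  by have := cardsD1 a A; rewrite aA hA add1n => -[<-].
pose M : R := #|[set s | perm_on A' s]|%:R.
have M0 : 0 < M.
  by rewrite ltr0n; apply/card_gt0P; exists 1%g; rewrite inE perm_on1.
pose mu b := (\sum_(s | perm_on A' s) f (tperm a b * s)%g) / M.
pose q : R := #|A|%:R.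
have q0 : 0 < q by rewrite ltr0n hA.
rewrite (card_perm_on_split aA) -/A' -/M -/q !(sum_perm_on_split _ aA) -/A'.
have e1 : (\sum_(b in A) \sum_(s | perm_on A' s) f (tperm a b * s)%g) / (q * M)
   = (\sum_(b in A) mu b) / q.
  rewrite -[in RHS]mulr_suml; field; lra.
rewrite e1; set m := _ / q.
have step b : \sum_(s | perm_on A' s) exp (f (tperm a b * s)%g) <=
   M * exp (mu b + 8 * c ^+ 2 * j%:R).
  have := IH A' hA' (fun s => f (tperm a b * s)%g); rewrite hA' -/M; apply.
  move=> x y s; set t := tperm a b.
  (* The translated function is again Lipschitz: conjugating a transposition by the involution [t]
     gives a transposition, so a swap after [t] is a swap before it. *)
  have -> : (t * (tperm x y * s) = tperm (t x) (t y) * (t * s))%g.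
    rewrite !mulgA; congr (_ * _)%g; rewrite -tpermJ /conjg tpermV mulgA.
    by rewrite -!mulgA tperm2 mulg1.
  exact: hf.
apply: (@le_trans _ _ (\sum_(b in A) M * exp (mu b + 8 * c ^+ 2 * j%:R))).
  by apply: ler_sum => b _.
have hmu b b' : mu b - mu b' <= 2 * c.
  rewrite /mu -mulrBl ler_pdivrMr // -sumrB.
  apply: (@le_trans _ _ (\sum_(s | perm_on A' s) 2 * c)).
    apply: ler_sum => s _; have := hf a b s; have := hf a b' s.
    by rewrite !ler_norml => /andP[? ?] /andP[? ?]; lra.
  by rewrite sumr_const -[X in X <= _]mulr_natr /M cardsE.
have hm b : `|mu b - m| <= 2 * c.
  have qE : q * mu b = \sum_(b' in A) mu b by rewrite sumr_const mulr_natl.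
  have qm : q * m = \sum_(b' in A) mu b' by rewrite /m; field; lra.
  have sc : \sum_(b' in A) 2 * c = q * (2 * c) by rewrite sumr_const -[LHS]mulr_natl.
  rewrite ler_norml; apply/andP; split.
    rewrite -(ler_pM2l q0) mulrBr qE qm -sumrB mulrN -sc -sumrN.
    by apply: ler_sum => b' _; have := hmu b' b; lra.
  rewrite -(ler_pM2l q0) mulrBr qE qm -sumrB -sc.
  by apply: ler_sum => b' _; apply: hmu.
have sum0 : \sum_(b in A) (mu b - m) = 0.
  rewrite sumrB sumr_const -mulr_natl -/q /m; field; lra.
(* The deviations [mu b - m] sum to zero, so the linear terms cancel; [8 c^2] is [2 x^2] at the
   extreme deviation [x = 2 c]. *)
have key : \sum_(b in A) exp (mu b - m) <= q * exp (8 * c ^+ 2).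
  apply: (@le_trans _ _ (\sum_(b in A) ((1 + 8 * c ^+ 2) + (mu b - m)))).
    apply: ler_sum => b _; apply: le_trans (exp_le_quadratic _) _.
      exact: le_trans (hm b) _.
    have := hm b; rewrite ler_norml => /andP[h1 h2].
    have : 0 <= (2 * c - (mu b - m)) * (2 * c + (mu b - m)).
      by rewrite mulr_ge0 //; lra.
    nra.
  rewrite big_split /= sum0 addr0 sumr_const -[leLHS]mulr_natl ler_wpM2l ?ler0n //.
  exact: exp_ge1D.
rewrite -mulr_sumr (mulrC q M) -(mulrA M q) ler_pM2l //.
rewrite (eq_bigr (fun b => exp (mu b - m) * exp (m + 8 * c ^+ 2 * j%:R))); last first.
  by move=> b _; rewrite -expRDE; congr exp; ring.
rewrite -mulr_suml.
have qj : q = j%:R + 1 by rewrite /q hA -natr1.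
have -> : m + 8 * c ^+ 2 * q = 8 * c ^+ 2 + (m + 8 * c ^+ 2 * j%:R).
  by rewrite qj; ring.
by rewrite [in leRHS]expRDE mulrA ler_wpM2r ?exp_ge0.
Qed.

Lemma perm_mgf_le_all (c : R) (f : {perm T} -> R) :
  2 * c <= 1 / 2 ->
  (forall a b s, `|f (tperm a b * s)%g - f s| <= c) ->
  \sum_s exp (f s) <=
  #|T|`!%:R * exp ((\sum_s f s) / #|T|`!%:R + 8 * c ^+ 2 * #|T|%:R).
Proof.
move=> h1 h2; have := perm_mgf_le [set: T] h1 h2.
have hp s : perm_on [set: T] s = true by apply/subsetP => t; rewrite inE.
have -> : #|[set s | perm_on [set: T] s]| = #|T|`!.
  by rewrite cardsE card_perm cardsT.
by rewrite !(eq_bigl _ _ hp) cardsT.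
Qed.

(* A Lipschitz function that is nonpositive with non-negligible probability is small
   with overwhelming probability: bound the mean from the lower tail, then use
   the upper tail. *)
Lemma perm_lipschitz_tail (c x : R) (f : {perm T} -> R) :
  2 * c <= 1 / 2 ->
  (forall a b s, `|f (tperm a b * s)%g - f s| <= c) ->
  #|[set s | f s <= 0]|%:R * #|[set s | x <= f s]|%:R <=
  #|T|`!%:R ^+ 2 * exp (16 * c ^+ 2 * #|T|%:R - x) :> R.
Proof.
move=> h1 h2; set m := (\sum_s f s) / #|T|`!%:R.
have h3 a b s : `|- f (tperm a b * s)%g - - f s| <= c.
  by rewrite -opprD normrN; apply: h2.
have up := perm_mgf_le_all h1 h2; rewrite -/m in up.
have lo := perm_mgf_le_all h1 h3; rewrite sumrN mulNr -/m in lo.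
have up' : #|[set s | x <= f s]|%:R * exp x <= \sum_s exp (f s).
  rewrite [leRHS](bigID (fun s => x <= f s)) /= -[leLHS]addr0 lerD //.
    rewrite mulr_natl -sumr_const; rewrite [leLHS](eq_bigl (fun s => x <= f s)).
      by apply: ler_sum => s hs; rewrite ler_exp.
    by move=> s; rewrite inE.
  by apply: sumr_ge0 => s _; apply: exp_ge0.
have lo' : #|[set s | f s <= 0]|%:R <= \sum_s exp (- f s).
  rewrite [leRHS](bigID (fun s => f s <= 0)) /= -[leLHS]addr0 lerD //.
    rewrite -sumr_const; rewrite [leLHS](eq_bigl (fun s => f s <= 0)).
      by apply: ler_sum => s hs; rewrite -expR0 ler_exp oppr_ge0.
    by move=> s; rewrite inE.
  by apply: sumr_ge0 => s _; apply: exp_ge0.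
(* In the product of the two tail bounds [exp (- m)] and [exp m] cancel, so the mean is never
   estimated. *)
have := ler_pM _ _ (le_trans lo' lo) (le_trans up' up).
rewrite mulr_ge0 ?exp_ge0 // ler0n => /(_ isT isT) H.
rewrite -(ler_pM2r (exp_gt0 x)) -[leLHS]mulrA; apply: le_trans H _.
rewrite mulrACA -expRDE -expr2 -(mulrA _ _ (exp x)) -expRDE subrK.
have -> : - m + 8 * c ^+ 2 * #|T|%:R + (m + 8 * c ^+ 2 * #|T|%:R) =
  16 * c ^+ 2 * #|T|%:R by ring.
exact: lexx.
Qed.

End PermConcentration.

(** * The configuration model *)

Section Configuration.
Variables (n d r m : nat).
Notation T := ('I_m * 'I_r)%type.
Variable vtx : {ffun T -> 'I_n}.
Hypothesis hvtx : forall v, cnt vtx v = d.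
Hypothesis r_gt0 : (0 < r)%N.
Implicit Types (s : {perm T}) (w : 'I_m) (t : T).

(** [T] indexes both sides of the matching: an argument of [s] is slot [i] of tuple [w], a value of
    [s] is a clone, and [vtx] gives the vertex of a clone. *)
Definition edge s w : {set 'I_n} := [set vtx (s (w, i)) | i : 'I_r].

Definition hg s : hgraph n := [set edge s w | w : 'I_m].

Definition simple s := [forall w, #|edge s w| == r] && injectiveb (edge s).

Lemma card_config : (n * d)%N = (m * r)%N.
Proof.
have := sum_cnt vtx; rewrite card_prod !card_ord => <-.
by rewrite (eq_bigr (fun=> d)) ?sum_nat_const ?card_ord.
Qed.

Lemma simple_inj s w i j :
  simple s -> vtx (s (w, i)) = vtx (s (w, j)) -> i = j.
Proof.
case/andP=> /forallP/(_ w) h _.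
have /imset_injP hi : #|edge s w| == #|{: 'I_r}| by rewrite card_ord.
by move=> e; apply: hi.
Qed.

Lemma simple_edge_inj s : simple s -> injective (edge s).
Proof. by case/andP=> _ /injectiveP. Qed.

Lemma mem_edge s t : vtx (s t) \in edge s t.1.
Proof. by apply/imsetP; exists t.2 => //; case: t. Qed.

Lemma simple_Hrnd s : simple s -> hg s \in Hrnd n r d.
Proof.
move=> hs; rewrite inE; apply/andP; split.
  apply/forall_inP => e /imsetP[w _ ->].
  by case/andP: hs => /forallP.
apply/forallP => v; rewrite -[d](hvtx v) /cnt.
(* Each clone of [v] is sent to the edge that holds it; simplicity makes this injective, so the
   degree equals the number [d] of clones. *)
pose phi t := edge s (s^-1%g t).1.
rewrite -(@card_in_imset _ _ phi).
  apply/eqP; congr #|pred_of_set _|; apply/setP => e; rewrite inE; apply/andP/imsetP.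
    case=> /imsetP[w _ ->] /imsetP[i _ hv]; exists (s (w, i)).
      by rewrite inE hv.
    by rewrite /phi permK.
  case=> t; rewrite inE => /eqP <- ->; split; first exact: imset_f.
  by rewrite -{1}[t](permKV s) mem_edge.
move=> t u; rewrite !inE => /eqP ht /eqP hu /(simple_edge_inj hs) e.
apply: (@perm_inj _ s^-1%g); case E1: (_ t) e => [w i]; case E2: (_ u) => [w' j] /= e.
subst w'; congr pair; apply: (@simple_inj s w) => //.
by rewrite -E1 -E2 !permKV ht hu.
Qed.

Lemma Hrnd_card H : H \in Hrnd n r d -> #|H| = m.
Proof.
rewrite inE => /andP[/forall_inP hu /forallP hr].
apply/eqP; rewrite -(eqn_pmul2r r_gt0) -card_config; apply/eqP.
transitivity (\sum_(e in H) \sum_(v : 'I_n | v \in e) 1)%N.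
  by rewrite -sum_nat_const; apply: eq_bigr => e /hu /eqP <-; rewrite sum1_card.
rewrite (exchange_big_dep predT) //=.
rewrite -[n in RHS]card_ord -sum_nat_const; apply: eq_bigr => v _.
rewrite -[RHS](eqP (hr v)) sum1_card.
by apply: eq_card => e; rewrite !inE.
Qed.

(** Listing the edges and the vertices of each edge yields a word on the slots in which every vertex
    occurs [d] times, as in [vtx]; [same_cnt_pcomp] then supplies the matching. *)
Lemma Hrnd_simple H : H \in Hrnd n r d -> exists2 s, simple s & hg s = H.
Proof.
move=> hH; have hm := Hrnd_card hH.
move: (hH); rewrite inE => /andP[/forall_inP hu /forallP hr].
pose e w := enum_val (cast_ord (esym hm) w).
have eH w : e w \in H by apply: enum_valP.
have e_inj : injective e by move=> w w' /enum_val_inj /cast_ord_inj.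
have e_card w : #|e w| = r by apply/eqP/hu.
have e_surj x : x \in H -> exists w, e w = x.
  move=> hx; exists (cast_ord hm (enum_rank_in hx x)).
  by rewrite /e cast_ordK enum_rankK_in.
pose f : {ffun T -> 'I_n} := [ffun t : T => enum_val (cast_ord (esym (e_card t.1)) t.2)].
have f_mem t : f t \in e t.1 by rewrite ffunE; apply: enum_valP.
have f_inj w i j : f (w, i) = f (w, j) -> i = j.
  by rewrite !ffunE /= => /enum_val_inj /cast_ord_inj.
have f_surj w v : v \in e w -> exists i, f (w, i) = v.
  move=> hv; exists (cast_ord (e_card w) (enum_rank_in hv v)).
  by rewrite ffunE /= cast_ordK enum_rankK_in.
have hc : same_cnt vtx f.
  apply/forallP => v; rewrite hvtx eq_sym -(eqP (hr v)).
  rewrite /cnt -(@card_in_imset _ _ (fun t : T => e t.1)).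
    apply/eqP; congr #|pred_of_set _|; apply/setP => x; rewrite inE.
    apply/imsetP/andP => [[t]|[/e_surj [w <-] /f_surj [i hi]]].
      by rewrite inE => /eqP <- ->.
    by exists (w, i); rewrite // inE hi.
  move=> [w i] [w' j]; rewrite !inE => /eqP h1 /eqP h2 /= /e_inj ew.
  by subst w'; congr pair; apply: (@f_inj w); rewrite h1 h2.
have [s hs] := same_cnt_pcomp hc.
have hst t : vtx (s t) = f t by rewrite -hs ffunE.
have he w : edge s w = e w.
  apply/setP => v; apply/imsetP/idP => [[i _ ->]|/f_surj[i <-]].
    by rewrite hst (f_mem (w, i)).
  by exists i; rewrite ?hst.
exists s.
  apply/andP; split; first by apply/forallP => w; rewrite he hu.
  by apply/injectiveP => w w'; rewrite !he => /e_inj.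
apply/setP => x; apply/imsetP/idP => [[w _ ->]|/e_surj[w <-]]; first by rewrite he.
by exists w; rewrite ?he.
Qed.

(** The wreath product that permutes the tuples and the slots inside them. Only its cardinality
    matters, because it is the same for all hypergraphs and cancels in [prob_simple]. *)
Definition tuple_perms : {set {perm T}} :=
  [set p : {perm T} | [forall t, forall u, (t.1 == u.1) == ((p t).1 == (p u).1)]].

Lemma tuple_permsP (p : {perm T}) :
  reflect (forall t (u : T), (t.1 == u.1) = ((p t).1 == (p u).1)) (p \in tuple_perms).
Proof.
rewrite inE; apply: (iffP forallP) => [h t u|h t].
  by have /forallP/(_ u)/eqP := h t.
by apply/forallP => u; apply/eqP.
Qed.

Lemma tuple_perm_image (p : {perm T}) s t : p \in tuple_perms ->
  [set vtx (s (p (t.1, i))) | i : 'I_r] = edge s (p t).1.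
Proof.
move=> /tuple_permsP hp.
have hpt u : (p (t.1, u)).1 = (p t).1 by apply/eqP; rewrite -hp.
have p_inj : injective (fun i => (p (t.1, i)).2).
  move=> i j e; have : p (t.1, i) = p (t.1, j).
    by rewrite [p (t.1, i)]surjective_pairing [p (t.1, j)]surjective_pairing e !hpt.
  by move/perm_inj => [].
have [q pq qp] := injF_bij p_inj.
apply/setP => v; apply/imsetP/imsetP => [[i _ ->]|[j _ ->]].
  exists (p (t.1, i)).2 => //; congr (vtx (s _)).
  by rewrite [LHS]surjective_pairing hpt.
exists (q j) => //; congr (vtx (s _)).
by rewrite [RHS]surjective_pairing hpt qp.
Qed.

(* The preimages of a simple hypergraph form one free orbit of the group
   generated by reordering the slots and relabelling the clones of a vertex. *)
Lemma card_simple_fiber s0 : simple s0 ->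
  #|[set s | simple s && (hg s == hg s0)]| = (#|tuple_perms| * #|stab vtx|)%N.
Proof.
move=> hs0; pose phi (x : {perm T} * {perm T}) := (x.1 * s0 * x.2)%g.
have vphi p u t : u \in stab vtx -> vtx ((p * s0 * u)%g t) = vtx (s0 (p t)).
  by rewrite inE => /eqP/ffunP/(_ (s0 (p t))); rewrite ffunE !permM.
have i0 : 'I_r := Ordinal r_gt0.
rewrite -cardsX -(@card_in_imset _ _ phi).
  congr #|pred_of_set _|; apply/setP => s; rewrite inE; apply/andP/imsetP; last first.
    case=> -[p u]; rewrite inE /= => /andP[hp hu] ->.
    have he w : edge (phi (p, u)) w = edge s0 (p (w, i0)).1.
      rewrite -(tuple_perm_image s0 (w, i0) hp) /=; apply: eq_imset => i.
      by rewrite vphi.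
    have hsim : simple (phi (p, u)).
      apply/andP; split; first by apply/forallP => w; rewrite he; case/andP: hs0 => /forallP.
      apply/injectiveP => w w'; rewrite !he => /(simple_edge_inj hs0) /eqP.
      by rewrite -(tuple_permsP _ hp) => /eqP.
    split=> //; rewrite eqEcard; apply/andP; split.
      by apply/subsetP => x /imsetP[w _ ->]; rewrite he imset_f.
    by rewrite !card_imset //; apply: simple_edge_inj.
  case=> hs /eqP hh.
  have htau w : exists w', edge s w == edge s0 w'.
    have : edge s w \in hg s0 by rewrite -hh imset_f.
    by case/imsetP => w' _ ->; exists w'.
  pose tau w := xchoose (htau w).
  have tauP w : edge s w = edge s0 (tau w) by apply/eqP/(xchooseP (htau w)).
  have hrho t : exists i, vtx (s t) == vtx (s0 (tau t.1, i)).
    have := mem_edge s t; rewrite tauP => /imsetP[i _ ->]; by exists i.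
  pose rho t := (tau t.1, xchoose (hrho t)).
  have rhoP t : vtx (s t) = vtx (s0 (rho t)) by apply/eqP/(xchooseP (hrho t)).
  have tau_inj : injective tau.
    by move=> w w' e; apply: (simple_edge_inj hs); rewrite !tauP e.
  have rho_inj : injective rho.
    move=> [w i] [w' j] e; have := congr1 fst e => /= /tau_inj ew; subst w'.
    by congr pair; apply: (@simple_inj s w) => //; rewrite !rhoP e.
  exists (perm rho_inj, (perm rho_inj * s0)^-1 * s)%g; last by rewrite /phi /= mulKVg.
  rewrite inE; apply/andP; split => /=.
    by apply/tuple_permsP => t u; rewrite !permE /= (inj_eq tau_inj).
  rewrite inE; apply/eqP/ffunP => t; rewrite ffunE permM rhoP.
  by rewrite -[X in s0 X](permE rho_inj) -(permM (perm rho_inj) s0) permKV.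
move=> [p u] [p' u'] /setXP[/= hp hu] /setXP[/= hp' hu'] e.
have hpE t : p t = p' t.
  have hv t' : vtx (s0 (p t')) = vtx (s0 (p' t')).
    by rewrite -(vphi _ u) // -[RHS](vphi _ u') // -/(phi (p, u)) e.
  have e1 : (p t).1 = (p' t).1.
    apply: (simple_edge_inj hs0); rewrite -!tuple_perm_image //.
    by apply: eq_imset => i; apply: hv.
  have := hv t; case: (p t) (p' t) e1 => [w i] [w' j] /= <- /(simple_inj hs0) -> //.
have epp : p = p' by apply/permP.
by move: e; rewrite /phi /= epp => /mulgI ->.
Qed.

Lemma card_Hrnd_simple (P : pred (hgraph n)) :
  (#|[set H in Hrnd n r d | P H]| * (#|tuple_perms| * #|stab vtx|))%N =
  #|[set s | simple s && P (hg s)]|.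
Proof.
rewrite -[RHS]sum1_card (partition_big hg (fun H => H \in [set H in Hrnd n r d | P H])) /=.
  rewrite -sum_nat_const; apply: eq_bigr => H /setIdP[hH hP].
  have [s0 hs0 e] := Hrnd_simple hH; rewrite -(card_simple_fiber hs0) e -sum1_card.
  apply: eq_bigl => s; rewrite !inE.
  by case: eqP => [->|]; rewrite ?hP ?andbT ?andbF.
by move=> s; rewrite inE => /andP[hs hP]; rewrite inE simple_Hrnd.
Qed.

Lemma prob_simple (P : pred (hgraph n)) :
  (0 < #|[set s | simple s]|)%N ->
  prob r d P = #|[set s | simple s && P (hg s)]|%:R / #|[set s | simple s]|%:R.
Proof.
move=> hpos; rewrite /prob !INRE RdivE.
have := card_Hrnd_simple predT; have := card_Hrnd_simple P.
set C := (#|tuple_perms| * _)%N.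
have -> : [set H in Hrnd n r d | predT H] = Hrnd n r d.
  by apply/setP => H; rewrite !inE andbT.
have -> : [set s | simple s && predT (hg s)] = [set s | simple s].
  by apply/setP => s; rewrite !inE andbT.
move=> <- e; move: hpos; rewrite -e muln_gt0 => /andP[h1 h2].
by rewrite !(natrM _ _ C) -mulf_div divff ?mulr1 // pnatr_eq0 -lt0n.
Qed.

End Configuration.

(** * Simple configurations *)

Lemma card_permT (T : finType) : #|{: {perm T}}| = #|T|`!.
Proof.
rewrite -(cardsT T) -card_perm; apply: eq_card => s.
by rewrite !inE; apply/esym/subsetP => t _; rewrite inE.
Qed.

(** Double counting: composing with the swap of [q] and [b] shows that [E _ b] holds as often as
    [E _ q], while a single permutation satisfies [E _ b] for at most [k] values [b] in [B]. *)
Lemma swap_average (T : finType) (E : {perm T} -> T -> bool) (P : pred {perm T})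
    (B : {set T}) q k :
  q \in B ->
  (forall b s, b \in B -> E (tperm q b * s)%g q = E s b) ->
  (forall s b, E s b -> P s) ->
  (forall s, (#|[set b in B | E s b]| <= k)%N) ->
  (#|B| * #|[set s | E s q]| <= k * #|[set s | P s]|)%N.
Proof.
move=> qB hE hP hk.
have -> : (#|B| * #|[set s | E s q]| = \sum_(b in B) \sum_(s | E s b) 1)%N.
  rewrite -sum_nat_const; apply: eq_bigr => b bB.
  rewrite -(card_imset _ (mulgI (tperm q b))) -sum1_card; apply: eq_bigl => s.
  apply/imsetP/idP => [[u]|h].
    rewrite inE => hu ->; rewrite -(hE b) //; by rewrite mulgA tperm2 mul1g.
  exists (tperm q b * s)%g; last by rewrite mulgA tperm2 mul1g.
  by rewrite inE hE.
rewrite (exchange_big_dep P) /=; last by move=> b s _; apply: hP.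
rewrite mulnC -sum_nat_const; rewrite [leqRHS](eq_bigl P); last by move=> s; rewrite inE.
apply: leq_sum => s _; apply: leq_trans (hk s).
by rewrite sum1_card; apply: eq_leq; apply: eq_card => b; rewrite !inE.
Qed.

Lemma card_exists_le (T U : finType) (A : {set U}) (E : T -> U -> bool) k :
  (forall a, a \in A -> (#|[set t | E t a]| <= k)%N) ->
  (#|[set t | [exists a in A, E t a]]| <= k * #|A|)%N.
Proof.
move=> h; rewrite mulnC -sum_nat_const.
apply: (@leq_trans (\sum_(a in A) \sum_(t | E t a) 1)); last first.
  apply: leq_sum => a /h; apply: leq_trans; rewrite sum1_card.
  by apply: eq_leq; apply: eq_card => t; rewrite inE.
rewrite (exchange_big_dep predT) //= -sum1_card big_mkcond /=.
apply: leq_sum => t _; rewrite inE; case: existsP => // -[a /andP[ha hE]].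
by rewrite (bigD1 a) ?ha.
Qed.

(** * Bad slots and the effect of one swap *)

Section BadSlots.
Variables (n d r m : nat).
Notation T := ('I_m * 'I_r)%type.
Implicit Types (g : {ffun T -> 'I_n}) (p q b t : T) (A : {set T}).

(** Either a loop, or a pair of vertices shared by two tuples. Absence of conflicts says that the
    hypergraph is linear, which for [r >= 2] excludes repeated edges and, unlike them, is visible on
    pairs of slots. *)
Definition conflict g t q :=
  [&& q != t, q.1 == t.1 &
   (g q == g t) || [exists t', exists q',
     [&& t'.1 == q'.1, t'.1 != t.1, g t' == g t & g q' == g q]]].

Definition bad g t := [exists q, conflict g t q].

Definition nbad g := #|[set t | bad g t]|.

Definition tuple_nbr A := [set t : T | [exists a in A, t.1 == a.1]].
Definition vertex_nbr g A := [set t | [exists a in A, g t == g a]].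

Lemma conflictP g t q :
  reflect [/\ q <> t, q.1 = t.1 & g q = g t \/
     exists t' q', [/\ t' <> q', t'.1 = q'.1, t'.1 <> t.1, g t' = g t & g q' = g q]]
    (conflict g t q).
Proof.
apply: (iffP and3P) => [[/eqP h1 /eqP h2 h3]|[h1 h2 h3]]; split => //; try by apply/eqP.
  case/orP: h3 => [/eqP ->|/existsP[t' /existsP[q' /and4P[/eqP a /eqP b /eqP c /eqP e]]]].
    by left.
  (* The boolean definition omits [t' != q']: if they coincide, the slots [t] and [q] form a
     loop. *)
  case: (eqVneq t' q') => [eq|/eqP neq]; last by right; exists t', q'.
  by left; rewrite -c -e eq.
case: h3 => [->|[t' [q' [_ a b c e]]]]; first by rewrite eqxx.
apply/orP; right; apply/existsP; exists t'; apply/existsP; exists q'.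
by rewrite a c e !eqxx /= andbT -a; apply/eqP.
Qed.

Lemma conflict_sym g t q : conflict g t q -> conflict g q t.
Proof.
case/conflictP => h1 h2 h3; apply/conflictP; split => //; first by move/esym.
case: h3 => [->|[t' [q' [a b c e f]]]]; [by left|right; exists q', t'; split => //].
  by move/esym.
by rewrite -b h2.
Qed.

Lemma bad_loop g t q : q <> t -> q.1 = t.1 -> g q = g t -> bad g t.
Proof. by move=> h1 h2 h3; apply/existsP; exists q; apply/conflictP; split=> //; left. Qed.

Lemma tuple_nbr_mem A a t : a \in A -> t.1 = a.1 -> t \in tuple_nbr A.
Proof. by move=> h1 h2; rewrite inE; apply/existsP; exists a; rewrite h1 h2 eqxx. Qed.

Lemma vertex_nbr_mem g A a t : a \in A -> g t = g a -> t \in vertex_nbr g A.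
Proof. by move=> h1 h2; rewrite inE; apply/existsP; exists a; rewrite h1 h2 eqxx. Qed.

Lemma card_tuple_nbr A : (#|tuple_nbr A| <= r * #|A|)%N.
Proof.
apply: card_exists_le => a _; rewrite -[r in leqRHS]card_ord.
rewrite -(@card_imset _ _ (fun i : 'I_r => (a.1, i))); last by move=> i j [].
apply: subset_leq_card; apply/subsetP => -[w i]; rewrite inE => /eqP /= ->.
exact: imset_f.
Qed.

Section FixedDegrees.
Variable g : {ffun T -> 'I_n}.
Hypothesis hg : forall v, cnt g v = d.

Lemma card_vertex_nbr A : (#|vertex_nbr g A| <= d * #|A|)%N.
Proof. by apply: card_exists_le => a _; rewrite -(hg (g a)). Qed.

Lemma sub_tuple_nbr A a : a \in A -> a \in tuple_nbr A.
Proof. by move=> h; apply: tuple_nbr_mem h _. Qed.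

Lemma sub_vertex_nbr A a : a \in A -> a \in vertex_nbr g A.
Proof. by move=> h; apply: vertex_nbr_mem h _. Qed.

(** The clones at [p] and [b] are to be exchanged. [near1] holds the slots [b] whose vertex could
    conflict once it enters the tuple of [p]; [near2] those whose tuple could conflict once the
    vertex of [p] enters it. *)
Definition near1 p := vertex_nbr g (tuple_nbr (vertex_nbr g (tuple_nbr [set p]))).
Definition near2 p := tuple_nbr (vertex_nbr g (tuple_nbr (vertex_nbr g [set p]))).

Lemma card_near1 p : (#|near1 p| <= (r * d) ^ 2)%N.
Proof.
apply: leq_trans (card_vertex_nbr _) _.
apply: (@leq_trans (d * (r * (d * (r * 1))))); last by lia.
rewrite leq_mul2l; apply/orP; right; apply: leq_trans (card_tuple_nbr _) _.
rewrite leq_mul2l; apply/orP; right; apply: leq_trans (card_vertex_nbr _) _.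
rewrite leq_mul2l; apply/orP; right; apply: leq_trans (card_tuple_nbr _) _.
by rewrite cards1.
Qed.

Lemma card_near2 p : (#|near2 p| <= (r * d) ^ 2)%N.
Proof.
apply: leq_trans (card_tuple_nbr _) _.
apply: (@leq_trans (r * (d * (r * (d * 1))))); last by lia.
rewrite leq_mul2l; apply/orP; right; apply: leq_trans (card_vertex_nbr _) _.
rewrite leq_mul2l; apply/orP; right; apply: leq_trans (card_tuple_nbr _) _.
rewrite leq_mul2l; apply/orP; right; apply: leq_trans (card_vertex_nbr _) _.
by rewrite cards1.
Qed.

Variables (p b : T).
Hypothesis b_near1 : b \notin near1 p.
Hypothesis b_good : ~~ bad g b.
Let g' : {ffun T -> 'I_n} := pcomp g (tperm p b).

Let p1 : p \in [set p]. Proof. by rewrite inE. Qed.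

Let neq_pb : p <> b.
Proof.
move=> e; move/negP: b_near1; apply; rewrite -e.
exact/sub_vertex_nbr/sub_tuple_nbr/sub_vertex_nbr/sub_tuple_nbr.
Qed.

Let ntup : b.1 <> p.1.
Proof.
move=> e; move/negP: b_near1; apply.
by apply/sub_vertex_nbr/sub_tuple_nbr/sub_vertex_nbr/(tuple_nbr_mem p1).
Qed.

Let nver : g b <> g p.
Proof.
move=> e; move/negP: b_near1; apply.
by apply: vertex_nbr_mem e; apply/sub_tuple_nbr/sub_vertex_nbr/sub_tuple_nbr.
Qed.

Let g'p : g' p = g b. Proof. by rewrite ffunE tpermL. Qed.
Let g'b : g' b = g p. Proof. by rewrite ffunE tpermR. Qed.
Let g'o t : t <> p -> t <> b -> g' t = g t.
Proof. by move=> /eqP h1 /eqP h2; rewrite ffunE tpermD // eq_sym. Qed.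

Let nloop q : q <> b -> q.1 = b.1 -> g q <> g b.
Proof. by move=> h1 h2 h3; move/negP: b_good; apply; apply: bad_loop h3. Qed.

(** Stated before [near2] is excluded: in the reverse count of switchings only this half is
    available. *)
Lemma swapped_slot_good : ~~ bad g' p.
Proof.
apply/negP => /existsP[q /conflictP[h1 h2 h3]].
have qb : q <> b by move=> e; apply: ntup; rewrite -e.
have qt : q \in tuple_nbr [set p] by apply: tuple_nbr_mem h2.
case: h3 => [|[t' [q' [a e f i j]]]].
  rewrite g'p g'o // => e; move/negP: b_near1; apply.
  by apply: (@vertex_nbr_mem _ _ q) => //; apply/sub_tuple_nbr/sub_vertex_nbr.
have t'p : t' <> p by move=> x; apply: f; rewrite x.
have q'p : q' <> p by move=> x; apply: f; rewrite e x.
rewrite g'p in i; rewrite (g'o h1 qb) in j.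
case: (eqVneq t' b) i => [->|/eqP t'b]; first by rewrite g'b => /esym.
rewrite g'o // => i; case: (eqVneq q' b) j => [eb|/eqP q'b].
  by case: (@nloop t') => //; rewrite e eb.
rewrite g'o // => j; move/negP: b_near1; apply.
by apply: (@vertex_nbr_mem _ _ t') => //; apply: (@tuple_nbr_mem _ q') => //; apply: (@vertex_nbr_mem _ _ q).
Qed.

Hypothesis b_near2 : b \notin near2 p.

Let swap_b q : conflict g' b q -> False.
Proof.
case/conflictP => h1 h2 h3.
have qp : q <> p by move=> e; apply: ntup; rewrite -h2 e.
have pv : p \in vertex_nbr g [set p] by apply: sub_vertex_nbr.
case: h3 => [|[t' [q' [a e f i j]]]].
  rewrite g'b g'o // => e; move/negP: b_near2; apply.
  by apply: (@tuple_nbr_mem _ q) => //; apply: (@vertex_nbr_mem _ _ p) => //; apply/sub_tuple_nbr.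
have t'b : t' <> b by move=> x; apply: f; rewrite x.
have q'b : q' <> b by move=> x; apply: f; rewrite e x.
rewrite g'b in i; rewrite (g'o qp h1) in j.
case: (eqVneq t' p) i => [->|/eqP t'p]; first by rewrite g'p.
rewrite g'o // => i; case: (eqVneq q' p) j => [->|/eqP q'p].
  by rewrite g'p => /esym /nloop; apply.
rewrite g'o // => j; move/negP: b_near2; apply.
apply: (@tuple_nbr_mem _ q) => //; apply: (@vertex_nbr_mem _ _ q') => //.
by apply: (@tuple_nbr_mem _ t') => //; apply: (@vertex_nbr_mem _ _ p).
Qed.

Let swap_other t q : t <> p -> t <> b -> q <> p -> q <> b ->
  conflict g' t q -> conflict g t q.
Proof.
move=> tp tb qp qb /conflictP[h1 h2 h3]; apply/conflictP; split => //.
rewrite !g'o // in h3; case: h3 => [->|[t' [q' [a e f i j]]]]; first by left.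
have key x y u v : x <> y -> x.1 = y.1 -> g' x = g u -> g' y = g v -> u.1 = v.1 ->
    x <> p /\ x <> b.
  move=> xy exy hx hy euv; split => [xp|xb].
    rewrite xp g'p in hx.
    have yb : y <> b by move=> yb; apply: ntup; rewrite -yb -exy xp.
    have yp : y <> p by move=> yp; apply: xy; rewrite xp yp.
    rewrite g'o // in hy; move/negP: b_near1; apply.
    apply: (@vertex_nbr_mem _ _ u) => //; apply: (@tuple_nbr_mem _ v) => //.
    by apply: (@vertex_nbr_mem _ _ y) => //; apply: (@tuple_nbr_mem _ p) => //; rewrite -exy xp.
  rewrite xb g'b in hx.
  have yp : y <> p by move=> yp; apply: ntup; rewrite -yp -exy xb.
  have yb : y <> b by move=> yb; apply: xy; rewrite xb yb.
  rewrite g'o // in hy; move/negP: b_near2; apply.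
  apply: (@tuple_nbr_mem _ y); last by rewrite -exy xb.
  apply: (@vertex_nbr_mem _ _ v) => //; apply: (@tuple_nbr_mem _ u) => //.
  by apply: (@vertex_nbr_mem _ _ p).
have [] := key t' q' t q => // t'p t'b.
have [] := key q' t' q t => // [/esym //|q'p q'b].
by rewrite g'o // in i; rewrite g'o // in j; right; exists t', q'.
Qed.

(** A new conflict would have to use slot [p] or [b], as one of the two conflicting slots or as a
    witness in another tuple. Each case puts [b] into [near1] or [near2], or exhibits a loop at the
    good slot [b]. *)
Lemma swap_bad_sub : [set t | bad g' t] \subset [set t | bad g t] :\ p.
Proof.
apply/subsetP => t; rewrite !inE => ht.
have tp : t != p by apply: contraTneq ht => ->; apply: swapped_slot_good.
rewrite tp /=; case/existsP: ht => q hq.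
have qp : q <> p.
  move=> e; move/negP: swapped_slot_good; apply; apply/existsP; exists t.
  by rewrite -e; apply: conflict_sym.
have tb : t <> b by move=> e; apply: (@swap_b q); rewrite -e.
have qb : q <> b by move=> e; apply: (@swap_b t); rewrite -e; apply: conflict_sym.
by apply/existsP; exists q; apply: swap_other => //; apply/eqP.
Qed.

End FixedDegrees.
End BadSlots.

Lemma leq_double_mul (N M c D : nat) :
  (N <= 2 * M -> M * c <= D -> N * c <= 2 * D)%N.
Proof.
move=> h1 h2; apply: (@leq_trans (2 * M * c)); first by rewrite leq_mul2r h1 orbT.
by rewrite -mulnA leq_mul2l h2 orbT.
Qed.

Section SimpleLowerBound.
Variables (n d r m : nat).
Notation T := ('I_m * 'I_r)%type.
Variable vtx : {ffun T -> 'I_n}.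
Hypothesis hvtx : forall v, cnt vtx v = d.
Hypothesis r_gt1 : (1 < r)%N.
Implicit Types (s : {perm T}).

Let gof s := pcomp vtx s.
Let hgof s v : cnt (gof s) v = d. Proof. by rewrite cnt_pcomp hvtx. Qed.

Lemma nbad0_simple s : nbad (gof s) = 0%N -> simple vtx s.
Proof.
move=> /cards0_eq h.
have nb t : ~~ bad (gof s) t.
  by apply/negP => ht; have := in_set0 t; rewrite -h inE ht.
have inj w i j : vtx (s (w, i)) = vtx (s (w, j)) -> i = j.
  move=> e; case: (eqVneq i j) => // /eqP ij; move/negP: (nb (w, j)); case.
  by apply: (@bad_loop _ _ _ _ _ (w, i)); rewrite // ?ffunE // => -[].
apply/andP; split.
  apply/forallP => w; rewrite card_imset ?card_ord //; exact: inj.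
apply/injectiveP => w w' e; case: (eqVneq w w') => // /eqP ww'.
pose i0 : 'I_r := Ordinal (ltnW r_gt1); pose i1 : 'I_r := Ordinal r_gt1.
have := mem_edge vtx s (w, i0); have := mem_edge vtx s (w, i1).
rewrite /= e => /imsetP[j1 _ e1] /imsetP[j0 _ e0].
move/negP: (nb (w, i0)); case; apply/existsP; exists (w, i1).
apply/conflictP; split => //=; right; exists (w', j0), (w', j1); rewrite !ffunE.
split => //=; last by move/esym.
move=> [ej]; have : i0 = i1 by apply: (inj w); rewrite e0 e1 ej.
by [].
Qed.

Lemma pair_coincide p q : p != q ->
  (#|{: T}|.-1 * #|[set s | gof s q == gof s p]| <= d * #|{: T}|`!)%N.
Proof.
move=> pq; have -> : #|{: T}|`! = #|[set s : {perm T} | predT s]|.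
  by rewrite -card_permT; apply: eq_card => s; rewrite !inE.
have -> : #|{: T}|.-1 = #|[set~ p]| by rewrite cardsC1.
apply: (@swap_average _ (fun s b => gof s b == gof s p) predT) => //.
- by rewrite !inE eq_sym.
- move=> b s; rewrite !inE => bp; rewrite !ffunE !permM tpermL.
  by rewrite (@tpermD _ q b p) // eq_sym.
- move=> s; rewrite -(hgof s (gof s p)); apply: subset_leq_card.
  by apply/subsetP => b; rewrite !inE => /andP[].
Qed.

Lemma quad_coincide p q p' q' : uniq [:: p; q; p'; q'] ->
  ((#|{: T}| - 3) * #|[set s | (gof s p' == gof s p) && (gof s q' == gof s q)]| <=
   d * #|[set s | gof s p' == gof s p]|)%N.
Proof.
rewrite /= !inE !negb_or !andbT => /andP[/and3P[pq pp' pq'] /andP[/andP[qp' qq'] p'q']].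
apply: (@leq_trans (#|~: [set p; q; p']| *
    #|[set s | (gof s p' == gof s p) && (gof s q' == gof s q)]|)).
  rewrite leq_mul2r; apply/orP; right; rewrite cardsCs setCK leq_sub2l //.
  apply: leq_trans (leq_card_setU _ _) _; rewrite cards1 addn1 ltnS.
  by rewrite cards2; case: (p != q).
apply: (@swap_average _ (fun s b => (gof s p' == gof s p) && (gof s b == gof s q))
          (fun s => gof s p' == gof s p)).
- by rewrite !inE !negb_or; rewrite ![q' == _]eq_sym pq' qq' p'q'.
- move=> b s; rewrite !inE !negb_or => /andP[/andP[bp bq] bp'].
  rewrite !ffunE !permM tpermL.
  rewrite (@tpermD _ q' b p) ?(@tpermD _ q' b q) ?(@tpermD _ q' b p') //.
  1-3: by rewrite eq_sym.
- by move=> s b /andP[].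
- move=> s; rewrite -(hgof s (gof s q)); apply: subset_leq_card.
  by apply/subsetP => b; rewrite !inE => /and3P[].
Qed.

(** Union bound with [N] slots: at most [N r] pairs, each a loop with probability at most
    [d / (N - 1)], and at most [(N r)^2] double pairs, each repeated with probability at most
    [d^2 / ((N - 1) (N - 3))]. From [N >= 6] on, each denominator is at least [N / 2]. *)
Lemma sum_nbad : (6 <= #|{: T}|)%N ->
  (\sum_s nbad (gof s) <= (2 * (r * d) + 4 * (r * d) ^ 2) * #|{: T}|`!)%N.
Proof.
move=> hT; set N := #|{: T}|.
pose pairs := [set x : T * T | (x.1 != x.2) && (x.2.1 == x.1.1)].
pose quads := [set x : (T * T) * (T * T) |
  [&& uniq [:: x.1.1; x.1.2; x.2.1; x.2.2], x.1.2.1 == x.1.1.1 & x.2.2.1 == x.2.1.1]].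
have hpairs : (#|pairs| <= N * r)%N.
  have -> : (N * r = #|{: T * 'I_r}|)%N by rewrite card_prod card_ord.
  pose phi (x : T * T) := (x.1, x.2.2).
  rewrite -(@card_in_imset _ _ phi); first exact: max_card.
  move=> [[a1 a2] [b1 b2]] [[c1 c2] [e1 e2]]; rewrite !inE /= => /andP[_ /eqP ->].
  by move=> /andP[_ /eqP ->] [-> -> ->].
have hquads : (#|quads| <= (N * r) ^ 2)%N.
  have -> : ((N * r) ^ 2 = #|{: (T * 'I_r) * (T * 'I_r)}|)%N.
    by rewrite !card_prod !card_ord /N card_prod !card_ord mulnn.
  pose phi (x : (T * T) * (T * T)) := ((x.1.1, x.1.2.2), (x.2.1, x.2.2.2)).
  rewrite -(@card_in_imset _ _ phi); first exact: max_card.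
  move=> [[[a1 a2] [b1 b2]] [[c1 c2] [e1 e2]]] [[[a1' a2'] [b1' b2']] [[c1' c2'] [e1' e2']]].
  rewrite !inE => /and3P[_ /= /eqP -> /eqP ->] /and3P[_ /= /eqP -> /eqP ->].
  by rewrite /phi /= => -[-> -> -> -> -> ->].
have step s : (nbad (gof s) <=
    \sum_(x in pairs) (gof s x.2 == gof s x.1) +
    \sum_(x in quads) ((gof s x.2.1 == gof s x.1.1) && (gof s x.2.2 == gof s x.1.2)))%N.
  rewrite -!big_mkcondr /= !sum1_card.
  set P1 := (X in (_ <= #|X| + _)%N); set P2 := (X in (_ <= _ + #|X|)%N).
  apply: (@leq_trans (#|[set x.1 | x in P1] :|: [set x.1.1 | x in P2]|)).
    apply: subset_leq_card; apply/subsetP => t; rewrite inE => /existsP[q /conflictP[h1 h2 h3]].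
    rewrite inE; apply/orP; case: h3 => [h3|[t' [q' [h3 h4 h5 h6 h7]]]]; [left|right].
      apply/imsetP; exists (t, q) => //; rewrite unfold_in /= inE /= h2 h3 !eqxx !andbT.
      by rewrite eq_sym; apply/eqP.
    apply/imsetP; exists ((t, q), (t', q')) => //.
    rewrite unfold_in /= inE /= h2 h4 h6 h7 !eqxx !inE !negb_or !andbT.
    have ne x y : x.1 <> y.1 -> x != y :> T by move=> h; apply/eqP => e; apply: h; rewrite e.
    rewrite [t == q]eq_sym (introN eqP h1) (introN eqP h3) !ne ?h2 -?h4 //=;
      by move/esym.
  by apply: leq_trans (leq_card_setU _ _) _; apply: leq_add; apply: leq_imset_card.
apply: leq_trans; first by apply: leq_sum => s _; exact: step.
rewrite big_split /= mulnDl; apply: leq_add.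
  rewrite exchange_big /=.
  apply: (@leq_trans (\sum_(x in pairs) #|[set s | gof s x.2 == gof s x.1]|)).
    apply: eq_leq; apply: eq_bigr => x _; rewrite -big_mkcond sum1_card.
    by apply: eq_card => s; rewrite !inE.
  rewrite -(leq_pmul2l (_ : 0 < N)%N); last by rewrite /N; lia.
  rewrite big_distrr /=.
  apply: (@leq_trans (\sum_(x in pairs) 2 * (d * N`!))%N).
    apply: leq_sum => x; rewrite inE => /andP[h _]; have := pair_coincide h; rewrite -/N.
    by apply: leq_double_mul; rewrite /N; lia.
  rewrite sum_nat_const; apply: (@leq_trans (N * r * (2 * (d * N`!)))).
    by rewrite leq_mul2r hpairs orbT.
  by apply: eq_leq; ring.
rewrite exchange_big /=.
apply: (@leq_trans (\sum_(x in quads) #|[set s | (gof s x.2.1 == gof s x.1.1)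
     && (gof s x.2.2 == gof s x.1.2)]|)).
  apply: eq_leq; apply: eq_bigr => x _; rewrite -big_mkcond sum1_card.
  by apply: eq_card => s; rewrite !inE.
rewrite -(leq_pmul2l (_ : 0 < N ^ 2)%N); last by rewrite expn_gt0 /N; lia.
rewrite big_distrr /=.
apply: (@leq_trans (\sum_(x in quads) 4 * (d ^ 2 * N`!))%N).
  apply: leq_sum => x; rewrite inE => /and3P[h _ _].
  have h1 := quad_coincide h; have h2 : x.1.1 != x.2.1.
    by move: h; rewrite /= !inE !negb_or => /andP[/and3P[]].
  have h3 := pair_coincide h2; rewrite -/N in h1 h3.
  have k1 : (N <= 2 * N.-1)%N by rewrite /N; lia.
  have k2 : (N <= 2 * (N - 3))%N by rewrite /N; lia.
  set a := #|_| in h1 *; set c := #|_| in h1 h3.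
  have u1 := leq_double_mul k1 h3; have u2 := leq_double_mul k2 h1.
  rewrite expnS expn1 -mulnA.
  apply: (@leq_trans (N * (2 * (d * c)))); first by rewrite leq_mul2l u2 orbT.
  apply: (@leq_trans (2 * d * (2 * (d * N`!)))); last by rewrite expnS expn1; nia.
  by rewrite mulnCA -!mulnA leq_mul2l /= mulnCA leq_mul2l u1 orbT.
rewrite sum_nat_const; apply: (@leq_trans ((N * r) ^ 2 * (4 * (d ^ 2 * N`!)))).
  by rewrite leq_mul2r hquads orbT.
by rewrite !expnMn; apply: eq_leq; ring.
Qed.

Let gof_tperm p b s : gof (tperm p b * s)%g = pcomp (gof s) (tperm p b).
Proof. by apply/ffunP => t; rewrite !ffunE permM. Qed.

(* Swapping a bad slot with a generic one lowers the number of bad slots, and a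
   configuration arises from few such swaps. *)
Lemma switching_step (J j : nat) :
  let C := (2 * (r * d) ^ 2 + J)%N in
  (2 * C <= #|{: T}|)%N -> (0 < #|{: T}|)%N -> (j < J)%N ->
  (#|[set s | nbad (gof s) <= j.+1]| <= (1 + 2 * C) * #|[set s | nbad (gof s) <= j]|)%N.
Proof.
move=> C hC N0 jJ; set N := #|{: T}| in hC N0 *.
pose D := [set s | nbad (gof s) == j.+1].
set c := #|[set s | (nbad (gof s) <= j)%N]|.
have -> : [set s | (nbad (gof s) <= j.+1)%N] = D :|: [set s | (nbad (gof s) <= j)%N].
  by apply/setP => s; rewrite !inE leq_eqVlt ltnS.
apply: leq_trans (leq_card_setU _ _) _; rewrite mulnDl mul1n addnC leq_add2l.
(* [X] is the set of forward switchings: at least [N - C] from each configuration with [j + 1] bad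
   slots. [Y] contains their images, at most [N C] over each configuration with at most [j] bad
   slots. *)
pose X := [set x : {perm T} * (T * T) | [&& x.1 \in D, bad (gof x.1) x.2.1 &
   x.2.2 \notin near1 (gof x.1) x.2.1 :|: near2 (gof x.1) x.2.1 :|: [set t | bad (gof x.1) t]]].
pose Y := [set x : {perm T} * (T * T) | (nbad (gof x.1) <= j)%N
   && bad (gof (tperm x.2.1 x.2.2 * x.1)%g) x.2.1].
have hX : (#|D| * (N - C) <= #|X|)%N.
  rewrite -sum_nat_const -sum1_card.
  rewrite (partition_big (fun x : {perm T} * (T * T) => x.1) (mem D)) /=; last first.
    by move=> x; rewrite inE => /and3P[].
  apply: leq_sum => s sD; rewrite sum1_card.
  have [p hp] : exists p, bad (gof s) p.
    have : (0 < nbad (gof s))%N by move: sD; rewrite inE => /eqP ->.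
    by case/card_gt0P => p; rewrite inE; exists p.
  pose E := near1 (gof s) p :|: near2 (gof s) p :|: [set t | bad (gof s) t].
  apply: (@leq_trans #|~: E|).
    rewrite cardsCs setCK leq_sub2l //.
    apply: leq_trans (leq_card_setU _ _) _.
    apply: leq_add; last by move: sD; rewrite inE /nbad => /eqP ->.
    apply: leq_trans (leq_card_setU _ _) _; rewrite mul2n -addnn.
    by apply: leq_add; [apply: card_near1|apply: card_near2].
  rewrite -(@card_imset _ _ (fun b => (s, (p, b)))); last by move=> b b' [].
  apply: subset_leq_card; apply/subsetP => _ /imsetP[b hb ->].
  by rewrite unfold_in /= inE /= sD hp eqxx andbT; move: hb; rewrite /E inE.
have hXY : (#|X| <= #|Y|)%N.
  pose phi (x : {perm T} * (T * T)) := ((tperm x.2.1 x.2.2 * x.1)%g, x.2).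
  rewrite -(@card_imset _ _ phi); last first.
    by move=> [s [p b]] [s' [p' b']] [e1 e2 e3]; move: e1; rewrite e2 e3 => /mulgI ->.
  apply: subset_leq_card; apply/subsetP => _ /imsetP[[s [p b]] hx ->].
  move: hx; rewrite inE /= => /and3P[sD hp]; rewrite !in_setU !negb_or.
  move=> /andP[/andP[b1 b2] b3]; rewrite inE /= mulgA tperm2 mul1g hp andbT.
  rewrite gof_tperm; have b3' : ~~ bad (gof s) b by move: b3; rewrite inE.
  have := subset_leq_card (swap_bad_sub b1 b3' b2).
  move: sD; rewrite inE /nbad => /eqP; rewrite (cardsD1 p) inE hp add1n => -[<-].
  by [].
have hY : (#|Y| <= c * (N * C))%N.
  rewrite /c -sum1_card -sum_nat_const.
  rewrite (partition_big (fun x : {perm T} * (T * T) => x.1)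
     (mem [set s | (nbad (gof s) <= j)%N])) /=; last first.
    by move=> x; rewrite !inE => /andP[].
  apply: leq_sum => s; rewrite inE => hs.
  rewrite /N -sum_nat_const.
  rewrite (partition_big (fun x : {perm T} * (T * T) => x.2.1) predT) //=.
  apply: leq_sum => p _; rewrite sum1_card.
  apply: (@leq_trans #|near1 (gof s) p :|: [set t | bad (gof s) t]|).
    rewrite -[leqRHS](@card_imset _ _ (fun b : T => (s, (p, b)))); last by move=> b b' [].
    apply: subset_leq_card; apply/subsetP => -[s' [p' b]].
    rewrite unfold_in /= inE /= => /andP[/andP[/andP[_ hb] /eqP e1] /eqP e2].
    subst s' p'; apply: imset_f; move: hb; rewrite gof_tperm in_setU.
    case: (boolP (b \in near1 _ _)) => //= b1; case: (boolP (b \in _)) => //.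
    by rewrite inE => b2; rewrite (negbTE (swapped_slot_good b1 b2)).
  apply: leq_trans (leq_card_setU _ _) _; apply: leq_add.
    by apply: leq_trans (card_near1 (hgof s) p) _; rewrite leq_pmull.
  by apply: leq_trans hs _; apply: ltnW.
have h := leq_trans hX (leq_trans hXY hY).
have h2 : (N <= 2 * (N - C))%N by lia.
rewrite mulnC in h; have := leq_double_mul h2 h.
have -> : (2 * (c * (N * C)) = N * (2 * C * c))%N by ring.
by rewrite leq_pmul2l.
Qed.

(** By Markov's inequality at least half of the configurations have at most [J] bad slots, [J]
    exceeding twice the mean; [J] switching steps, each costing a factor [1 + 2 C], then reach
    zero. *)
Lemma simple_card_ge :
  let e := (2 * (r * d) + 4 * (r * d) ^ 2)%N in
  let J := (2 * e).+1 in
  let C := (2 * (r * d) ^ 2 + J)%N in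
  (2 * C <= #|{: T}|)%N -> (6 <= #|{: T}|)%N ->
  (#|{: T}|`! <= 2 * (1 + 2 * C) ^ J * #|[set s | simple vtx s]|)%N.
Proof.
move=> e J C hC hT; pose c (j : nat) := #|[set s | (nbad (gof s) <= j)%N]|.
have h1 : (#|{: T}|`! <= 2 * c J)%N.
  have hs := sum_nbad hT; rewrite -/e in hs.
  have hc : (c J + #|~: [set s | (nbad (gof s) <= J)%N]| = #|{: T}|`!)%N.
    by rewrite cardsC card_permT.
  have : (#|~: [set s | (nbad (gof s) <= J)%N]| * (2 * e).+2 <= e * #|{: T}|`!)%N.
    apply: leq_trans hs; rewrite -sum_nat_const.
    rewrite [leqRHS](bigID (fun s => s \in ~: [set s | (nbad (gof s) <= J)%N])) /=.
    apply: leq_trans (leq_addr _ _); apply: leq_sum => s.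
    by rewrite !inE -ltnNge.
  by rewrite -hc; set x := #|_|; set y := c J; nia.
apply: leq_trans h1 _; rewrite -mulnA leq_mul2l /=.
have h2 j : (j <= J)%N -> (c j <= (1 + 2 * C) ^ j * c 0)%N.
  elim: j => [|j IH] hj; first by rewrite expn0 mul1n.
  apply: leq_trans (switching_step hC _ hj) _; first by lia.
  by rewrite (expnS _ j) -[leqRHS]mulnA; apply: leq_mul => //; apply: IH; apply: ltnW.
apply: leq_trans (h2 J (leqnn _)) _; rewrite leq_mul2l; apply/orP; right.
apply: subset_leq_card; apply/subsetP => s; rewrite !inE leqn0 => /eqP.
exact: nbad0_simple.
Qed.

End SimpleLowerBound.

(** * Small sets are sparse *)

(** Sampling without replacement is no more likely to stay in [D] than sampling with replacement,
    because [(#|D| - j) / (#|T| - j) <= #|D| / #|T|]. *)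
Lemma perm_into_le (T : finType) (A D : {set T}) :
  (#|T| ^ #|A| * #|[set s : {perm T} | [forall a in A, s a \in D]]| <= #|D| ^ #|A| * #|T|`!)%N.
Proof.
elim: {A}#|A| {-2}A (erefl #|A|) => [|j IH] A hA.
  by rewrite hA !expn0 !mul1n -card_permT max_card.
have [a aA] : exists a, a \in A by apply/set0Pn; rewrite -card_gt0 hA.
pose A' := A :\ a; have hA' : #|A'| = j.
  by have := cardsD1 a A; rewrite aA hA add1n => -[<-].
have aA' : a \notin A' by rewrite !inE eqxx.
pose P (s : {perm T}) := [forall x in A', s x \in D].
have hP (s : {perm T}) : [forall x in A, s x \in D] = P s && (s a \in D).
  apply/forall_inP/andP => [h|[/forall_inP h ha] x xA].
    by split; [apply/forall_inP => x /setD1P[_]; apply: h|apply: h].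
  by case: (eqVneq x a) => [->|xa] //; apply: h; rewrite !inE xa.
have step : (#|~: A'| * #|[set s : {perm T} | P s && (s a \in D)]| <=
    (#|D| - j) * #|[set s | P s]|)%N.
  apply: (@swap_average _ (fun (s : {perm T}) b => P s && (s b \in D)) P).
  - by rewrite inE.
  - move=> b s; rewrite inE => bA'; rewrite permM tpermL; congr andb.
    apply: eq_forallb => x; case: (boolP (x \in A')) => //= xA'.
    rewrite permM tpermD //; first by apply: contraNneq aA' => ->.
    by apply: contraNneq bA' => ->.
  - by move=> s b /andP[].
  - move=> s; case: (boolP (P s)) => [/forall_inP hs|_]; last first.
      by rewrite (_ : [set b in _ | _] = set0) ?cards0 //; apply/setP => b; rewrite !inE andbF.
    have hsub : [set s x | x in A'] \subset D by apply/subsetP => _ /imsetP[x xA ->]; exact: hs.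
    rewrite -hA' -[#|A'|](card_imset _ (@perm_inj _ s)) -cardsDS //.
    rewrite -[leqLHS](card_imset _ (@perm_inj _ s)); apply: subset_leq_card.
    apply/subsetP => _ /imsetP[b /setIdP[bA /= bD] ->].
    rewrite !inE bD andbT; apply/imsetP => -[x xA /perm_inj e].
    by move: bA; rewrite inE e xA.
have hN : (j < #|T|)%N by rewrite -hA; apply: max_card.
have hcA : #|~: A'| = (#|T| - j)%N by rewrite cardsCs setCK hA'.
have hD : (#|D| <= #|T|)%N := max_card _.
have IH' := IH A' hA'; rewrite hA' in IH'.
rewrite (_ : [set s : {perm T} | _] = [set s : {perm T} | P s && (s a \in D)]); last first.
  by apply/setP => s; rewrite !inE hP.
move: step; rewrite hcA; set x := #|[set s | P s && _]|; set y := #|[set s | P s]| => step.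
have xy : (#|T| * x <= #|D| * y)%N.
  rewrite -(@leq_pmul2l (#|T| - j)) ?subn_gt0 //.
  apply: (@leq_trans (#|T| * ((#|D| - j) * y))).
    by rewrite mulnCA leq_mul2l step orbT.
  have : (#|T| * (#|D| - j) <= #|D| * (#|T| - j))%N.
    by rewrite !mulnBr [(#|T| * #|D|)%N]mulnC leq_sub2l // leq_mul2r hD orbT.
  move=> hh; rewrite mulnA; apply: (@leq_trans (#|D| * (#|T| - j) * y)).
    by rewrite leq_mul2r hh orbT.
  by apply: eq_leq; ring.
rewrite hA !expnS; apply: (@leq_trans (#|T| ^ j * (#|D| * y))).
  by rewrite -mulnA mulnCA leq_mul2l xy orbT.
by rewrite mulnCA -mulnA leq_mul2l IH' orbT.
Qed.

Lemma bin_le_pow (n u : nat) : (0 < u)%N ->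
  'C(n, u)%:R <= (exp 1 * n%:R / u%:R) ^+ u :> R.
Proof.
move=> u0; have uR : (0 : R) < u%:R by rewrite ltr0n.
rewrite exprMn exprVn ler_pdivlMr ?exprn_gt0 // exprMn exprX mulr1.
have h : ('C(n, u) * u`! <= n ^ u)%N.
  rewrite bin_ffact ffact_prod -[u in leqRHS]card_ord -prod_nat_const.
  by apply: leq_prod => i _; apply: leq_subr.
apply: (@le_trans _ _ ('C(n, u)%:R * (u`!%:R * exp u%:R))).
  by rewrite ler_wpM2l ?factorial_ge.
by rewrite mulrA mulrC ler_wpM2l ?exp_ge0 // -natrM -natrX ler_nat.
Qed.

Lemma sum_card_sets (n : nat) (G : nat -> R) :
  \sum_(U : {set 'I_n}) G #|U| = \sum_(u < n.+1) 'C(n, u)%:R * G u.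
Proof.
have hU (U : {set 'I_n}) : (#|U| < n.+1)%N by rewrite ltnS -[leqRHS]card_ord max_card.
rewrite (partition_big (fun U : {set 'I_n} => Ordinal (hU U)) predT) //=.
apply: eq_bigr => u _; rewrite (eq_bigr (fun=> G u)); last by move=> U /eqP <-.
rewrite sumr_const -[LHS]mulr_natl; congr (_%:R * _).
rewrite -[X in 'C(X, _)](card_ord n) -card_draws.
by apply: eq_card => U; rewrite !inE.
Qed.

Section SparseSets.
Variables (n d r m : nat).
Notation T := ('I_m * 'I_r)%type.
Variable vtx : {ffun T -> 'I_n}.
Hypothesis hvtx : forall v, cnt vtx v = d.
Hypothesis r_gt1 : (1 < r)%N.
Implicit Types (s : {perm T}) (U : {set 'I_n}).
Notation edge := (edge vtx).

(** The factor 2 serves both sides: it forces a vertex of degree below [2 r] inside [U], and it is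
    large enough for the union bound over [U] to converge already at [r = 2]. *)
Definition sparse h s := [forall U : {set 'I_n}, (0 < #|U| <= h)%N ==>
  (#|[set w | edge s w \subset U]| < 2 * #|U|)%N].

Lemma card_vertex_slots U : #|[set t | vtx t \in U]| = (d * #|U|)%N.
Proof.
rewrite -sum1_card (partition_big vtx (mem U)) /=; last by move=> t; rewrite inE.
rewrite mulnC -sum_nat_const; apply: eq_bigr => v vU.
rewrite -(hvtx v) /cnt -sum1_card; apply: eq_bigl => t; rewrite !inE.
by case: eqP => [->|]; rewrite ?vU ?andbF.
Qed.

Lemma edges_inside_le U (B : {set 'I_m}) : (0 < n)%N -> (0 < d)%N ->
  #|[set s | [forall w in B, edge s w \subset U]]|%:R <=
  (#|U|%:R / n%:R) ^+ (#|B| * r) * #|{: T}|`!%:R :> R.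
Proof.
move=> n0 d0; pose A : {set T} := setX B [set: 'I_r].
have hA : #|A| = (#|B| * r)%N by rewrite cardsX cardsT card_ord.
have hN : #|{: T}| = (n * d)%N by rewrite card_prod !card_ord (card_config hvtx).
have := perm_into_le A [set t | vtx t \in U].
rewrite card_vertex_slots hA => h.
have -> : [set s | [forall w in B, edge s w \subset U]] =
    [set s : {perm T} | [forall a in A, s a \in [set t | vtx t \in U]]].
  apply/setP => s; rewrite !inE; apply/forall_inP/forall_inP => [hs [w i]|hs w wB].
    rewrite !inE andbT /= => wB; apply: (subsetP (hs w wB)); exact: (mem_edge vtx s (w, i)).
  apply/subsetP => _ /imsetP[i _ ->]; have := hs (w, i).
  by rewrite !inE wB /= => /(_ isT).
move: h; set x := #|[set s : {perm T} | _]|; rewrite hN -(ler_nat R) !natrM !natrX !natrM => h.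
have nR : (0 : R) < n%:R by rewrite ltr0n.
have dR : (0 : R) < d%:R by rewrite ltr0n.
rewrite -(@ler_pM2l _ ((n%:R * d%:R) ^+ (#|B| * r))) ?exprn_gt0 ?mulr_gt0 //.
apply: le_trans h _; rewrite mulrA -exprMn.
rewrite (_ : n%:R * d%:R * (#|U|%:R / n%:R) = d%:R * #|U|%:R) //.
by field; rewrite gt_eqF.
Qed.

(** Union bound over [U] of size [u] and [2 u] tuples inside it. The terms are at most
    [(c u / n)^u]; the hypothesis on [h] makes their base at most 1/4, so the sum is of the order of
    its first term. *)
Lemma not_sparse_le (h : nat) : (0 < n)%N -> (0 < d)%N ->
  exp 3 * d%:R ^+ 2 / 4 * h%:R <= n%:R / 4 ->
  #|[set s | ~~ sparse h s]|%:R <= 2 * exp 3 * d%:R ^+ 2 / n%:R * #|{: T}|`!%:R :> R.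
Proof.
move=> n0 d0 hh.
have nR : (0 : R) < n%:R by rewrite ltr0n.
have dR : (1 : R) <= d%:R by rewrite ler1n.
set c := exp 3 * d%:R ^+ 2 / 4 in hh *.
have c0 : 0 < c by rewrite divr_gt0 ?mulr_gt0 ?exp_gt0 ?exprn_gt0 //; lra.
pose good := [pred x : {set 'I_n} * {set 'I_m} | (0 < #|x.1| <= h)%N && (#|x.2| == 2 * #|x.1|)%N].
have step1 : #|[set s | ~~ sparse h s]|%:R <= \sum_(x | good x)
   #|[set s | [forall w in x.2, edge s w \subset x.1]]|%:R :> R.
  rewrite -natr_sum ler_nat.
  apply: (@leq_trans (\sum_(x | good x) \sum_(s | [forall w in x.2, edge s w \subset x.1]) 1)).
    rewrite (exchange_big_dep predT) //= -sum1_card big_mkcond /=.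
    apply: leq_sum => s _; rewrite inE; case: ifP => // /forallPn[U].
    rewrite negb_imply -leqNgt => /andP[hU hw].
    have [B hB1 hB2] : exists2 B : {set 'I_m}, B \subset [set w | edge s w \subset U] &
        #|B| = (2 * #|U|)%N.
      have [B /andP[hB1 /eqP hB2]] : exists B : {set 'I_m},
          (B \subset [set w | edge s w \subset U]) && (#|B| == 2 * #|U|)%N.
        have /card_gt0P[B] : (0 < #|[set B : {set 'I_m} |
            B \subset [set w | edge s w \subset U] & #|B| == (2 * #|U|)%N]|)%N.
          by rewrite cards_draws bin_gt0.
        by rewrite inE; exists B.
      by exists B.
    rewrite (bigD1 (U, B)) //=; rewrite hU hB2 eqxx /=.
    by apply/forall_inP => w /(subsetP hB1); rewrite inE.
  apply: leq_sum => x _; rewrite sum1_card; apply: eq_leq.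
  by apply: eq_card => s; rewrite !inE.
apply: le_trans step1 _.
have step2 : \sum_(x | good x) #|[set s | [forall w in x.2, edge s w \subset x.1]]|%:R <=
   \sum_(x | good x) (#|x.1|%:R / n%:R) ^+ (2 * #|x.1| * r) * #|{: T}|`!%:R :> R.
  by apply: ler_sum => x /andP[_ /eqP <-]; apply: edges_inside_le.
apply: le_trans step2 _.
rewrite -mulr_suml ler_wpM2r //.
pose F (u : nat) : R := (u%:R / n%:R) ^+ (2 * u * r).
pose G (u : nat) : R := if (0 < u <= h)%N then 'C(m, 2 * u)%:R * F u else 0.
have -> : \sum_(x | good x) (#|x.1|%:R / n%:R) ^+ (2 * #|x.1| * r) =
   \sum_(u < n.+1) 'C(n, u)%:R * G u.
  rewrite -sum_card_sets -(pair_big_dep (fun U : {set 'I_n} => (0 < #|U| <= h)%N)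
    (fun (U : {set 'I_n}) (B : {set 'I_m}) => #|B| == (2 * #|U|)%N)
    (fun U B => (#|U|%:R / n%:R) ^+ (2 * #|U| * r) : R)) /= big_mkcond /=.
  apply: eq_bigr => U _; rewrite /G; case: ifP => // _.
  rewrite sumr_const -[LHS]mulr_natl; congr (_%:R * _).
  rewrite -[X in 'C(X, _)](card_ord m) -card_draws.
  by apply: eq_card => B; rewrite !inE.
have mn : (m <= n * d)%N by rewrite (card_config hvtx) leq_pmulr // ltnW.
have key (u : nat) : (0 < u <= h)%N -> 'C(n, u)%:R * ('C(m, 2 * u)%:R * F u) <=
    (c * u%:R / n%:R) ^+ u.
  case/andP=> u0 uh; have uR : (0 : R) < u%:R by rewrite ltr0n.
  have un : u%:R <= n%:R :> R.
    apply: (@le_trans _ _ h%:R); first by rewrite ler_nat.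
    have e3 := exp_ge1D 3; have dd : 1 <= d%:R ^+ 2 :> R by rewrite exprn_ege1.
    have hR : (0 : R) <= h%:R by [].
    have c1 : 1 <= c by rewrite /c; nra.
    nra.
  have b1 := bin_le_pow n u0.
  have b2 : 'C(m, 2 * u)%:R <= (exp 1 * (n%:R * d%:R) / (2 * u%:R)) ^+ (2 * u) :> R.
    apply: le_trans (bin_le_pow m _) _; first by rewrite muln_gt0.
    rewrite natrM lerXn2r ?nnegrE ?divr_ge0 ?mulr_ge0 ?exp_ge0 //.
    rewrite ler_wpM2r ?invr_ge0 ?mulr_ge0 // ler_wpM2l ?exp_ge0 //.
    by rewrite -natrM ler_nat.
  (* Here [r >= 2] enters: four factors [u / n] outweigh the three factors [n / u] coming from the
     two binomial coefficients. *)
  have b3 : F u <= (u%:R / n%:R) ^+ (4 * u).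
    rewrite /F; apply: ler_wiXn2l; first by rewrite divr_ge0.
      by rewrite ler_pdivrMr // mul1r.
    by rewrite [(4 * u)%N]mulnC (_ : 4 = 2 * 2)%N // mulnA [(u * 2)%N]mulnC leq_mul.
  have F0 : 0 <= F u by rewrite exprn_ge0 // divr_ge0.
  apply: (@le_trans _ _ ((exp 1 * n%:R / u%:R) ^+ u *
     ((exp 1 * (n%:R * d%:R) / (2 * u%:R)) ^+ (2 * u) * (u%:R / n%:R) ^+ (4 * u)))).
    by rewrite ler_pM ?mulr_ge0 // ler_pM.
  rewrite !exprM -!exprMn; rewrite le_eqVlt; apply/orP; left; apply/eqP; congr (_ ^+ _).
  rewrite /c (_ : exp 3 = exp 1 ^+ 3); last by rewrite exprX mulr1.
  field; rewrite !gt_eqF //.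
(* One factor [c u / n] is kept to supply the [1 / n]; the others are replaced by 1/4, and
   [u <= 2^u] absorbs the remaining [u]. *)
have geo (u : nat) : (0 < u <= h)%N -> (c * u%:R / n%:R) ^+ u <= 4 * c / n%:R * 2^-1 ^+ u.
  case/andP=> u0 uh; have uR : (0 : R) < u%:R by rewrite ltr0n.
  case: u u0 uh uR => // u _ uh uR; rewrite exprS.
  have q4 : c * u.+1%:R / n%:R <= 4^-1.
    rewrite ler_pdivrMr // [4^-1 * _]mulrC; apply: le_trans hh; rewrite ler_wpM2l ?(ltW c0) ?(ltW nR) //.
    by rewrite ler_nat.
  have q0 : 0 <= c * u.+1%:R / n%:R by rewrite divr_ge0 ?mulr_ge0 ?exp_ge0 ?exprn_ge0 ?invr_ge0 ?ler0n.
  apply: (@le_trans _ _ (c * u.+1%:R / n%:R * 4^-1 ^+ u)).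
    by rewrite ler_wpM2l // lerXn2r ?nnegrE // invr_ge0.
  have : u.+1%:R <= 2 ^+ u.+1 :> R by rewrite -natrX ler_nat ltnW // ltn_expl.
  set z : R := u.+1%:R => hz.
  have -> : c * z / n%:R * 4^-1 ^+ u = 4 * c / n%:R * (4^-1 ^+ u.+1 * z).
    by rewrite exprS; field; rewrite gt_eqF.
  rewrite ler_wpM2l ?divr_ge0 ?mulr_ge0 ?exp_ge0 ?exprn_ge0 ?invr_ge0 ?ler0n //.
  have -> : 2^-1 ^+ u.+1 = 4^-1 ^+ u.+1 * 2 ^+ u.+1 :> R.
    by rewrite -exprMn; congr (_ ^+ _); field.
  by rewrite ler_wpM2l // exprn_ge0 // invr_ge0.
apply: (@le_trans _ _ (\sum_(u < n.+1) 4 * c / n%:R * (2^-1 ^+ u : R))).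
  apply: ler_sum => u _; rewrite /G; case: ifP => hu.
    exact: le_trans (key _ hu) (geo _ hu).
  rewrite mulr0; apply: mulr_ge0; last by rewrite exprn_ge0 // invr_ge0.
  by rewrite divr_ge0 // mulr_ge0 // (ltW c0).
rewrite -mulr_sumr /c.
have hg : \sum_(u < n.+1) (2^-1 ^+ u : R) <= 2.
  have -> : \sum_(u < n.+1) (2^-1 ^+ u : R) = 2 - 2^-1 ^+ n.
    elim: (n) => [|k IH]; first by rewrite big_ord1 !expr0; lra.
    by rewrite big_ord_recr /= IH exprS; field.
  by rewrite gerBl exprn_ge0 // invr_ge0.
apply: (@le_trans _ _ (4 * (exp 3 * d%:R ^+ 2 / 4) / n%:R * 2)).
  by rewrite ler_wpM2l // divr_ge0 ?mulr_ge0 ?exp_ge0 ?exprn_ge0 ?invr_ge0 ?ler0n.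
rewrite le_eqVlt; apply/orP; left; apply/eqP.
by field; rewrite gt_eqF.
Qed.
End SparseSets.

(** * Partial colourings and their greedy completion *)

Section PartialColorings.
Variables (n d r m : nat).
Notation T := ('I_m * 'I_r)%type.
Variable vtx : {ffun T -> 'I_n}.
Hypothesis hvtx : forall v, cnt vtx v = d.
Hypothesis r_gt1 : (1 < r)%N.
Implicit Types (s : {perm T}) (U : {set 'I_n}).
Notation edge := (edge vtx).

Definition mono k (f : {ffun 'I_n -> 'I_k}) (e : {set 'I_n}) :=
  [exists c : 'I_k, [forall v in e, f v == c]].

Lemma monoPn k (f : {ffun 'I_n -> 'I_k}) (e : {set 'I_n}) u v :
  u \in e -> v \in e -> f u <> f v -> ~~ mono f e.
Proof.
move=> ue ve h; apply/negP => /existsP[c /forall_inP hc]; apply: h.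
by rewrite (eqP (hc u ue)) (eqP (hc v ve)).
Qed.

Lemma sparse_colorable h s U : simple vtx s -> sparse vtx h s -> (#|U| <= h)%N ->
  exists f : {ffun 'I_n -> 'I_(2 * r)},
    forall w, edge s w \subset U -> ~~ mono f (edge s w).
Proof.
move=> hs hsp; have hcard w : #|edge s w| = r by apply/eqP; case/andP: hs => /forallP.
have r0 : (0 < 2 * r)%N by lia.
elim: {U}#|U| {-2}U (erefl #|U|) => [|j IH] U hU Uh.
  exists [ffun=> Ordinal r0] => w hw; have := subset_leq_card hw.
  by rewrite hU hcard leqNgt ltnW.
pose deg v := #|[set w | (edge s w \subset U) && (v \in edge s w)]|.
(* Averaging: fewer than [2 #|U|] tuples lie inside [U] and each has [r] vertices, so some degree is
   below [2 r]. *)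
have [v vU hv] : exists2 v, v \in U & (deg v < 2 * r)%N.
  apply/exists_inP; rewrite -[X in is_true X]negbK negb_exists_in; apply/negP => /forall_inP h0.
  have : (2 * r * #|U| <= \sum_(v in U) deg v)%N.
    rewrite mulnC -sum_nat_const; apply: leq_sum => v /h0; by rewrite -leqNgt.
  have -> : (\sum_(v in U) deg v = #|[set w | edge s w \subset U]| * r)%N.
    rewrite -sum_nat_const.
    transitivity (\sum_(v in U) \sum_(w | (edge s w \subset U) && (v \in edge s w)) 1)%N.
      by apply: eq_bigr => v _; rewrite sum1_card; apply: eq_card => w; rewrite inE.
    rewrite (exchange_big_dep (mem [set w | edge s w \subset U])) /=; last first.
      by move=> v w _ /andP[]; rewrite inE.
    apply: eq_bigr => w; rewrite inE => hw; rewrite -[RHS](hcard w) -[RHS]sum1_card.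
    apply: eq_bigl => v; rewrite hw /= andbC.
    by case: (boolP (v \in edge s w)) => //= /(subsetP hw) ->.
  have /forallP/(_ U) := hsp; rewrite Uh hU /= => h1 h2; move: h1 h2.
  by rewrite -hU; set x := #|_|; nia.
have [f hf] : exists f : {ffun 'I_n -> 'I_(2 * r)},
    forall w, edge s w \subset U :\ v -> ~~ mono f (edge s w).
  apply: IH; first by have := cardsD1 v U; rewrite vU hU add1n => -[<-].
  by apply: leq_trans Uh; apply: subset_leq_card; apply: subsetDl.
(* Avoiding the colour of a single other vertex of each tuple is enough. The default [v] is never
   taken, as [r > 1]. *)
pose other w := odflt v [pick u in edge s w :\ v].
have hother w : other w \in edge s w /\ other w != v.
  rewrite /other; case: pickP => [u|h0] /=; first by rewrite !inE => /andP[].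
  have := subset_leq_card (_ : edge s w \subset [set v]); rewrite hcard cards1 leqNgt r_gt1.
  suff hh : edge s w \subset [set v] by move/(_ hh).
  by apply/subsetP => u hu; have := h0 u; rewrite !inE hu andbT => /negbFE.
pose bads := [set f (other w) | w in [set w | (edge s w \subset U) && (v \in edge s w)]].
have [c hc] : exists c, c \notin bads.
  have : (#|bads| < #|'I_(2 * r)|)%N.
    by rewrite card_ord; apply: leq_ltn_trans (leq_imset_card _ _) hv.
  rewrite -subn_gt0 => h0; have /card_gt0P[c] : (0 < #|~: bads|)%N by rewrite cardsCs setCK.
  by rewrite inE; exists c.
exists [ffun u => if u == v then c else f u] => w hw.
case: (boolP (v \in edge s w)) => vw.
  have [h1 h2] := hother w; apply: (monoPn vw h1); rewrite !ffunE eqxx (negbTE h2) => e.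
  by move/negP: hc; apply; rewrite e; apply: imset_f; rewrite inE hw.
have : ~~ mono f (edge s w).
  apply: hf; apply/subsetP => u hu; rewrite !inE (subsetP hw) // andbT.
  by apply: contraNneq vw => <-.
apply: contraNN => /existsP[x /forall_inP hx]; apply/existsP; exists x.
apply/forall_inP => u hu; have := hx u hu; rewrite ffunE ifN //.
by apply: contraNneq vw => <-.
Qed.

Variable k : nat.
Hypothesis k_gt0 : (0 < k)%N.

(** The colouring [f] is total and [U] only excuses the tuples that meet it. A change of tuples is
    then repaired by enlarging [U], with [f] unchanged. *)
Definition partial_ok s U := [exists f : {ffun 'I_n -> 'I_k},
  [forall w, (edge s w :&: U != set0) || ~~ mono f (edge s w)]].

Definition uncolored s : nat := #|[arg min_(U < setT | partial_ok s U) #|U|]|.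

Lemma partial_okT s : partial_ok s setT.
Proof.
apply/existsP; exists [ffun=> Ordinal k_gt0]; apply/forallP => w.
apply/orP; left; rewrite setIT; apply/set0Pn.
by exists (vtx (s (w, Ordinal (ltnW r_gt1)))); apply: (mem_edge vtx s (w, _)).
Qed.

Lemma uncoloredP s : exists2 U, partial_ok s U & #|U| = uncolored s.
Proof.
rewrite /uncolored; case: arg_minnP => [|U hU _]; first exact: partial_okT.
by exists U.
Qed.

Lemma uncolored_le s U : partial_ok s U -> (uncolored s <= #|U|)%N.
Proof.
rewrite /uncolored; case: arg_minnP => [|U' hU' h]; first exact: partial_okT.
exact: h.
Qed.

(** Only two tuples change, and each of them contains one of the two exchanged vertices; adding
    these vertices to [U] excuses both. *)
Lemma uncolored_lipschitz p b s : (uncolored (tperm p b * s)%g <= uncolored s + 2)%N.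
Proof.
have [U /existsP[f /forallP hf] <-] := uncoloredP s.
pose U' := U :|: [set vtx (s p); vtx (s b)].
apply: (@leq_trans #|U'|); last first.
  apply: leq_trans (leq_card_setU _ _) _; rewrite leq_add2l cards2.
  by case: (_ != _).
apply: uncolored_le; apply/existsP; exists f; apply/forallP => w.
have hp : (tperm p b * s)%g p = s b by rewrite permM tpermL.
have hb : (tperm p b * s)%g b = s p by rewrite permM tpermR.
case: (eqVneq p.1 w) => [e|pw].
  apply/orP; left; apply/set0Pn; exists (vtx (s b)).
  by rewrite !inE eqxx !orbT andbT -hp -e mem_edge.
case: (eqVneq b.1 w) => [e|bw].
  apply/orP; left; apply/set0Pn; exists (vtx (s p)).
  by rewrite !inE eqxx !orbT andbT -hb -e mem_edge.
have -> : edge (tperm p b * s)%g w = edge s w.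
  apply: eq_imset => i; rewrite permM tpermD //.
    by apply: contraNneq pw => ->.
  by apply: contraNneq bw => ->.
case/orP: (hf w) => [h|->]; last by rewrite orbT.
apply/orP; left; apply: contraNneq h => h; apply/eqP/setP => v.
have /setP/(_ v) := h; rewrite !inE => hv.
by move: hv; case: (v \in edge s w) => //=; case: (v \in U).
Qed.

(** With disjoint palettes there are three kinds of edges: inside [U] the colouring [g] works,
    outside [U] the colouring [f] works, and a crossing edge sees both palettes. *)
Lemma colorable_of_uncolored h s : simple vtx s -> sparse vtx h s ->
  (uncolored s <= h)%N -> colorable (hg vtx s) (k + 2 * r).
Proof.
move=> hs hsp hu; have [U /existsP[f /forallP hf] hU] := uncoloredP s.
have hUh : (#|U| <= h)%N by rewrite hU.
have [g hgU] := sparse_colorable hs hsp hUh.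
apply/existsP; exists [ffun v => if v \in U then rshift k (g v) else lshift (2 * r) (f v)].
apply/forall_inP => _ /imsetP[w _ ->].
have hcard : #|edge s w| = r by apply/eqP; case/andP: hs => /forallP.
case: (boolP (edge s w \subset U)) => hw.
  apply: contraNN (hgU w hw) => /existsP[c /forall_inP hc].
  have [v hv] : exists v, v \in edge s w.
    by apply/card_gt0P; rewrite hcard ltnW.
  apply/existsP; exists (g v); apply/forall_inP => u hu'.
  have := hc u hu'; rewrite -(eqP (hc v hv)) !ffunE !(subsetP hw) //.
  by move=> /eqP /rshift_inj ->.
have [u hu1 hu2] := subsetPn hw.
case: (set_0Vmem (edge s w :&: U)) => [e0|[v]]; last first.
  rewrite inE => /andP[v1 v2]; apply/negP => /existsP[c /forall_inP hc].
  have := hc u hu1; rewrite -(eqP (hc v v1)) !ffunE v2 (negbTE hu2).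
  by rewrite eq_lrshift.
have hnU x : x \in edge s w -> x \notin U.
  move=> hx; apply/negP => xU; have : x \in edge s w :&: U by rewrite inE hx.
  by rewrite e0 inE.
have := hf w; rewrite e0 eqxx /=; apply: contraNN => /existsP[c /forall_inP hc].
apply/existsP; exists (f u); apply/forall_inP => x hx.
have := hc x hx; rewrite -(eqP (hc u hu1)) !ffunE !ifN ?hnU //.
Qed.

End PartialColorings.

(** * Large independent sets *)

(** For independent letters the [m] tuples are independent, so the weight factorises over them. *)
Lemma sum_tuples_prod (K : finType) (m r : nat) (q : pred {ffun 'I_r -> K}) (a : K -> R) :
  \sum_(h : {ffun 'I_m * 'I_r -> K} | [forall w, q [ffun i => h (w, i)]]) \prod_t a (h t) =
  (\sum_(t : {ffun 'I_r -> K} | q t) \prod_i a (t i)) ^+ m.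
Proof.
rewrite -[m in RHS]card_ord -prodr_const bigA_distr_big /=.
pose F (u : {ffun 'I_m -> {ffun 'I_r -> K}}) : {ffun 'I_m * 'I_r -> K} :=
  [ffun t => u t.1 t.2].
pose G (h : {ffun 'I_m * 'I_r -> K}) : {ffun 'I_m -> {ffun 'I_r -> K}} :=
  [ffun w => [ffun i => h (w, i)]].
have FG : cancel G F by move=> h; apply/ffunP => -[w i]; rewrite !ffunE.
have GF : cancel F G.
  by move=> u; apply/ffunP => w; apply/ffunP => i; rewrite !ffunE.
rewrite (reindex F) /=; last by exists G => ? _; [apply: GF | apply: FG].
apply: eq_big => [u|u _].
  apply/forallP/familyP => h w; have := h w; rewrite unfold_in /=.
    by congr q; apply/ffunP => i; rewrite !ffunE.
  by congr q; apply/ffunP => i; rewrite !ffunE.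
rewrite (eq_bigr (fun t : 'I_m * 'I_r => a (u t.1 t.2))); last by move=> t _; rewrite ffunE.
by rewrite -(pair_bigA _ (fun w i => a (u w i))).
Qed.

Section VertexColorings.
Variables (n d r m : nat).
Notation T := ('I_m * 'I_r)%type.
Variable vtx : {ffun T -> 'I_n}.
Hypothesis hvtx : forall v, cnt vtx v = d.
Hypothesis d_gt0 : (0 < d)%N.
Implicit Types (s : {perm T}).

Section Colors.
Variable K : finType.
Implicit Types (f : {ffun 'I_n -> K}) (q : pred {ffun 'I_r -> K}).

Definition lift_coloring f : {ffun T -> K} := [ffun t => f (vtx t)].

Definition tuple_col f s w : {ffun 'I_r -> K} := [ffun i => f (vtx (s (w, i)))].

Lemma cnt_lift f x : cnt (lift_coloring f) x = (d * cnt f x)%N.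
Proof.
rewrite /cnt -(card_vertex_slots hvtx); apply: eq_card => t.
by rewrite !inE ffunE.
Qed.

Lemma freq_lift f x : freq (lift_coloring f) x = freq f x.
Proof.
rewrite /freq cnt_lift card_prod !card_ord -(card_config hvtx) !natrM.
have dR : (0 : R) < d%:R by rewrite ltr0n.
rewrite [n%:R * _]mulrC invfM mulrACA divff ?mul1r // gt_eqF //.
Qed.

(** [perm_class_le] followed by [sum_tuples_prod]; clones and vertices have the same colour
    frequencies because every vertex has [d] clones. *)
Lemma tuple_event_le f q :
  #|[set s | [forall w, q (tuple_col f s w)]]|%:R <=
  polyfac T K * #|{: T}|`!%:R *
    (\sum_(t : {ffun 'I_r -> K} | q t) \prod_i freq f (t i)) ^+ m :> R.
Proof.
have := perm_class_le (lift_coloring f)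
  (fun h : {ffun T -> K} => [forall w, q [ffun i => h (w, i)]]).
rewrite sum_tuples_prod.
under eq_bigr do under eq_bigr do rewrite freq_lift.
apply: le_trans; rewrite ler_nat; apply: eq_leq; apply: eq_card => s; rewrite !inE.
apply: eq_forallb => w; congr q; by apply/ffunP => i; rewrite !ffunE.
Qed.

Lemma sum_prod_freq f : (0 < n)%N ->
  \sum_(t : {ffun 'I_r -> K}) \prod_i freq f (t i) = 1.
Proof.
move=> n0; rewrite -(bigA_distr_bigA (fun=> freq f)) big1 // => i _.
by rewrite sum_freq // card_ord.
Qed.

End Colors.

Lemma independent_tuples s (S : {set 'I_n}) : independent (hg vtx s) S ->
  [forall w, ~~ [forall i, tuple_col [ffun v => v \in S] s w i]].
Proof.
move=> /forall_inP h; apply/forallP => w.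
have hw : edge vtx s w \in hg vtx s by apply: imset_f.
have := h _ hw; apply: contraNN => /forallP hi.
by apply/subsetP => _ /imsetP[i _ ->]; have := hi i; rewrite !ffunE.
Qed.

Lemma independent_set_le (S : {set 'I_n}) : (0 < n)%N ->
  #|[set s | independent (hg vtx s) S]|%:R <=
  polyfac T bool * #|{: T}|`!%:R * (1 - (#|S|%:R / n%:R) ^+ r) ^+ m :> R.
Proof.
move=> n0; pose f : {ffun 'I_n -> bool} := [ffun v => v \in S].
have hf : freq f true = #|S|%:R / n%:R.
  rewrite /freq card_ord; congr (_%:R / _); apply: eq_card => v.
  by rewrite !inE ffunE eqb_id.
have := tuple_event_le f (fun t => ~~ [forall i, t i]).
have -> : \sum_(t : {ffun 'I_r -> bool} | ~~ [forall i, t i]) \prod_i freq f (t i) =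
    1 - (#|S|%:R / n%:R) ^+ r.
  have := sum_prod_freq f n0; rewrite (bigID (fun t : {ffun 'I_r -> bool} => ~~ [forall i, t i])) /=.
  rewrite [X in _ + X](big_pred1 [ffun=> true]); last first.
    move=> t; rewrite /= negbK; apply/forallP/eqP => [h|-> i]; last by rewrite ffunE.
    by apply/ffunP => i; rewrite ffunE; apply: h.
  have -> : \prod_(i < r) freq f ([ffun=> true] i) = (#|S|%:R / n%:R) ^+ r.
    by rewrite -hf -[r in RHS]card_ord -prodr_const; apply: eq_bigr => i _; rewrite ffunE.
  exact: canRL (addrK _).
apply: le_trans; rewrite ler_nat; apply: subset_leq_card; apply/subsetP => s.
by rewrite !inE; apply: independent_tuples.
Qed.

(** Subsets of independent sets are independent, so a union bound over sets of size exactly [a]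
    suffices; the exponent comes from ['C(n, a) <= (e n / a)^a] and [1 - p^r <= exp (- p^r)]. *)
Lemma alpha_tail (a : nat) : (0 < a <= n)%N ->
  #|[set s | (a <= alpha (hg vtx s))%N]|%:R <=
  polyfac T bool * #|{: T}|`!%:R *
    exp (a%:R * (1 - ln (a%:R / n%:R)) - m%:R * (a%:R / n%:R) ^+ r) :> R.
Proof.
case/andP=> a0 an; have n0 : (0 < n)%N by apply: leq_trans an.
have nR : (0 : R) < n%:R by rewrite ltr0n.
have aR : (0 : R) < a%:R by rewrite ltr0n.
set p : R := a%:R / n%:R.
have p0 : 0 < p by rewrite divr_gt0.
have p1 : p <= 1 by rewrite ler_pdivrMr // mul1r ler_nat.
apply: (@le_trans _ _ (\sum_(S : {set 'I_n} | #|S| == a)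
    #|[set s | independent (hg vtx s) S]|%:R)).
  rewrite -natr_sum ler_nat.
  apply: (@leq_trans (\sum_(S : {set 'I_n} | #|S| == a) \sum_(s | independent (hg vtx s) S) 1)).
    rewrite (exchange_big_dep predT) //= -sum1_card big_mkcond /=.
    apply: leq_sum => s _; rewrite inE; case: ifP => // ha.
    have [S hS e] : exists2 S, independent (hg vtx s) S & alpha (hg vtx s) = #|S|.
      case: (pickP (independent (hg vtx s))) => [S0 hS0|h0]; last first.
        by move: ha; rewrite /alpha big_pred0 // leqNgt a0.
      have hpos : (0 < #|independent (hg vtx s)|)%N by apply/card_gt0P; exists S0.
      by have [S hS e] := eq_bigmax_cond (fun S : {set 'I_n} => #|S|) hpos; exists S.
    rewrite e in ha.
    have /card_gt0P[B] : (0 < #|[set B : {set 'I_n} | B \subset S & #|B| == a]|)%N.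
      by rewrite cards_draws bin_gt0.
    rewrite inE => /andP[BS hB]; rewrite (bigD1 B) //= hB /=.
    by apply/forall_inP => x hx; apply: contraNN (forall_inP hS x hx) => /subset_trans; apply.
  apply: leq_sum => S _; rewrite sum1_card; apply: eq_leq.
  by apply: eq_card => s; rewrite !inE.
apply: (@le_trans _ _ (\sum_(S : {set 'I_n} | #|S| == a)
    polyfac T bool * #|{: T}|`!%:R * (1 - p ^+ r) ^+ m)).
  by apply: ler_sum => S /eqP hS; have := independent_set_le S n0; rewrite hS.
rewrite sumr_const.
have -> : #|(fun S : {set 'I_n} => #|S| == a)| = 'C(n, a).
  rewrite -[n in RHS]card_ord -card_draws; by apply: eq_card => S; rewrite !inE.
rewrite -[leLHS]mulr_natr -mulrA ler_wpM2l ?mulr_ge0 ?(ltW (polyfac_gt0 _ _)) //.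
rewrite mulrC expRDE ler_pM //.
- by rewrite exprn_ge0 // subr_ge0 exprn_ile1 // ltW.
- apply: le_trans (bin_le_pow n a0) _; rewrite -exprX lerXn2r ?nnegrE ?exp_ge0 //.
    by rewrite divr_ge0 ?mulr_ge0 ?exp_ge0.
  rewrite expRDE expRNE exp_lnK // /p.
  by rewrite le_eqVlt; apply/orP; left; apply/eqP; field; rewrite !gt_eqF.
- apply: one_sub_exp_le; rewrite exprn_ge0 ?(ltW p0) //=.
  by rewrite exprn_ile1 // ltW.
Qed.

End VertexColorings.

(** * Second moment of balanced colourings *)

(** The gap in Bernoulli's inequality [y^r >= 1 + r (y - 1)]. Summed over [y = #|K| a x] its linear
    part is constant, so it measures how far the [r]-th power sum is from its uniform value. *)
Definition bern_gap (r : nat) (y : R) : R := y ^+ r - r%:R * y + r%:R - 1.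

Lemma bern_gapS r y : bern_gap r.+1 y = y * bern_gap r y + r%:R * (y - 1) ^+ 2.
Proof. by rewrite /bern_gap exprS -natr1; ring. Qed.

Lemma bern_gap0 y : bern_gap 0 y = 0.
Proof. by rewrite /bern_gap expr0; ring. Qed.

Lemma bern_gap_ge0 r y : 0 <= y -> 0 <= bern_gap r y.
Proof.
move=> y0; elim: r => [|r IH]; first by rewrite bern_gap0.
by rewrite bern_gapS; apply: addr_ge0; apply: mulr_ge0 => //; apply: sqr_ge0.
Qed.

Lemma bern_gap_le_sqr r y M : 0 <= y <= M -> 1 <= M ->
  bern_gap r y <= r%:R ^+ 2 * M ^+ r * (y - 1) ^+ 2.
Proof.
move=> /andP[y0 yM] M1; elim: r => [|r IH].
  by rewrite bern_gap0 expr0n /= mul0r mul0r.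
rewrite bern_gapS (exprS M) -natr1.
set z := (y - 1) ^+ 2; have z0 : 0 <= z := sqr_ge0 _.
set P := M ^+ r; have P1 : 1 <= P by rewrite exprn_ege1.
have r0 : (0 : R) <= r%:R by [].
have h1 : y * bern_gap r y <= M * (r%:R ^+ 2 * P * z).
  by rewrite ler_pM // bern_gap_ge0.
have h2 : r%:R * z <= r%:R * (M * P) * z.
  by rewrite ler_wpM2r // ler_peMr //; nra.
apply: (le_trans (lerD h1 h2)).
have -> : M * (r%:R ^+ 2 * P * z) + r%:R * (M * P) * z = (r%:R ^+ 2 + r%:R) * (M * P * z) by ring.
have -> : (r%:R + 1) ^+ 2 * (M * P) * z = (r%:R + 1) ^+ 2 * (M * P * z) by ring.
have MPz : 0 <= M * P * z by apply: mulr_ge0 => //; nra.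
by rewrite ler_wpM2r //; nra.
Qed.

Lemma bern_gap_le_pow r y : 1 <= y -> bern_gap r y <= y ^+ r.
Proof. by move=> y1; rewrite /bern_gap; have : (0 : R) <= r%:R by []; nra. Qed.

Lemma sum_bern_gap (K : finType) r (a : K -> R) : \sum_x a x = 1 ->
  \sum_x bern_gap r (#|K|%:R * a x) = #|K|%:R ^+ r * \sum_x a x ^+ r - #|K|%:R.
Proof.
move=> h1; rewrite /bern_gap.
under eq_bigr do rewrite exprMn -!addrA.
rewrite big_split /= -mulr_sumr; congr (_ + _).
rewrite big_split /= sumrN -!mulr_sumr h1 sumr_const -[X in _ + X]mulr_natl; ring.
Qed.

(** The power mean inequality, as the sum of Bernoulli's inequalities at [#|K| a x]. *)
Lemma sum_pow_ge (K : finType) r (a : K -> R) : (0 < #|K|)%N ->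
  (forall x, 0 <= a x) -> \sum_x a x = 1 ->
  #|K|%:R / #|K|%:R ^+ r <= \sum_x a x ^+ r.
Proof.
move=> K0 a0 h1; have KR : (0 : R) < #|K|%:R by rewrite ltr0n.
rewrite ler_pdivrMr ?exprn_gt0 // -subr_ge0 mulrC -(sum_bern_gap r h1).
by apply: sumr_ge0 => x _; rewrite bern_gap_ge0 // mulr_ge0.
Qed.

(* The relative entropy on the right absorbs the correlation term: termwise this is
   the hypothesis, after centring both sides at the uniform overlap. *)
Lemma overlap_weight_le (n d r m k : nat) (f : {ffun 'I_n -> 'I_k * 'I_k}) (q : R) :
  (0 < n)%N -> (0 < k)%N -> (0 < r)%N -> (n * d = m * r)%N ->
  q = k%:R / k%:R ^+ r -> q < 1 ->
  (forall y : R, 0 <= y <= k%:R + 1 ->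
     d%:R / (r%:R * (1 - q) ^+ 2) * (k%:R ^+ 2 / (k%:R ^+ 2) ^+ r) * bern_gap r y
       <= y * ln y - y + 1) ->
  (forall x, k%:R ^+ 2 * freq f x <= k%:R + 1) ->
  (1 - 2 * q + \sum_x freq f x ^+ r) ^+ m <=
  ((1 - q) ^+ 2) ^+ m * ((k%:R ^+ 2) ^+ n * \prod_v freq f (f v)).
Proof.
move=> n0 k0 r0 hnm hq q1 key hf.
have kR : (0 : R) < k%:R by rewrite ltr0n.
have rR : (0 : R) < r%:R by rewrite ltr0n.
have nR : (0 : R) < n%:R by rewrite ltr0n.
have cK : #|{: 'I_k * 'I_k}|%:R = k%:R ^+ 2 :> R by rewrite card_prod card_ord natrM.
set kk : R := k%:R ^+ 2; have kk0 : 0 < kk by rewrite exprn_gt0.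
have hs : \sum_x freq f x = 1 by rewrite sum_freq // card_ord.
have hq2 : kk / kk ^+ r = q ^+ 2.
  by rewrite hq expr_div_n /kk -!exprM mulnC.
have hX0 : q ^+ 2 <= \sum_x freq f x ^+ r.
  rewrite -hq2 /kk -cK; apply: sum_pow_ge => //; last exact: freq_ge0.
  by rewrite card_prod card_ord muln_gt0 k0.
set S := \sum_x freq f x ^+ r in hX0 *.
have q2 : 0 < (1 - q) ^+ 2 by rewrite exprn_gt0 // subr_gt0.
(* [(1 - q)^2] is the value for independent colourings, where [S = q^2]; the remaining factor is
   bounded by [1 + x <= exp x]. *)
have e1 : 1 - 2 * q + S = (1 - q) ^+ 2 * (1 + (S - q ^+ 2) / (1 - q) ^+ 2).
  by field; rewrite gt_eqF // subr_gt0.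
rewrite e1 exprMn; apply: ler_wpM2l; first by apply: exprn_ge0; exact: ltW.
apply: (@le_trans _ _ (exp (m%:R * ((S - q ^+ 2) / (1 - q) ^+ 2)))).
  rewrite -exprX; apply: lerXn2r; rewrite ?nnegrE ?exp_ge0 ?exp_ge1D //.
  by rewrite addr_ge0 // divr_ge0 ?subr_ge0 // ltW.
have hSq : kk ^+ r * (S - q ^+ 2) = \sum_x bern_gap r (kk * freq f x).
  have := sum_bern_gap r hs; rewrite cK => ->.
  by rewrite -hq2 mulrBr [kk ^+ r * (_ / _)]mulrC divfK // gt_eqF // exprn_gt0.
have hnm' : m%:R = n%:R * d%:R / r%:R :> R.
  by rewrite -natrM hnm natrM mulfK // gt_eqF.
have e2 : m%:R * ((S - q ^+ 2) / (1 - q) ^+ 2) = n%:R / kk * \sum_x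
    d%:R / (r%:R * (1 - q) ^+ 2) * (kk / kk ^+ r) * bern_gap r (kk * freq f x).
  rewrite -mulr_sumr -hSq hnm'; field.
  by rewrite !gt_eqF ?exprn_gt0 //= subr_gt0.
have le3 : m%:R * ((S - q ^+ 2) / (1 - q) ^+ 2) <= n%:R / kk * \sum_x
    (kk * freq f x * ln (kk * freq f x) - kk * freq f x + 1).
  rewrite e2 ler_wpM2l ?divr_ge0 ?(ltW kk0) //; apply: ler_sum => x _.
  by apply: key; rewrite hf andbT mulr_ge0 ?freq_ge0 // ltW.
(* The values [kk * freq f x] sum to their number [kk], so the terms [- y + 1] cancel and [n] times
   the relative entropy to the uniform overlap remains. *)
have e4 : n%:R / kk * \sum_x (kk * freq f x * ln (kk * freq f x) - kk * freq f x + 1) =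
    \sum_x (cnt f x)%:R * ln (kk * freq f x).
  rewrite big_split /= sumrB -mulr_sumr hs sumr_const cK mulr1 subrK mulr_sumr.
  apply: eq_bigr => x _; rewrite /freq card_ord; field.
  by rewrite !gt_eqF.
rewrite e4 in le3.
apply: (@le_trans _ _ (exp (\sum_x (cnt f x)%:R * ln (kk * freq f x)))).
  by rewrite ler_exp.
rewrite exp_sum -[n in kk ^+ n]card_ord -prodr_const -big_split /=.
rewrite (weight_class (fun x => kk * freq f x)) le_eqVlt; apply/orP; left; apply/eqP.
apply: eq_bigr => x _; case: (posnP (cnt f x)) => [->|c0]; first by rewrite mul0r expR0 expr0.
rewrite -exprX exp_lnK // mulr_gt0 //.
by rewrite divr_gt0 ?ltr0n // card_ord.
Qed.

Section ConstTuples.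
Variables (K C : finType) (r : nat) (a : K -> R) (phi : K -> C).
Hypothesis r_gt0 : (0 < r)%N.

Definition const_along (t : {ffun 'I_r -> K}) := [exists c, [forall i, phi (t i) == c]].

Lemma sum_const_tuples :
  \sum_(t | const_along t) \prod_i a (t i) = \sum_c (\sum_(x | phi x == c) a x) ^+ r.
Proof.
pose i0 : 'I_r := Ordinal r_gt0.
rewrite (partition_big (fun t : {ffun 'I_r -> K} => phi (t i0)) predT) //=.
apply: eq_bigr => c _; rewrite -[r in RHS]card_ord -prodr_const bigA_distr_big /=.
apply: eq_bigl => t; apply/andP/familyP => [[/existsP[x /forallP h] /eqP <-] i|h].
  by rewrite unfold_in /= (eqP (h i)) (eqP (h i0)).
have hi i : phi (t i) == c by have := h i; rewrite unfold_in.
by split; [apply/existsP; exists c; apply/forallP|].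
Qed.

End ConstTuples.

Section PairUpper.
Variables (n d r m k : nat).
Notation T := ('I_m * 'I_r)%type.
Variable vtx : {ffun T -> 'I_n}.
Hypothesis hvtx : forall v, cnt vtx v = d.
Hypotheses (d_gt0 : (0 < d)%N) (n_gt0 : (0 < n)%N) (k_gt0 : (0 < k)%N) (r_gt0 : (0 < r)%N).
Implicit Types (s : {perm T}) (sg tu : {ffun 'I_n -> 'I_k}).

Definition nonmono (t : {ffun 'I_r -> 'I_k}) := ~~ [exists c, [forall i, t i == c]].

Definition proper_conf sg s := [forall w, nonmono (tuple_col vtx sg s w)].

Definition join_col sg tu : {ffun 'I_n -> 'I_k * 'I_k} := [ffun v => (sg v, tu v)].

(** Inclusion and exclusion. The two single terms are bounded by the power mean inequality on the
    marginals, so the marginals need not be uniform; the joint term is the power sum itself. *)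
Lemma nonmono_pair_sum (a : 'I_k * 'I_k -> R) :
  (forall x, 0 <= a x) -> \sum_x a x = 1 ->
  \sum_(t : {ffun 'I_r -> 'I_k * 'I_k} | nonmono [ffun i => (t i).1] && nonmono [ffun i => (t i).2])
    \prod_i a (t i) <= 1 - 2 * (k%:R / k%:R ^+ r) + \sum_x a x ^+ r.
Proof.
move=> a0 a1; pose w (t : {ffun 'I_r -> 'I_k * 'I_k}) := \prod_i a (t i).
pose m1 := @const_along _ _ r (fst : 'I_k * 'I_k -> 'I_k).
pose m2 := @const_along _ _ r (snd : 'I_k * 'I_k -> 'I_k).
pose m12 := @const_along _ _ r (id : 'I_k * 'I_k -> _).
have tot : \sum_t w t = 1.
  by rewrite /w -(bigA_distr_bigA (fun=> a)) big1.
have e12 t : m12 t = m1 t && m2 t.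
  apply/existsP/andP => [[c /forallP h]|[/existsP[c /forallP h] /existsP[c' /forallP h']]].
    split; apply/existsP; [exists c.1|exists c.2]; apply/forallP => i;
    by rewrite (eqP (h i)).
  exists (c, c'); apply/forallP => i.
  by rewrite [t i]surjective_pairing (eqP (h i)) (eqP (h' i)).
have eq1 (t : {ffun 'I_r -> 'I_k * 'I_k}) : nonmono [ffun i => (t i).1] = ~~ m1 t.
  by congr (~~ _); apply: eq_existsb => c; apply: eq_forallb => i; rewrite ffunE.
have eq2 (t : {ffun 'I_r -> 'I_k * 'I_k}) : nonmono [ffun i => (t i).2] = ~~ m2 t.
  by congr (~~ _); apply: eq_existsb => c; apply: eq_forallb => i; rewrite ffunE.
have incl : \sum_(t : {ffun 'I_r -> 'I_k * 'I_k} | nonmono [ffun i => (t i).1] && nonmono [ffun i => (t i).2]) w t =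
   \sum_t w t - \sum_(t | m1 t) w t - \sum_(t | m2 t) w t + \sum_(t | m12 t) w t.
  rewrite big_mkcond [\sum_(t | m1 t) _]big_mkcond [\sum_(t | m2 t) _]big_mkcond.
  rewrite [\sum_(t | m12 t) _]big_mkcond /= -!sumrB -big_split /=.
  apply: eq_bigr => t _; rewrite eq1 eq2 e12.
  by case: (m1 t); case: (m2 t) => /=; ring.
rewrite -/(w _) incl tot.
have s12 : \sum_(t | m12 t) w t = \sum_x a x ^+ r.
  rewrite /w sum_const_tuples //; apply: eq_bigr => x _.
  by rewrite (big_pred1 x) // => y; rewrite /= eq_sym.
have sums (phi : 'I_k * 'I_k -> 'I_k) :
    k%:R / k%:R ^+ r <= \sum_c (\sum_(x | phi x == c) a x) ^+ r.
  rewrite -[k in leLHS]card_ord; apply: sum_pow_ge; rewrite ?card_ord //.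
    by move=> c; apply: sumr_ge0.
  by rewrite -a1 [RHS](partition_big phi predT).
have s1 : k%:R / k%:R ^+ r <= \sum_(t | m1 t) w t by rewrite /w sum_const_tuples.
have s2 : k%:R / k%:R ^+ r <= \sum_(t | m2 t) w t by rewrite /w sum_const_tuples.
rewrite s12; lra.
Qed.

Lemma proper_pair_le sg tu :
  #|[set s | proper_conf sg s && proper_conf tu s]|%:R <=
  polyfac T ('I_k * 'I_k)%type * #|{: T}|`!%:R *
    (1 - 2 * (k%:R / k%:R ^+ r) + \sum_x freq (join_col sg tu) x ^+ r) ^+ m :> R.
Proof.
have := tuple_event_le hvtx d_gt0 (join_col sg tu)
  (fun t : {ffun 'I_r -> 'I_k * 'I_k} => nonmono [ffun i => (t i).1] && nonmono [ffun i => (t i).2]).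
have hs : \sum_x freq (join_col sg tu) x = 1 by rewrite sum_freq // card_ord.
move=> h; apply: le_trans (le_trans h _).
  rewrite ler_nat; apply: subset_leq_card; apply/subsetP => s; rewrite !inE.
  move=> /andP[/forallP h1 /forallP h2]; apply/forallP => w; apply/andP; split.
    by have := h1 w; congr nonmono; apply/ffunP => i; rewrite !ffunE.
  by have := h2 w; congr nonmono; apply/ffunP => i; rewrite !ffunE.
rewrite ler_wpM2l ?mulr_ge0 ?(ltW (polyfac_gt0 _ _)) //.
have hle := nonmono_pair_sum (freq_ge0 (join_col sg tu)) hs.
have h0 : 0 <= \sum_(t : {ffun 'I_r -> 'I_k * 'I_k} |
   nonmono [ffun i => (t i).1] && nonmono [ffun i => (t i).2])
    \prod_i freq (join_col sg tu) (t i).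
  by apply: sumr_ge0 => t _; apply: prodr_ge0 => i _; apply: freq_ge0.
by rewrite lerXn2r ?nnegrE //; apply: le_trans hle.
Qed.

End PairUpper.

(** * A proper word with prescribed colour counts *)

Lemma card_mod_class (m K : nat) (j : 'I_K) :
  (m %/ K <= #|[set w : 'I_m | w %% K == j]| <= (m %/ K).+1)%N.
Proof.
have K0 : (0 < K)%N by apply: leq_ltn_trans (ltn_ord j).
apply/andP; split.
  have hlt (i : 'I_(m %/ K)) : (i * K + j < m)%N.
    apply: (@leq_trans (i.+1 * K)).
      by rewrite mulSn addnC ltn_add2r.
    by apply: leq_trans (leq_trunc_div m K); rewrite leq_mul2r ltn_ord orbT.
  rewrite -[leqLHS]card_ord -(@card_imset _ _ (fun i => Ordinal (hlt i))).
    apply: subset_leq_card; apply/subsetP => _ /imsetP[i _ ->].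
    by rewrite inE /= modnMDl modn_small.
  move=> i i' /(congr1 val) /= /eqP; rewrite eqn_add2r eqn_pmul2r // => /eqP.
  exact: val_inj.
have hlt (w : 'I_m) : (w %/ K < (m %/ K).+1)%N by rewrite ltnS leq_div2r // ltnW.
rewrite -[leqRHS]card_ord -(@card_in_imset _ _ (fun w => Ordinal (hlt w))).
  exact: max_card.
move=> w w'; rewrite !inE => /eqP h1 /eqP h2 /(congr1 val) /= e.
by apply: val_inj; rewrite /= (divn_eq w K) (divn_eq w' K) h1 h2 e.
Qed.

Section BaseAssignment.
Variables (m r k : nat).
Notation T := ('I_m * 'I_r)%type.
Notation Q := {ffun 'I_r -> 'I_k}.
Hypotheses (r_gt1 : (1 < r)%N) (k_gt2 : (2 < k)%N).
Implicit Types (u : {ffun 'I_m -> Q}) (t : Q).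

Definition flat u : {ffun T -> 'I_k} := [ffun x : T => u x.1 x.2].

Lemma cnt_flat u x : cnt (flat u) x = (\sum_(t : Q) cnt u t * cnt t x)%N.
Proof.
transitivity (\sum_(w < m) cnt (u w) x)%N.
  rewrite /cnt -sum1_card (partition_big (fun y : T => y.1) predT) //=.
  apply: eq_bigr => w _.
  rewrite -(@card_imset _ _ (fun i : 'I_r => (w, i))) -?sum1_card; last by move=> i j [].
  apply: eq_bigl => -[w' i]; rewrite !inE ffunE /=; apply/andP/imsetP.
    by case=> h /eqP e; subst w'; exists i; rewrite // inE.
  by case=> j; rewrite inE => h [-> ->].
rewrite (partition_big u predT) //=; apply: eq_bigr => t _.
rewrite (eq_bigr (fun=> cnt t x)); last by move=> w /eqP ->.
by rewrite sum_nat_const; congr (_ * _)%N; apply: eq_card => w; rewrite !inE.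
Qed.

Lemma nonmono_pairP t i j : t i <> t j -> nonmono t.
Proof.
move=> h; apply/negP => /existsP[c /forallP hc]; apply: h.
by rewrite (eqP (hc i)) (eqP (hc j)).
Qed.

Variable N : 'I_k -> nat.
Hypothesis sumN : (\sum_x N x = m * r)%N.

Let sum_flat u : (\sum_x cnt (flat u) x = m * r)%N.
Proof. by rewrite sum_cnt card_prod !card_ord. Qed.

(* Recolouring one slot of a tuple [(x, z, ..., z)] from an overfull colour [x] to an
   underfull colour [y] keeps every tuple non-monochromatic. *)
Lemma discrepancy_step u :
  (forall w, nonmono (u w)) -> (0 < \sum_x (cnt (flat u) x - N x))%N ->
  (forall t, nonmono t -> (0 < cnt u t)%N) ->
  exists u', [/\ forall w, nonmono (u' w),
    (\sum_x (cnt (flat u') x - N x) < \sum_x (cnt (flat u) x - N x))%N &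
    forall t, (cnt u' t <= (cnt u t).+1)%N /\ (cnt u t <= (cnt u' t).+1)%N].
Proof.
move=> hu hpos hcov.
have [x hx] : exists x, (N x < cnt (flat u) x)%N.
  apply/existsP; rewrite -[X in is_true X]negbK negb_exists; apply/negP => /forallP h.
  by move: hpos; rewrite big1 // => x _; apply/eqP; rewrite subn_eq0 leqNgt.
have [y hy] : exists y, (cnt (flat u) y < N y)%N.
  apply/existsP; rewrite -[X in is_true X]negbK negb_exists; apply/negP => /forallP h.
  have : (\sum_x N x < \sum_x cnt (flat u) x)%N.
    rewrite (bigD1 x) //= [ltnRHS](bigD1 x) //= -addSn; apply: leq_add => //.
    by apply: leq_sum => y _; rewrite leqNgt h.
  by rewrite sumN sum_flat ltnn.
have xy : x != y by apply: contraTneq hx => ->; rewrite -leqNgt ltnW.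
have [z hz] : exists z, z \notin [set x; y].
  have /card_gt0P[z] : (0 < #|~: [set x; y]|)%N.
    by rewrite cardsCs setCK card_ord cards2 xy subn_gt0.
  by rewrite inE; exists z.
move: hz; rewrite !inE negb_or => /andP[zx zy].
pose i0 : 'I_r := Ordinal (ltnW r_gt1); pose i1 : 'I_r := Ordinal r_gt1.
pose t0 : Q := [ffun i => if i == i0 then x else z].
pose t1 : Q := [ffun i => if i == i0 then y else z].
have nm0 : nonmono t0 by apply: (@nonmono_pairP _ i1 i0); rewrite !ffunE /=; apply/eqP.
have nm1 : nonmono t1 by apply: (@nonmono_pairP _ i1 i0); rewrite !ffunE /=; apply/eqP.
have /card_gt0P[w0] := hcov t0 nm0; rewrite inE => /eqP hw0.
pose u' : {ffun 'I_m -> Q} := [ffun w => if w == w0 then t1 else u w].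
have hflat p : flat u' p = if p == (w0, i0) then y else flat u p.
  case: p => w i; rewrite !ffunE /= xpair_eqE; case: (eqVneq w w0) => [->|] //=.
  by rewrite hw0 !ffunE; case: (i == i0).
have hflat0 : flat u (w0, i0) = x by rewrite ffunE /= hw0 ffunE eqxx.
have cx : (cnt (flat u') x).+1 = cnt (flat u) x.
  rewrite /cnt [RHS](cardsD1 (w0, i0)) inE hflat0 eqxx add1n; congr _.+1.
  apply: eq_card => p; rewrite !inE hflat; case: (eqVneq p (w0, i0)) => //= _.
  by rewrite eq_sym (negbTE xy).
have cother x' : x' != x -> (cnt (flat u') x' - N x' <= cnt (flat u) x' - N x')%N.
  move=> hx'; case: (eqVneq x' y) => [->|hxy'].
    have : (cnt (flat u') y <= (cnt (flat u) y).+1)%N.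
      apply: (@leq_trans #|(w0, i0) |: [set p | flat u p == y]|).
        apply: subset_leq_card; apply/subsetP => p; rewrite !inE hflat.
        by case: (eqVneq p (w0, i0)).
      by rewrite cardsU1 -add1n leq_add2r; case: (_ \notin _).
    by lia.
  apply: leq_sub2r; apply: subset_leq_card; apply/subsetP => p; rewrite !inE hflat.
  by case: ifP => // _; rewrite eq_sym (negbTE hxy').
exists u'; split.
- by move=> w; rewrite ffunE; case: ifP.
- rewrite (bigD1 x) //= [ltnRHS](bigD1 x) //= -addSn; apply: leq_add; last exact: leq_sum.
  by move: hx; rewrite -cx; lia.
- move=> t; split.
    apply: (@leq_trans #|w0 |: [set w | u w == t]|); last first.
      by rewrite cardsU1 -add1n leq_add2r; case: (_ \notin _).
    apply: subset_leq_card; apply/subsetP => w; rewrite !inE ffunE.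
    by case: (eqVneq w w0).
  apply: (@leq_trans #|w0 |: [set w | u' w == t]|); last first.
    by rewrite cardsU1 -add1n leq_add2r; case: (_ \notin _).
  apply: subset_leq_card; apply/subsetP => w; rewrite !inE ffunE.
  by case: (eqVneq w w0).
Qed.

(** The number [o] is a budget: a step lowers the total excess by at least one and every
    multiplicity by at most one, so [o] copies of each non-monochromatic tuple suffice until the
    end. *)
Lemma discrepancy_fix (o B : nat) u :
  (forall w, nonmono (u w)) -> (\sum_x (cnt (flat u) x - N x) <= o)%N ->
  (forall t, nonmono t -> (o <= cnt u t)%N) -> (forall t, (cnt u t <= B)%N) ->
  exists u', [/\ forall w, nonmono (u' w), forall x, cnt (flat u') x = N x &
    forall t, (cnt u' t <= B + o)%N].
Proof.
elim: o B u => [|o IH] B u hu ho hlo hB.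
  exists u; split => // [x|t]; last by rewrite addn0.
  have hle y : (cnt (flat u) y <= N y)%N.
    by move: ho; rewrite leqn0 sum_nat_eq0 => /forallP/(_ y); rewrite subn_eq0.
  have h := leqif_sum (fun y _ => leqif_eq (hle y)).
  have /= := (h predT).2; rewrite sumN sum_flat eqxx => /esym /forallP/(_ x) /= /eqP.
  by [].
have weak (u' : {ffun 'I_m -> Q}) : (forall t, (cnt u' t <= B + o)%N) ->
    forall t, (cnt u' t <= B + o.+1)%N.
  by move=> h t; apply: leq_trans (h t) _; rewrite addnS.
case: (posnP (\sum_x (cnt (flat u) x - N x))) => [h0|hpos].
  have [||t ht||u' [h1 h2 h3]] := IH B u; rewrite ?h0 //; first exact: ltnW (hlo t ht).
  by exists u'; split => //; apply: weak.
have [|u1 [g1 g2 g3]] := discrepancy_step hu hpos.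
  by move=> t ht; apply: leq_ltn_trans (hlo t ht).
have [||t ht|t|u' [h1 h2 h3]] := IH B.+1 u1 => //.
- by rewrite -ltnS; apply: leq_trans g2 ho.
- by rewrite -ltnS; apply: leq_trans (hlo t ht) (g3 t).2.
- by apply: leq_trans (g3 t).1 _; rewrite ltnS.
- by exists u'; split => // t; apply: leq_trans (h3 t) _; rewrite addSnnS.
Qed.

Definition nmset : {set Q} := [set t | nonmono t].

Lemma card_nmset : #|nmset|%:R = k%:R ^+ r - k%:R :> R.
Proof.
have r0 : (0 < r)%N by apply: ltnW.
have hm : \sum_(t : Q | const_along (id : 'I_k -> 'I_k) t) \prod_(i < r) (1 : R) = k%:R.
  rewrite (sum_const_tuples (fun=> 1) id r0) (eq_bigr (fun=> 1)) ?sumr_const ?card_ord //.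
  by move=> c _; rewrite (big_pred1 c) ?expr1n // => x; rewrite /= eq_sym.
have htot : \sum_(t : Q) (1 : R) = k%:R ^+ r.
  by rewrite sumr_const cardT -cardE card_ffun !card_ord natrX.
rewrite -htot (bigID (const_along (id : 'I_k -> 'I_k))) /=.
rewrite (eq_bigr (fun t : Q => \prod_(i < r) (1 : R))); last by move=> t _; rewrite big1.
by rewrite hm addrC addrK sumr_const; congr _%:R; apply: eq_card => t; rewrite !inE.
Qed.

Lemma nmset_gt0 : (0 < #|nmset|)%N.
Proof.
pose x0 : 'I_k := Ordinal (ltnW (ltnW k_gt2)); pose x1 : 'I_k := Ordinal (ltnW k_gt2).
pose i0 : 'I_r := Ordinal (ltnW r_gt1); pose i1 : 'I_r := Ordinal r_gt1.
apply/card_gt0P; exists [ffun i => if i == i0 then x0 else x1]; rewrite inE.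
by apply: (@nonmono_pairP _ i0 i1); rewrite !ffunE /=.
Qed.

(** Transposing two colours preserves [nmset], so all colours are used equally often. *)
Lemma color_use x : (k * \sum_(t in nmset) cnt t x = #|nmset| * r)%N.
Proof.
have sym y : (\sum_(t in nmset) cnt t x = \sum_(t in nmset) cnt t y)%N.
  pose g (t : Q) : Q := [ffun i => tperm x y (t i)].
  have gK : involutive g by move=> t; apply/ffunP => i; rewrite !ffunE tpermK.
  rewrite (reindex_inj (inv_inj gK)) /=; apply: eq_big => t.
    rewrite !inE; congr (~~ _); apply/existsP/existsP => -[c /forallP hc];
    exists (tperm x y c); apply/forallP => i; have := hc i; rewrite ?ffunE => /eqP <-;
    by rewrite ?tpermK.
  move=> _; apply: eq_card => i; rewrite !inE ffunE.
  by rewrite -(inj_eq (@perm_inj _ (tperm x y))) tpermK tpermL.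
transitivity (\sum_(y < k) \sum_(t in nmset) cnt t y)%N.
  by rewrite -(eq_bigr _ (fun y _ => sym y)) sum_nat_const card_ord.
rewrite exchange_big /= -sum_nat_const; apply: eq_bigr => t _.
by rewrite sum_cnt card_ord.
Qed.

(** Running cyclically through all non-monochromatic tuples uses them almost equally, hence, by
    [color_use], also the colours. The excess left is at most [O], independently of [m], and
    [discrepancy_fix] removes it. *)
Lemma base_assignment (d : nat) : let O := (k * (#|nmset| * r + k * d))%N in
  (forall x, (m * r <= k * N x + k * d)%N) -> (O <= m %/ #|nmset|)%N ->
  exists u, [/\ forall w, nonmono (u w), forall x, cnt (flat u) x = N x &
    forall t, (cnt u t <= (m %/ #|nmset|).+1 + O)%N].
Proof.
move=> O hN hO; set K := #|nmset| in O hO *; have K0 : (0 < K)%N := nmset_gt0.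
pose idx (w : 'I_m) : 'I_K := Ordinal (ltn_pmod w K0).
pose u : {ffun 'I_m -> Q} := [ffun w => enum_val (idx w)].
have hu w : nonmono (u w) by rewrite ffunE; have := enum_valP (idx w); rewrite inE.
have cu t : t \in nmset -> (m %/ K <= cnt u t <= (m %/ K).+1)%N.
  move=> ht; have := card_mod_class m (enum_rank_in ht t).
  rewrite (_ : #|[set w : 'I_m | _]| = cnt u t) //; apply: eq_card => w; rewrite !inE ffunE.
  apply/eqP/eqP => e; last by have := congr1 (enum_rank_in ht) e; rewrite enum_valK_in => <-.
  rewrite -(enum_rankK_in ht ht); congr enum_val; exact: val_inj.
have cu' t : (cnt u t <= (m %/ K).+1)%N.
  case: (boolP (t \in nmset)) => [/cu /andP[] //|ht].
  rewrite /cnt (_ : [set w | _] = set0) ?cards0 //; apply/setP => w; rewrite !inE.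
  by apply/eqP => e; move: ht; rewrite inE -e hu.
apply: (@discrepancy_fix O _ u hu _ _ cu'); last first.
  move=> t ht; have htn : t \in nmset by rewrite inE.
  by apply: leq_trans hO _; have /andP[] := cu t htn.
rewrite /O -[X in (_ <= X * _)%N](card_ord k) -sum_nat_const; apply: leq_sum => x _.
rewrite -(leq_pmul2l (ltnW (ltnW k_gt2))) mulnBr.
have h1 : (k * cnt (flat u) x <= (m %/ K).+1 * (K * r))%N.
  rewrite -(color_use x) mulnCA leq_mul2l; apply/orP; right.
  rewrite cnt_flat (bigID (mem nmset)) /= [X in (_ + X)%N]big1 ?addn0; last first.
    move=> t ht; have : cnt u t = 0%N; last by move=> ->.
    rewrite /cnt (_ : [set w | _] = set0) ?cards0 //; apply/setP => w; rewrite !inE.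
    by apply/eqP => e; move: ht; rewrite inE -e hu.
  by rewrite big_distrr /=; apply: leq_sum => t _; rewrite leq_mul2r cu' orbT.
have h2 : (m %/ K * K <= m)%N := leq_trunc_div m K.
have h3 := hN x; have h4 : (m %/ K * K * r <= m * r)%N by rewrite leq_mul2r h2 orbT.
have k1 : (K * r + k * d <= k * (K * r + k * d))%N by rewrite leq_pmull // ltnW // ltnW.
apply: leq_trans k1; rewrite leq_subLR; apply: leq_trans h1 _.
rewrite mulSn addnC addnCA addnA [(K * r + _)%N]addnC -addnA addnC.
by rewrite [(K * r + k * d)%N]addnC; lia.
Qed.

End BaseAssignment.

(** * First and second moment of the number of colourings *)

Lemma paley_zygmund (S : finType) (X : S -> R) : (forall s, 0 <= X s) ->
  (\sum_s X s) ^+ 2 <= #|[set s | 0 < X s]|%:R * \sum_s X s ^+ 2.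
Proof.
move=> X0; set M : R := #|_|%:R; set A := \sum_s X s; set B := \sum_s X s ^+ 2.
have eA : A = \sum_(s in [set s | 0 < X s]) X s.
  rewrite /A (bigID (fun s => 0 < X s)) /= [X in _ + X]big1 ?addr0.
    by apply: eq_bigl => s; rewrite inE.
  by move=> s; rewrite -leNgt => h; apply/le_anti; rewrite h X0.
have eB : B = \sum_(s in [set s | 0 < X s]) X s ^+ 2.
  rewrite /B (bigID (fun s => 0 < X s)) /= [X in _ + X]big1 ?addr0.
    by apply: eq_bigl => s; rewrite inE.
  move=> s; rewrite -leNgt => h; have -> : X s = 0 by apply/le_anti; rewrite h X0.
  by rewrite expr0n.
have M0 : 0 <= M by [].
(* The sum of squares expands to [M (M B - A^2)], which is Cauchy-Schwarz on the support; [M = 0] is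
   treated apart. *)
have h : 0 <= \sum_(s in [set s | 0 < X s]) (M * X s - A) ^+ 2.
  by apply: sumr_ge0 => s _; apply: sqr_ge0.
have e : \sum_(s in [set s | 0 < X s]) (M * X s - A) ^+ 2 = M * (M * B - A ^+ 2).
  rewrite (eq_bigr (fun s => M ^+ 2 * X s ^+ 2 - 2 * M * A * X s + A ^+ 2)); last first.
    by move=> s _; ring.
  have sc : \sum_(s in [set s | 0 < X s]) A ^+ 2 = M * A ^+ 2 by rewrite sumr_const mulr_natl.
  by rewrite big_split /= sc sumrB -!mulr_sumr -eA -eB; ring.
rewrite e in h; move: M0; rewrite le_eqVlt => /orP[/eqP M0|M0].
  have : A = 0; last by move=> ->; rewrite expr0n -M0 mul0r.
  rewrite eA big1 // => s hs; have : (0 < #|[set s | (0 : R) < X s]%R|)%N by apply/card_gt0P; exists s.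
  by rewrite -(ltr0n R) -/M -M0 ltxx.
by move: h; rewrite pmulr_rge0 // subr_ge0.
Qed.

Section SecondMoment.
Variables (n d r m k : nat).
Notation T := ('I_m * 'I_r)%type.
Notation Q := {ffun 'I_r -> 'I_k}.
Variable vtx : {ffun T -> 'I_n}.
Hypothesis hvtx : forall v, cnt vtx v = d.
Hypotheses (d_gt0 : (0 < d)%N) (r_gt1 : (1 < r)%N) (k_gt2 : (2 < k)%N).
Hypothesis n_gt0 : (0 < n)%N.
Implicit Types (s : {perm T}) (sg tu : {ffun 'I_n -> 'I_k}).

Let k_gt0 : (0 < k)%N. Proof. exact: ltnW (ltnW k_gt2). Qed.
Let r_gt0 : (0 < r)%N. Proof. exact: ltnW. Qed.
Let m_gt0 : (0 < m)%N.
Proof.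
have := card_config hvtx; case: (posnP m) => // ->; rewrite mul0n => /eqP.
by rewrite muln_eq0 !eqn0Ngt n_gt0 d_gt0.
Qed.
Let nR : (0 : R) < n%:R. Proof. by rewrite ltr0n. Qed.
Let mR : (0 : R) < m%:R. Proof. by rewrite ltr0n. Qed.
Let kR : (0 : R) < k%:R. Proof. by rewrite ltr0n. Qed.

Definition sg0 : {ffun 'I_n -> 'I_k} := [ffun v : 'I_n => Ordinal (ltn_pmod v k_gt0)].

Lemma cnt_sg0 x : (n %/ k <= cnt sg0 x <= (n %/ k).+1)%N.
Proof.
have := card_mod_class n x; rewrite (_ : #|[set w : 'I_n | _]| = cnt sg0 x) //.
apply: eq_card => v; rewrite !inE ffunE.
by apply/eqP/eqP => [e|<-] //; apply: val_inj.
Qed.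

Lemma freq_sg0 x : freq sg0 x <= k%:R^-1 * (1 + k%:R / n%:R).
Proof.
have -> : k%:R^-1 * (1 + k%:R / n%:R) = (n%:R / k%:R + 1) / n%:R :> R.
  by field; rewrite !gt_eqF.
rewrite /freq card_ord ler_wpM2r ?invr_ge0 ?ler0n //.
have /andP[_ h] := cnt_sg0 x; apply: (@le_trans _ _ (n %/ k).+1%:R); first by rewrite ler_nat.
by rewrite -natr1 lerD2r ler_pdivlMr // -natrM ler_nat leq_trunc_div.
Qed.

(** The counts agree exactly with those of [sg0], so this is a single class: [class_ge] bounds its
    size, and its members are all proper equally often. *)
Definition balanced : {set {ffun 'I_n -> 'I_k}} := [set sg | same_cnt sg0 sg].

Lemma balanced_ge :
  k%:R ^+ n <= polyfac 'I_n 'I_k * exp k%:R * #|balanced|%:R :> R.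
Proof.
have h := class_ge sg0; rewrite -/balanced in h.
have hp : \prod_t freq sg0 (sg0 t) <= k%:R^-1 ^+ n * exp k%:R.
  apply: (@le_trans _ _ (\prod_(t < n) (k%:R^-1 * (1 + k%:R / n%:R)))).
    by apply: ler_prod => t _; rewrite freq_ge0 freq_sg0.
  rewrite prodr_const card_ord exprMn ler_wpM2l ?exprn_ge0 ?invr_ge0 //.
  apply: (@le_trans _ _ (exp (k%:R / n%:R) ^+ n)).
    by rewrite lerXn2r ?nnegrE ?exp_ge0 ?exp_ge1D // addr_ge0 // divr_ge0.
  by rewrite exprX mulrC divfK // gt_eqF.
have := le_trans h (ler_wpM2l _ hp).
rewrite mulr_ge0 ?(ltW (polyfac_gt0 _ _)) // => /(_ isT) h2.
rewrite -(ler_pM2l (_ : 0 < k%:R^-1 ^+ n)) ?exprn_gt0 ?invr_gt0 //.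
rewrite -exprMn mulVf ?gt_eqF // expr1n; apply: le_trans h2 _.
by rewrite le_eqVlt; apply/orP; left; apply/eqP; ring.
Qed.

Notation Kn := #|nmset r k|.
(** The budget [O] of [base_assignment], a constant once [r], [d], [k] are fixed. *)
Definition slack := (k * (Kn * r + k * d))%N.

Definition proper_words : {set {ffun T -> 'I_k}} :=
  [set h | same_cnt (lift_coloring vtx sg0) h && [forall w, nonmono [ffun i => h (w, i)]]].

(** Permuting the tuples of one base assignment changes neither the colour counts nor properness.
    The assignment uses the [Kn] admissible tuples almost uniformly, so by [class_ge] these
    rearrangements number [Kn^m] up to a polynomial factor. *)
Lemma proper_words_ge : (slack <= m %/ Kn)%N ->
  Kn%:R ^+ m <= polyfac 'I_m Q * exp (Kn%:R * slack.+1%:R) * #|proper_words|%:R :> R.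
Proof.
move=> hs; have K0 : (0 < Kn)%N := nmset_gt0 r_gt1 k_gt2.
have KR : (0 : R) < Kn%:R by rewrite ltr0n.
pose N x := cnt (lift_coloring vtx sg0) x.
have sumN : (\sum_x N x = m * r)%N by rewrite sum_cnt card_prod !card_ord.
have hN x : (m * r <= k * N x + k * d)%N.
  rewrite /N (cnt_lift hvtx) -(card_config hvtx) mulnCA [(k * d)%N]mulnC -mulnDr mulnC leq_mul2l.
  apply/orP; right; have /andP[h _] := cnt_sg0 x.
  apply: (@leq_trans (k * (n %/ k) + k)); last by rewrite leq_add2r leq_mul2l h orbT.
  by rewrite addnC -mulnS mulnC ltnW // ltn_ceil.
have [u [h1 h2 h3]] := base_assignment r_gt1 k_gt2 sumN hN hs.
have hc : (#|[set u' | same_cnt u u']| <= #|proper_words|)%N.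
  rewrite -(@card_imset _ _ (@flat m r k)); last first.
    move=> v v' /ffunP e; apply/ffunP => w; apply/ffunP => i.
    by have := e (w, i); rewrite !ffunE.
  apply: subset_leq_card; apply/subsetP => _ /imsetP[v hv ->].
  move: hv; rewrite !inE => /forallP hv; apply/andP; split.
    apply/forallP => x; rewrite -/(N x) -h2 !cnt_flat; apply/eqP.
    by apply: eq_bigr => t _; rewrite (eqP (hv t)).
  apply/forallP => w; rewrite (_ : [ffun i => flat v (w, i)] = v w); last first.
    by apply/ffunP => i; rewrite !ffunE.
  have : (0 < cnt v (v w))%N by apply/card_gt0P; exists w; rewrite inE.
  rewrite -(eqP (hv _)) => /card_gt0P[w']; rewrite inE => /eqP <-.
  exact: h1.
have hf t : freq u t <= Kn%:R^-1 * (1 + Kn%:R * slack.+1%:R / m%:R).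
  have -> : Kn%:R^-1 * (1 + Kn%:R * slack.+1%:R / m%:R) =
     (m%:R / Kn%:R + slack.+1%:R) / m%:R :> R by field; rewrite !gt_eqF.
  rewrite /freq card_ord ler_wpM2r ?invr_ge0 ?ler0n //.
  apply: (@le_trans _ _ ((m %/ Kn).+1 + slack)%:R); first by rewrite ler_nat h3.
  rewrite addSnnS natrD lerD2r ler_pdivlMr // -natrM ler_nat.
  exact: leq_trunc_div.
have hp : \prod_t freq u (u t) <= Kn%:R^-1 ^+ m * exp (Kn%:R * slack.+1%:R).
  apply: (@le_trans _ _ (\prod_(t < m) (Kn%:R^-1 * (1 + Kn%:R * slack.+1%:R / m%:R)))).
    by apply: ler_prod => t _; rewrite freq_ge0 hf.
  rewrite prodr_const card_ord exprMn ler_wpM2l ?exprn_ge0 ?invr_ge0 //.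
  apply: (@le_trans _ _ (exp (Kn%:R * slack.+1%:R / m%:R) ^+ m)).
    by rewrite lerXn2r ?nnegrE ?exp_ge0 ?exp_ge1D // addr_ge0 // divr_ge0 // mulr_ge0.
  by rewrite exprX mulrC divfK // gt_eqF.
have := le_trans (class_ge u) (ler_wpM2l _ hp).
rewrite mulr_ge0 ?(ltW (polyfac_gt0 _ _)) // => /(_ isT) hh.
rewrite -(ler_pM2l (_ : 0 < Kn%:R^-1 ^+ m)) ?exprn_gt0 ?invr_gt0 //.
rewrite -exprMn mulVf ?gt_eqF // expr1n; apply: le_trans hh _.
rewrite -(ler_nat R) in hc.
set P := polyfac _ _; set E := exp _; set I := _ ^+ m.
have -> : P * #|[set u' | same_cnt u u']|%:R * (I * E) =
  (P * I * E) * #|[set u' | same_cnt u u']|%:R by ring.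
have -> : I * (P * E * #|proper_words|%:R) = (P * I * E) * #|proper_words|%:R by ring.
rewrite ler_wpM2l // !mulr_ge0 ?exp_ge0 ?(ltW (polyfac_gt0 _ _)) //.
by rewrite exprn_ge0 // invr_ge0.
Qed.

(** The colouring read along the slots is uniform on a class of at most [k^(m r)] words, among which
    [proper_words] are the good ones. *)
Lemma proper_conf_ge sg : sg \in balanced ->
  (#|{: T}|`! * #|proper_words| <= k ^ (m * r) * #|[set s | proper_conf vtx sg s]|)%N.
Proof.
rewrite inE => /forallP hsg.
have hl x : cnt (lift_coloring vtx sg0) x = cnt (lift_coloring vtx sg) x.
  by rewrite !(cnt_lift hvtx) (eqP (hsg x)).
have := card_perm_class (lift_coloring vtx sg)
   (fun h : {ffun T -> 'I_k} => [forall w, nonmono [ffun i => h (w, i)]]).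
have -> : [set h | same_cnt (lift_coloring vtx sg) h &
    [forall w, nonmono [ffun i => h (w, i)]]] = proper_words.
  apply/setP => h; rewrite !inE; congr andb.
  by apply: eq_forallb => x; rewrite hl.
have -> : [set s | [forall w, nonmono [ffun i => pcomp (lift_coloring vtx sg) s (w, i)]]] =
    [set s | proper_conf vtx sg s].
  apply/setP => s; rewrite !inE; apply: eq_forallb => w; congr nonmono.
  by apply/ffunP => i; rewrite !ffunE.
move=> ->; rewrite -(card_class (lift_coloring vtx sg)) mulnA [(k ^ _ * _)%N]mulnC leq_mul2r.
apply/orP; right; rewrite leq_mul2l; apply/orP; right; apply: leq_trans (max_card _) _.
by rewrite card_ffun card_prod !card_ord.
Qed.

Variable q : R.
Hypotheses (hq : q = k%:R / k%:R ^+ r) (q_lt1 : q < 1).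
Hypothesis key : forall y : R, 0 <= y <= k%:R + 1 ->
  d%:R / (r%:R * (1 - q) ^+ 2) * (k%:R ^+ 2 / (k%:R ^+ 2) ^+ r) * bern_gap r y
    <= y * ln y - y + 1.
Hypothesis n_large : (k ^ 2 <= n)%N.
Hypothesis m_large : (slack <= m %/ Kn)%N.

Definition proper_count s : R := #|[set sg in balanced | proper_conf vtx sg s]|%:R.

Let F : R := #|{: T}|`!%:R.
Let F_gt0 : 0 < F. Proof. by rewrite ltr0n fact_gt0. Qed.

(** As [Kn = k^r (1 - q)], the counts of proper words and of balanced colourings combine to
    [(1 - q)^m k^n], the mean for independent tuples. *)
Lemma first_moment_ge :
  F * ((1 - q) ^+ m * k%:R ^+ n) <=
  (polyfac 'I_n 'I_k * exp k%:R) * (polyfac 'I_m Q * exp (Kn%:R * slack.+1%:R)) *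
  \sum_s proper_count s.
Proof.
set P1 := _ * exp k%:R; set P2 := _ * exp (Kn%:R * _).
have P10 : 0 < P1 by rewrite mulr_gt0 ?polyfac_gt0 ?exp_gt0.
have P20 : 0 < P2 by rewrite mulr_gt0 ?polyfac_gt0 ?exp_gt0.
have eX : \sum_s proper_count s = \sum_(sg in balanced) #|[set s | proper_conf vtx sg s]|%:R.
  transitivity (\sum_s \sum_(sg | (sg \in balanced) && proper_conf vtx sg s) (1 : R)).
    apply: eq_bigr => s _; rewrite sumr_const; congr _%:R.
    by apply: eq_card => sg; rewrite in_set.
  rewrite (exchange_big_dep (mem balanced)) /=; last by move=> s sg _ /andP[].
  apply: eq_bigr => sg hsg; rewrite sumr_const; congr _%:R.
  by apply: eq_card => s; rewrite in_set unfold_in /= hsg.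
have hX : #|balanced|%:R * (F * #|proper_words|%:R) <= k%:R ^+ (m * r) * \sum_s proper_count s.
  rewrite eX mulr_sumr mulr_natl -sumr_const; apply: ler_sum => sg hsg.
  by rewrite /F -natrX -!natrM ler_nat proper_conf_ge.
have b1 := balanced_ge; have b2 := proper_words_ge m_large.
rewrite -/P1 in b1; rewrite -/P2 in b2.
have hK : Kn%:R = k%:R ^+ r * (1 - q) :> R.
  rewrite (card_nmset k r_gt1) hq; field.
  by rewrite gt_eqF // exprn_gt0.
have hKm : Kn%:R ^+ m = k%:R ^+ (m * r) * (1 - q) ^+ m :> R.
  by rewrite hK exprMn -exprM mulnC.
have kN : 0 < k%:R ^+ (m * r) :> R by rewrite exprn_gt0.
rewrite -(ler_pM2l kN).
have -> : k%:R ^+ (m * r) * (F * ((1 - q) ^+ m * k%:R ^+ n)) = F * (Kn%:R ^+ m * k%:R ^+ n) :> R.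
  by rewrite hKm; ring.
apply: (@le_trans _ _ (F * ((P2 * #|proper_words|%:R) * (P1 * #|balanced|%:R)))).
  rewrite ler_wpM2l ?(ltW F_gt0) // ler_pM // exprn_ge0 //.
have -> : F * (P2 * #|proper_words|%:R * (P1 * #|balanced|%:R)) =
  P1 * P2 * (#|balanced|%:R * (F * #|proper_words|%:R)) by ring.
have -> : k%:R ^+ (m * r) * (P1 * P2 * \sum_s proper_count s) =
  P1 * P2 * (k%:R ^+ (m * r) * \sum_s proper_count s) by ring.
by rewrite ler_wpM2l // ltW // mulr_gt0.
Qed.

(** An overlap entry is at most its marginal, about [1 / k]; [k^2 <= n] bounds the rounding by 1.
    This is why the entropy inequality is required only up to [y = k + 1]. *)
Lemma join_freq_le sg tu x : sg \in balanced ->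
  k%:R ^+ 2 * freq (join_col sg tu) x <= k%:R + 1.
Proof.
rewrite inE => /forallP hsg.
have h1 : freq (join_col sg tu) x <= freq sg0 x.1.
  rewrite /freq ler_wpM2r ?invr_ge0 // ler_nat (eqP (hsg x.1)).
  apply: subset_leq_card; apply/subsetP => v; rewrite !inE ffunE => /eqP <-.
  by rewrite eqxx.
have h2 := le_trans h1 (freq_sg0 x.1).
apply: (le_trans (ler_wpM2l _ h2)); first by rewrite exprn_ge0.
have -> : k%:R ^+ 2 * (k%:R^-1 * (1 + k%:R / n%:R)) = k%:R + k%:R ^+ 2 / n%:R :> R.
  by field; rewrite !gt_eqF.
by rewrite lerD2l ler_pdivrMr // mul1r -natrX ler_nat.
Qed.

Lemma second_moment_le :
  \sum_s proper_count s ^+ 2 <=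
  polyfac T ('I_k * 'I_k)%type * n.+1%:R ^+ (k * k) * F * ((1 - q) ^+ m * k%:R ^+ n) ^+ 2.
Proof.
have eX : \sum_s proper_count s ^+ 2 = \sum_(sg in balanced) \sum_(tu in balanced)
    #|[set s | proper_conf vtx sg s && proper_conf vtx tu s]|%:R.
  transitivity (\sum_s \sum_(sg in balanced) \sum_(tu in balanced)
      ((proper_conf vtx sg s && proper_conf vtx tu s)%:R : R)).
    apply: eq_bigr => s _.
    have -> : proper_count s = \sum_(sg in balanced) (proper_conf vtx sg s)%:R.
      rewrite /proper_count -sum1_card natr_sum big_mkcond [RHS]big_mkcond /=.
      by apply: eq_bigr => sg _; rewrite !inE; case: (same_cnt _ _) => //=; case: proper_conf.
    rewrite expr2 mulr_suml; apply: eq_bigr => sg _; rewrite mulr_sumr.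
    by apply: eq_bigr => tu _; rewrite -natrM mulnb.
  rewrite exchange_big /=; apply: eq_bigr => sg _; rewrite exchange_big /=.
  apply: eq_bigr => tu _; rewrite -natr_sum -sum1_card [in RHS]big_mkcond /=; congr _%:R.
  by apply: eq_bigr => s _; rewrite inE; case: (_ && _).
set P3 := polyfac _ _; have P30 : 0 < P3 := polyfac_gt0 _ _.
pose W (f : {ffun 'I_n -> 'I_k * 'I_k}) : R := \prod_v freq f (f v).
have step sg tu : sg \in balanced ->
    #|[set s | proper_conf vtx sg s && proper_conf vtx tu s]|%:R <=
    P3 * F * ((1 - q) ^+ m * k%:R ^+ n) ^+ 2 * W (join_col sg tu).
  move=> hsg; apply: le_trans (proper_pair_le hvtx d_gt0 n_gt0 k_gt0 r_gt0 sg tu) _.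
  rewrite -/P3 -/F -hq -[leRHS]mulrA -[leRHS]mulrA -[leLHS]mulrA.
  rewrite !ler_wpM2l ?(ltW F_gt0) ?(ltW P30) //.
  apply: le_trans (overlap_weight_le n_gt0 k_gt0 r_gt0 (card_config hvtx) hq q_lt1 key _) _.
    by move=> x; apply: join_freq_le.
  rewrite le_eqVlt; apply/orP; left; apply/eqP; rewrite -/(W _) [in RHS]exprMn -!exprM.
  by rewrite [(m * 2)%N]mulnC [(n * 2)%N]mulnC mulrA.
rewrite eX; apply: (@le_trans _ _ (\sum_(sg in balanced) \sum_(tu in balanced)
    P3 * F * ((1 - q) ^+ m * k%:R ^+ n) ^+ 2 * W (join_col sg tu))).
  by apply: ler_sum => sg hsg; apply: ler_sum => tu _; apply: step.
under eq_bigr do rewrite -mulr_sumr.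
rewrite -mulr_sumr.
(* After [overlap_weight_le] each pair contributes only the weight of its overlap type, and these
   weights sum to a polynomial by [sum_freq_le]. *)
have hW : \sum_(sg in balanced) \sum_(tu in balanced) W (join_col sg tu) <= n.+1%:R ^+ (k * k).
  have W0 f : 0 <= W f by apply: prodr_ge0 => v _; apply: freq_ge0.
  have := sum_freq_le 'I_n ('I_k * 'I_k)%type; rewrite card_prod !card_ord.
  apply: le_trans; rewrite -/(W _).
  apply: (@le_trans _ _ (\sum_sg \sum_tu W (join_col sg tu))).
    rewrite [leRHS](bigID (mem balanced)) /= -[leLHS]addr0 lerD ?sumr_ge0 //; last first.
      by move=> sg _; apply: sumr_ge0.
    apply: ler_sum => sg _; rewrite [leRHS](bigID (mem balanced)) /= -[leLHS]addr0 lerD //.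
    by apply: sumr_ge0.
  rewrite pair_bigA /= (reindex (fun f : {ffun 'I_n -> 'I_k * 'I_k} =>
     ([ffun v => (f v).1], [ffun v => (f v).2]))) /=; last first.
    exists (fun p => join_col p.1 p.2) => [f _|[a b] _] /=.
      by apply/ffunP => v; rewrite !ffunE -surjective_pairing.
    by congr pair; apply/ffunP => v; rewrite !ffunE.
  apply: ler_sum => f _; rewrite (_ : join_col _ _ = f) //.
  by apply/ffunP => v; rewrite !ffunE -surjective_pairing.
set Y := (_ * _) ^+ 2.
have Y0 : 0 <= Y by apply: sqr_ge0.
have -> : P3 * n.+1%:R ^+ (k * k) * F * Y = P3 * F * Y * n.+1%:R ^+ (k * k) by ring.
by apply: ler_wpM2l => //; apply: mulr_ge0 => //; apply: mulr_ge0; apply: ltW.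
Qed.

Lemma proper_count_pos s : 0 < proper_count s -> uncolored vtx k s = 0%N.
Proof.
rewrite ltr0n => /card_gt0P[sg]; rewrite inE => /andP[_ /forallP hsg].
apply/eqP; rewrite -leqn0 -(cards0 'I_n); apply: uncolored_le => //.
apply/existsP; exists sg; apply/forallP => w; apply/orP; right.
have := hsg w; apply: contraNN => /existsP[c /forall_inP hc]; apply/existsP; exists c.
by apply/forallP => i; rewrite ffunE; apply: hc; apply: (mem_edge vtx s (w, i)).
Qed.

Lemma colorable_prob_ge :
  F <= ((polyfac 'I_n 'I_k * exp k%:R) * (polyfac 'I_m Q * exp (Kn%:R * slack.+1%:R))) ^+ 2 *
    (polyfac T ('I_k * 'I_k)%type * n.+1%:R ^+ (k * k)) *
    #|[set s | uncolored vtx k s == 0%N]|%:R.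
Proof.
have h1 := first_moment_ge; have h2 := second_moment_le.
have h3 := @paley_zygmund {perm T} proper_count (fun s => ler0n _ _).
set P12 := (_ * _ * (polyfac 'I_m _ * _)) in h1 *.
set P3 := polyfac T _ * _ in h2 *.
set Y := (1 - q) ^+ m * _ in h1 h2.
have P120 : 0 < P12 by rewrite !mulr_gt0 ?polyfac_gt0 ?exp_gt0.
have P30 : 0 < P3 by rewrite mulr_gt0 ?polyfac_gt0 ?exprn_gt0.
have Y0 : 0 < Y by rewrite mulr_gt0 ?exprn_gt0 // subr_gt0.
set A := \sum_s proper_count s in h1 h3; set B := \sum_s _ ^+ 2 in h2 h3.
have hM : #|[set s | 0 < proper_count s]|%:R <= #|[set s | uncolored vtx k s == 0%N]|%:R :> R.
  rewrite ler_nat; apply: subset_leq_card; apply/subsetP => s.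
  by rewrite !inE => /proper_count_pos ->.
set M : R := #|[set s | uncolored vtx k s == 0%N]|%:R in hM *.
have M0 : 0 <= M by [].
have FY : 0 < F * Y ^+ 2 by rewrite mulr_gt0 // exprn_gt0.
rewrite -(ler_pM2r FY).
have -> : F * (F * Y ^+ 2) = (F * Y) ^+ 2 by ring.
apply: (@le_trans _ _ ((P12 * A) ^+ 2)).
  by rewrite lerXn2r ?nnegrE // ?(le_trans _ h1) // mulr_ge0 // ltW.
rewrite exprMn -[leRHS]mulrA -[leRHS]mulrA; apply: ler_wpM2l; first exact: sqr_ge0.
apply: le_trans h3 _; apply: (@le_trans _ _ (M * (P3 * F * Y ^+ 2))).
  apply: ler_pM => //; by apply: sumr_ge0 => s _; apply: sqr_ge0.
by rewrite le_eqVlt; apply/orP; left; apply/eqP; ring.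
Qed.

End SecondMoment.

(** * Exponential tail bounds *)

Lemma exp_ge_pow (x : R) (M : nat) : 0 <= x -> (x / M.+1%:R) ^+ M.+1 <= exp x.
Proof.
move=> x0; have MR : (0 : R) < M.+1%:R by rewrite ltr0Sn.
have MN : M.+1%:R != 0 :> R by rewrite gt_eqF.
have -> : exp x = exp (x / M.+1%:R) ^+ M.+1 by rewrite exprX mulrC divfK.
rewrite lerXn2r ?nnegrE ?exp_ge0 ?divr_ge0 //.
by apply: le_trans (exp_ge1D _); rewrite lerDr ler01.
Qed.

Lemma archimedean_nat (x : R) : exists n : nat, x <= n%:R.
Proof.
have [n hn] := INR_unbounded x; exists n.
by rewrite -INRE; apply/ltW/RltP.
Qed.

Lemma poly_exp_small (C D c : R) (E : nat) (delta : R) :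
  0 <= C -> 0 <= D -> 0 < c -> 0 < delta ->
  exists n0 : nat, forall n : nat, (n0 <= n)%N ->
    C * (D * n%:R) ^+ E * exp (- (c * n%:R)) <= delta.
Proof.
move=> C0 D0 c0 dl0; pose B := (c / E.+1%:R) ^+ E.+1.
have B0 : 0 < B by rewrite exprn_gt0 // divr_gt0 // ltr0Sn.
have [n0 hn0] := archimedean_nat (C * D ^+ E / (B * delta)).
exists n0.+1 => n hn; have nR : (0 : R) < n%:R by rewrite ltr0n (leq_trans _ hn).
have he := @exp_ge_pow (c * n%:R) E (mulr_ge0 (ltW c0) (ltW nR)).
have eB : (c * n%:R / E.+1%:R) ^+ E.+1 = B * n%:R ^+ E.+1.
  by rewrite mulrAC exprMn.
rewrite eB in he.
rewrite expRNE ler_pdivrMr ?exp_gt0 //.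
apply: (@le_trans _ _ (delta * (B * n%:R ^+ E.+1))); last by rewrite ler_wpM2l // ltW.
rewrite exprMn exprS.
have -> : delta * (B * (n%:R * n%:R ^+ E)) = (B * delta * n%:R) * n%:R ^+ E by ring.
rewrite mulrA ler_wpM2r ?exprn_ge0 // -ler_pdivrMl ?mulr_gt0 // mulrC.
by apply: le_trans hn0 _; rewrite ler_nat ltnW.
Qed.

Lemma natr_dist_le (x y c : nat) :
  (x <= y + c)%N -> (y <= x + c)%N -> `|x%:R - y%:R| <= c%:R :> R.
Proof.
rewrite -!(ler_nat R) !natrD => h1 h2; rewrite ler_norml; apply/andP; split; lra.
Qed.

Section Tails.
Variables (n d r m : nat).
Notation T := ('I_m * 'I_r)%type.
Variable vtx : {ffun T -> 'I_n}.
Hypothesis hvtx : forall v, cnt vtx v = d.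
Hypotheses (d_gt0 : (0 < d)%N) (r_gt1 : (1 < r)%N) (n_gt0 : (0 < n)%N).
Implicit Types (s : {perm T}).

Let nR : (0 : R) < n%:R. Proof. by rewrite ltr0n. Qed.
Let dR : (0 : R) < d%:R. Proof. by rewrite ltr0n. Qed.
Let rR : (0 : R) < r%:R. Proof. by rewrite ltr0n ltnW. Qed.
Let F : R := #|{: T}|`!%:R.
Let F_gt0 : 0 < F. Proof. by rewrite ltr0n fact_gt0. Qed.
Let cT : #|{: T}| = (n * d)%N. Proof. by rewrite card_prod !card_ord (card_config hvtx). Qed.

(** A common bound for the bases [e (j + 1)] of all the [polyfac] factors, valid for [j <= n d]. *)
Definition poly_base : R := 2 * exp 1 * d%:R * n%:R.

Let base_ge (j : nat) : (j <= n * d)%N -> 0 <= exp 1 * j.+1%:R <= poly_base.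
Proof.
move=> hj; rewrite mulr_ge0 ?exp_ge0 //=.
have -> : poly_base = exp 1 * (2 * (n * d)%:R) by rewrite /poly_base natrM; ring.
rewrite ler_wpM2l ?exp_ge0 // -natrM ler_nat.
have : (0 < n * d)%N by rewrite muln_gt0 n_gt0.
by lia.
Qed.

Let m_le : (m <= n * d)%N.
Proof. by rewrite (card_config hvtx) leq_pmulr // ltnW. Qed.

(** The size tested is the least integer [a >= p0 n]. Rounding up does no harm, as
    [1 - ln p - (d / r) p^(r-1)] decreases in [p]. *)
Lemma alpha_tail_exp (p0 c : R) : 0 < p0 -> p0 <= 1 -> 0 <= c ->
  1 - ln p0 - d%:R / r%:R * p0 ^+ r.-1 <= - c ->
  #|[set s | p0 * n%:R <= (alpha (hg vtx s))%:R]|%:R <=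
    poly_base ^+ 2 * exp (- (p0 * c * n%:R)) * F.
Proof.
move=> p00 p01 c0 hc.
have exa : exists a : nat, p0 * n%:R <= a%:R by exists n; rewrite ler_piMl.
pose a := ex_minn exa; have [ha amin] : p0 * n%:R <= a%:R /\
    forall j : nat, p0 * n%:R <= j%:R -> (a <= j)%N by rewrite /a; case: ex_minnP.
have an : (a <= n)%N by apply: amin; rewrite ler_piMl.
have a0 : (0 < a)%N by rewrite -(ltr0n R); apply: lt_le_trans ha; rewrite mulr_gt0.
apply: (@le_trans _ _ #|[set s | (a <= alpha (hg vtx s))%N]|%:R).
  rewrite ler_nat; apply: subset_leq_card; apply/subsetP => s; rewrite !inE.
  exact: amin.
apply: le_trans (alpha_tail hvtx d_gt0 _) _; first by rewrite a0 an.
rewrite -/F [leRHS]mulrAC ler_pM //.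
- by rewrite mulr_ge0 ?(ltW (polyfac_gt0 _ _)) // ltW.
- exact: exp_ge0.
- rewrite ler_wpM2r ?(ltW F_gt0) // /polyfac card_bool cT.
  by have /andP[h1 h2] := base_ge (leqnn _); rewrite lerXn2r ?nnegrE // (le_trans h1).
rewrite ler_exp; set p : R := a%:R / n%:R.
have pp : p0 <= p by rewrite ler_pdivlMr.
have p_gt0 : 0 < p by apply: lt_le_trans pp.
have ea : a%:R = n%:R * p :> R by rewrite /p mulrC divfK // gt_eqF.
have em : m%:R = n%:R * (d%:R / r%:R) :> R.
  by rewrite mulrA -natrM (card_config hvtx) natrM mulfK // gt_eqF.
have er : p ^+ r = p * p ^+ r.-1 by rewrite -exprS prednK // ltnW.
rewrite ea em er.
have -> : n%:R * p * (1 - ln p) - n%:R * (d%:R / r%:R) * (p * p ^+ r.-1) =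
   - (n%:R * p * - (1 - ln p - d%:R / r%:R * p ^+ r.-1)) by ring.
rewrite lerN2 [leLHS]mulrC mulrA ler_pM ?mulr_ge0 ?(ltW nR) ?(ltW p00) //.
  by rewrite ler_wpM2l // ltW.
have l1 := ler_ln p00 pp.
have l2 : d%:R / r%:R * p0 ^+ r.-1 <= d%:R / r%:R * p ^+ r.-1.
  by rewrite ler_wpM2l ?divr_ge0 // lerXn2r ?nnegrE ?(ltW p00) ?(ltW p_gt0).
lra.
Qed.

Lemma uncolored_tail (k : nat) (q eta : R) :
  (2 < k)%N -> q = k%:R / k%:R ^+ r -> q < 1 ->
  (forall y : R, 0 <= y <= k%:R + 1 ->
    d%:R / (r%:R * (1 - q) ^+ 2) * (k%:R ^+ 2 / (k%:R ^+ 2) ^+ r) * bern_gap r y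
      <= y * ln y - y + 1) ->
  (k ^ 2 <= n)%N -> (slack d r k <= m %/ #|nmset r k|)%N ->
  0 < eta -> eta <= 1 ->
  #|[set s | eta * n%:R <= (uncolored vtx k s)%:R]|%:R <=
    exp (2 * (k%:R + #|nmset r k|%:R * (slack d r k).+1%:R)) *
    poly_base ^+ (2 * (k + k ^ r) + 2 * (k * k)) * exp (- (eta ^+ 2 / (256 * d%:R) * n%:R)) * F.
Proof.
move=> k2 hq q1 key nk mk eta0 eta1.
have k0 : (0 < k)%N by apply: ltnW; apply: ltnW.
have hG := colorable_prob_ge hvtx d_gt0 r_gt1 k2 n_gt0 hq q1 key nk mk.
set G := (X in F <= X * _) in hG.
(* This [lam] minimises [64 d lam^2 - eta lam], the exponent per vertex for a function with
   Lipschitz constant [2 lam]; the minimum is [- eta^2 / (256 d)]. *)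
pose lam := eta / (128 * d%:R).
have d1 : (1 : R) <= d%:R by rewrite ler1n.
have lam0 : 0 < lam by rewrite divr_gt0 ?mulr_gt0.
have lam1 : lam <= 1 / 8.
  by rewrite ler_pdivrMr ?mulr_gt0 //; nra.
pose f s : R := lam * (uncolored vtx k s)%:R.
have lip p b s : `|f (tperm p b * s)%g - f s| <= 2 * lam.
  have u1 := uncolored_lipschitz vtx r_gt1 k0 p b s.
  have := uncolored_lipschitz vtx r_gt1 k0 p b (tperm p b * s)%g.
  rewrite mulgA tperm2 mul1g => u2; rewrite -mulrBr normrM gtr0_norm // mulrC.
  by rewrite ler_wpM2r ?(ltW lam0) //; apply: natr_dist_le u1 u2.
have tail := @perm_lipschitz_tail _ (2 * lam) (lam * (eta * n%:R)) f _ lip.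
have {}tail : #|[set s | f s <= 0]|%:R * #|[set s | lam * (eta * n%:R) <= f s]|%:R <=
   F ^+ 2 * exp (16 * (2 * lam) ^+ 2 * #|{: T}|%:R - lam * (eta * n%:R)).
  by apply: tail; lra.
have eU : [set s | lam * (eta * n%:R) <= f s] = [set s | eta * n%:R <= (uncolored vtx k s)%:R].
  by apply/setP => s; rewrite !inE ler_pM2l.
have eZ : [set s | f s <= 0] = [set s | uncolored vtx k s == 0%N].
  by apply/setP => s; rewrite !inE pmulr_rle0 // lern0.
rewrite eU eZ in tail.
have eE : 16 * (2 * lam) ^+ 2 * #|{: T}|%:R - lam * (eta * n%:R) =
    - (eta ^+ 2 / (256 * d%:R) * n%:R).
  by rewrite cT natrM /lam; field; rewrite gt_eqF.
rewrite eE in tail; set X := exp (- _) in tail *.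
set U : R := #|[set s | eta * n%:R <= _]|%:R in tail *.
set Z : R := #|[set s | uncolored vtx k s == 0%N]|%:R in tail hG.
have Z0 : 0 <= Z by []. have U0 : 0 <= U by [].
have X0 : 0 < X := exp_gt0 _.
have G0 : 0 <= G.
  by rewrite mulr_ge0 ?sqr_ge0 // mulr_ge0 ?(ltW (polyfac_gt0 _ _)) ?exprn_ge0.
have step1 : U <= G * X * F.
  rewrite -(ler_pM2l F_gt0).
  apply: (@le_trans _ _ (G * Z * U)); first by rewrite ler_wpM2r.
  apply: (@le_trans _ _ (G * (F ^+ 2 * X))); first by rewrite -mulrA ler_wpM2l.
  by rewrite le_eqVlt; apply/orP; left; apply/eqP; ring.
apply: le_trans step1 _; rewrite ler_wpM2r ?(ltW F_gt0) // ler_wpM2r ?(ltW X0) //.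
have pf (j : nat) (K : finType) (A : finType) : #|A| = j -> (j <= n * d)%N ->
    0 <= polyfac A K <= poly_base ^+ #|K|.
  move=> hA hj; rewrite (ltW (polyfac_gt0 _ _)) /= /polyfac hA.
  by have /andP[h1 h2] := base_ge hj; rewrite lerXn2r ?nnegrE // (le_trans h1).
have n_le : (n <= n * d)%N by rewrite leq_pmulr.
have /andP[a1 b1] := pf n 'I_k 'I_n (card_ord n) n_le.
have /andP[a2 b2] := pf m {ffun 'I_r -> 'I_k} 'I_m (card_ord m) m_le.
have /andP[a3 b3] := pf (n * d)%N ('I_k * 'I_k)%type T cT (leqnn _).
have base0 : 0 <= poly_base by have /andP[h1] := base_ge n_le; apply: le_trans.
have b4 : n.+1%:R ^+ (k * k) <= poly_base ^+ (k * k).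
  rewrite lerXn2r ?nnegrE //; have /andP[_] := base_ge n_le; apply: le_trans.
  by rewrite ler_peMl // (le_trans _ (exp_ge1D 1)) // lerDl ler01.
rewrite card_ord in b1; rewrite card_ffun !card_ord in b2; rewrite card_prod !card_ord in b3.
rewrite /G; set e1 := exp k%:R; set e2 := exp (#|_|%:R * _).
have -> : exp (2 * (k%:R + #|nmset r k|%:R * (slack d r k).+1%:R)) = (e1 * e2) ^+ 2.
  by rewrite /e1 /e2 -expRDE exprX.
rewrite (exprD poly_base (2 * (k + k ^ r))) [leRHS]mulrA; apply: ler_pM.
- exact: sqr_ge0.
- by apply: mulr_ge0; [exact: a3 | apply: exprn_ge0].
- rewrite [(2 * (k + _))%N]mulnC exprM -exprMn exprD; apply: lerXn2r; rewrite ?nnegrE.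
  + by rewrite !mulr_ge0 ?exp_ge0.
  + by rewrite !mulr_ge0 ?exp_ge0 ?exprn_ge0.
  rewrite mulrACA [leLHS]mulrC; apply: ler_wpM2l; first by rewrite mulr_ge0 ?exp_ge0.
  exact: ler_pM.
- by rewrite mul2n -addnn exprD; apply: ler_pM => //; apply: exprn_ge0.
Qed.

End Tails.

(** * The probabilistic conclusion for fixed [r], [d] and [k] *)

Lemma exists_vertex_map (n d r m : nat) : (n * d = m * r)%N ->
  exists vtx : {ffun 'I_m * 'I_r -> 'I_n}, forall v, cnt vtx v = d.
Proof.
move=> e; have ec : #|{: 'I_m * 'I_r}| = #|{: 'I_n * 'I_d}|.
  by rewrite !card_prod !card_ord.
pose g (t : 'I_m * 'I_r) : 'I_n * 'I_d := enum_val (cast_ord ec (enum_rank t)).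
pose g' (t : 'I_n * 'I_d) : 'I_m * 'I_r := enum_val (cast_ord (esym ec) (enum_rank t)).
have g'K : cancel g' g by move=> x; rewrite /g /g' enum_valK cast_ordKV enum_rankK.
have gK : cancel g g' by move=> x; rewrite /g /g' enum_valK cast_ordK enum_rankK.
exists [ffun t => (g t).1] => v; rewrite /cnt.
rewrite -(card_imset _ (can_inj gK)) -[RHS]card_ord.
rewrite -[RHS](@card_imset _ _ (fun i : 'I_d => (v, i))); last by move=> i j [].
apply: eq_card => -[v' i]; apply/imsetP/imsetP => [[t]|[j _ [-> ->]]].
  by rewrite inE ffunE => /eqP <- h; exists i => //; rewrite -h.
by exists (g' (v, j)); rewrite ?inE ?ffunE g'K.
Qed.

Section FixedParameters.
Variables (r d k : nat) (q p0 : R).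
Hypotheses (r_gt1 : (1 < r)%N) (d_gt0 : (0 < d)%N) (k_gt2 : (2 < k)%N).
Hypotheses (hq : q = k%:R / k%:R ^+ r) (q_lt1 : q < 1).
Hypothesis key : forall y : R, 0 <= y <= k%:R + 1 ->
  d%:R / (r%:R * (1 - q) ^+ 2) * (k%:R ^+ 2 / (k%:R ^+ 2) ^+ r) * bern_gap r y
    <= y * ln y - y + 1.
Hypotheses (p0_gt0 : 0 < p0) (p0_le1 : p0 <= 1).
Hypothesis p0_large : 1 - ln p0 < d%:R / r%:R * p0 ^+ r.-1.

(** Three events are excluded: a large independent set, more than [eta n] uncoloured vertices, and
    failure of sparsity. The threshold [n0] is chosen before [P], which depends on [n]. *)
Lemma prob_colorable_alpha (delta : R) : 0 < delta ->
  exists n0 : nat, forall n : nat, (n0 <= n)%N -> (r %| n * d)%N ->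
  forall P : pred (hgraph n),
    (forall H, H \in Hrnd n r d -> colorable H (k + 2 * r) ->
       (alpha H)%:R < p0 * n%:R -> P H) ->
    1 - delta <= prob r d P.
Proof.
move=> dl0.
have dR : (0 : R) < d%:R by rewrite ltr0n.
pose e := (2 * (r * d) + 4 * (r * d) ^ 2)%N; pose J := (2 * e).+1.
(* [cs] is the constant of [simple_card_ge]. Conditioning on simplicity multiplies probabilities by
   at most [cs], so each of the three bad events is allotted [delta / (3 cs)]. *)
pose C := (2 * (r * d) ^ 2 + J)%N; pose cs : nat := (2 * (1 + 2 * C) ^ J)%N.
have cs0 : (0 : R) < cs%:R by rewrite ltr0n muln_gt0 expn_gt0.
pose dl := delta / (3 * cs%:R); have dl'0 : 0 < dl by rewrite divr_gt0 ?mulr_gt0.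
have e3 : 1 <= exp 3 by apply: le_trans (exp_ge1D 3); lra.
pose A := exp 3 * d%:R ^+ 2.
have A1 : 1 <= A by rewrite mulr_ege1 // exprn_ege1 // ler1n.
have A0 : 0 < A by apply: lt_le_trans A1.
(* The largest [eta] for which every [h <= eta n] satisfies the hypothesis of [not_sparse_le]. *)
pose eta := A^-1; have eta0 : 0 < eta by rewrite invr_gt0.
have eta1 : eta <= 1 by rewrite invf_le1.
pose c1 := - (1 - ln p0 - d%:R / r%:R * p0 ^+ r.-1).
have c10 : 0 < c1 by rewrite /c1; move: p0_large; set u := _ * _ ^+ _; lra.
have D0 : 0 <= 2 * exp 1 * d%:R by rewrite !mulr_ge0 ?exp_ge0.
have [n1 hn1] := @poly_exp_small 1 _ (p0 * c1) 2 dl ler01 D0 (mulr_gt0 p0_gt0 c10) dl'0.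
pose Cu := exp (2 * (k%:R + #|nmset r k|%:R * (slack d r k).+1%:R)).
have ce0 : 0 < eta ^+ 2 / (256 * d%:R) by rewrite divr_gt0 ?exprn_gt0 ?mulr_gt0.
have [n2 hn2] := @poly_exp_small Cu _ (eta ^+ 2 / (256 * d%:R))
  (2 * (k + k ^ r) + 2 * (k * k)) dl (exp_ge0 _) D0 ce0 dl'0.
have [n3 hn3] := archimedean_nat (2 * A / dl).
exists (maxn n1 (maxn n2 (maxn n3.+1 (maxn (2 * C + 6) (maxn (k ^ 2) (slack d r k * #|nmset r k| * r)))))).
move=> n; rewrite !geq_max => /and5P[h1 h2 h3 h4 /andP[h5 h6]] hdvd P hP.
have n0 : (0 < n)%N by apply: leq_trans h3.
have nR : (0 : R) < n%:R by rewrite ltr0n.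
pose m := (n * d %/ r)%N; have hm : (n * d = m * r)%N by rewrite divnK.
have [vtx hvtx] := exists_vertex_map hm.
have nd : (n <= n * d)%N by rewrite leq_pmulr.
have cT : #|{: 'I_m * 'I_r}| = (n * d)%N by rewrite card_prod !card_ord.
pose F : R := #|{: 'I_m * 'I_r}|`!%:R.
have F0 : 0 < F by rewrite ltr0n fact_gt0.
have hsim : F <= cs%:R * #|[set s | simple vtx s]|%:R.
  rewrite -natrM ler_nat; apply: simple_card_ge => //; rewrite cT.
    by apply: leq_trans nd; apply: leq_trans h4; rewrite leq_addr.
  by apply: leq_trans nd; apply: leq_trans h4; rewrite leq_addl.
have spos : (0 < #|[set s | simple vtx s]|)%N.
  by rewrite -(ltr0n R) -(pmulr_rgt0 _ cs0); apply: lt_le_trans hsim.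
have sR : (0 : R) < #|[set s | simple vtx s]|%:R by rewrite ltr0n.
have [h [hh1 hh2]] : exists h : nat, h%:R <= eta * n%:R /\
    forall j : nat, j%:R <= eta * n%:R -> (j <= h)%N.
  have ex0 : exists j : nat, j%:R <= eta * n%:R by exists 0%N; rewrite mulr_ge0 // ltW.
  have bd (j : nat) : j%:R <= eta * n%:R -> (j <= n)%N.
    by move=> hj; rewrite -(ler_nat R); apply: le_trans hj _; rewrite ler_piMl.
  by case: (ex_maxnP ex0 bd) => h hh hmax; exists h.
have b1 := alpha_tail_exp hvtx d_gt0 r_gt1 n0 p0_gt0 p0_le1 (ltW c10) (_ : _ <= - c1).
have {}b1 : #|[set s | p0 * n%:R <= (alpha (hg vtx s))%:R]|%:R <= dl * F.
  apply: le_trans (b1 _) _; first by rewrite /c1 opprK.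
  by rewrite ler_wpM2r ?(ltW F0) // -[leLHS]mul1r mulrA; apply: hn1.
have b2 : #|[set s | eta * n%:R <= (uncolored vtx k s)%:R]|%:R <= dl * F.
  apply: le_trans (uncolored_tail hvtx d_gt0 r_gt1 n0 k_gt2 hq q_lt1 key h5 _ eta0 eta1) _.
    rewrite leq_divRL ?nmset_gt0 //; rewrite -(leq_pmul2r (ltnW r_gt1)) -hm.
    by apply: leq_trans h6 nd.
  by rewrite ler_wpM2r ?(ltW F0) //; apply: hn2.
have b3 : #|[set s | ~~ sparse vtx h s]|%:R <= dl * F.
  apply: le_trans (not_sparse_le hvtx r_gt1 n0 d_gt0 _) _.
    rewrite -/A -mulrA [4^-1 * _]mulrC mulrA ler_wpM2r ?invr_ge0 //.
    by rewrite mulrC -ler_pdivlMr // mulrC.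
  rewrite -/F ler_wpM2r ?(ltW F0) // -[2 * exp 3 * _]mulrA -/A ler_pdivrMr //.
  rewrite -ler_pdivrMl // mulrC; apply: le_trans hn3 _.
  by rewrite ler_nat ltnW.
rewrite (prob_simple hvtx (ltnW r_gt1)) //.
have hle : #|[set s | simple vtx s]|%:R <= #|[set s | simple vtx s && P (hg vtx s)]|%:R +
   (#|[set s | p0 * n%:R <= (alpha (hg vtx s))%:R]|%:R +
    #|[set s | eta * n%:R <= (uncolored vtx k s)%:R]|%:R +
    #|[set s | ~~ sparse vtx h s]|%:R) :> R.
  rewrite -!natrD ler_nat.
  set S1 := [set s | _ <= (alpha _)%:R]; set S2 := [set s | _ <= (uncolored _ _ _)%:R].
  set S3 := [set s | ~~ _].
  apply: (@leq_trans #|[set s | simple vtx s && P (hg vtx s)] :|: (S1 :|: S2 :|: S3)|).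
    apply: subset_leq_card; apply/subsetP => s hs; rewrite !in_setU.
    move: hs; rewrite inE => hs.
    case: (boolP (s \in S1)) => [_|hs1]; first by rewrite /= ?orbT.
    case: (boolP (s \in S2)) => [_|hs2]; first by rewrite /= ?orbT.
    case: (boolP (s \in S3)) => [_|hs3]; first by rewrite /= ?orbT.
    rewrite /= orbF inE hs /=; apply: hP.
    - exact: simple_Hrnd.
    - apply: (@colorable_of_uncolored _ _ _ vtx r_gt1 k _ h) => //.
      + exact: ltnW (ltnW k_gt2).
      + by move: hs3; rewrite inE negbK.
      + by apply: hh2; apply: ltW; move: hs2; rewrite inE -ltNge.
    - by move: hs1; rewrite inE -ltNge.
  apply: leq_trans (leq_card_setU _ _) _; rewrite leq_add2l.
  apply: leq_trans (leq_card_setU _ _) _; rewrite leq_add2r.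
  exact: leq_card_setU.
rewrite ler_pdivlMr // mulrBl mul1r lerBlDr.
apply: le_trans hle _; rewrite lerD2l.
apply: (@le_trans _ _ (3 * dl * F)).
  have -> : 3 * dl * F = dl * F + dl * F + dl * F by ring.
  by rewrite !lerD.
have -> : 3 * dl = delta / cs%:R by rewrite /dl; field; rewrite gt_eqF.
by rewrite mulrAC ler_pdivrMr // -mulrA ler_pM2l // mulrC.
Qed.

End FixedParameters.

(** * Chromatic number against independence number *)

Lemma bigminn_le (I : eqType) (s : seq I) (P : pred I) (F : I -> nat) n j :
  j \in s -> P j -> (\big[minn/n]_(i <- s | P i) F i <= F j)%N.
Proof.
elim: s => // i s IH; rewrite inE big_cons => /orP[/eqP <-|hj] hP.
  by rewrite hP geq_minl.
have := IH hj hP; case: ifP => // _ h; apply: leq_trans (geq_minr _ _) h.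
Qed.

Section ChiAlpha.
Variables (n r d : nat) (H : hgraph n).
Hypotheses (r_gt1 : (1 < r)%N) (hH : H \in Hrnd n r d).

Lemma chi_le k : colorable H k -> (k <= n)%N -> (chi H <= k)%N.
Proof.
move=> hk kn; rewrite /chi.
exact: (@bigminn_le _ _ (fun j : 'I_n.+1 => colorable H j) _ n (Ordinal (kn : k < n.+1)%N))
  (mem_index_enum _) hk.
Qed.

(** Shows that the default value [n] of the minimum defining [chi] is itself a valid number of
    colours. *)
Lemma colorable_all : colorable H n.
Proof.
move: hH; rewrite inE => /andP[/forall_inP hu _].
apply/existsP; exists [ffun v => v]; apply/forall_inP => e he; apply/negP.
move=> /existsP[c /forall_inP hc]; have := hu e he => /eqP her.
have : e \subset [set c] by apply/subsetP => v /hc; rewrite ffunE inE.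
by move=> /subset_leq_card; rewrite cards1 her leqNgt r_gt1.
Qed.

Lemma chi_colorable : colorable H (chi H).
Proof.
rewrite /chi; elim/big_ind: _ => [|x y hx hy|//]; first exact: colorable_all.
by rewrite /minn; case: ifP.
Qed.

Lemma leq_chi_alpha : (n <= chi H * alpha H)%N.
Proof.
have /existsP[f /forall_inP hf] := chi_colorable.
rewrite -[leqLHS]card_ord -sum1_card (partition_big f predT) //=.
rewrite -[X in (_ <= X * _)%N]card_ord -sum_nat_const; apply: leq_sum => c _.
rewrite /alpha.
have -> : (\sum_(i | f i == c) 1 = #|[set i | f i == c]|)%N.
  by rewrite -sum1_card; apply: eq_bigl => i; rewrite inE.
apply: (@leq_bigmax_cond _ _ (fun S : {set 'I_n} => #|S|)).
apply/forall_inP => e he; apply: contraNN (hf e he) => /subsetP hs.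
by apply/existsP; exists c; apply/forall_inP => v /hs; rewrite inE.
Qed.

End ChiAlpha.

(** * The entropy inequality behind the second moment *)

(** With [y = z^2], the bound [ln z >= 1 - 1 / z] turns the right side into exactly [(z - 1)^2]. The
    square root keeps the bound valid down to [y = 0]. *)
Lemma entropy_ge_sqr (z : R) : 0 <= z -> (z - 1) ^+ 2 <= z ^+ 2 * ln (z ^+ 2) - z ^+ 2 + 1.
Proof.
rewrite le_eqVlt => /orP[/eqP <-|z0].
  by rewrite expr0n /= mul0r !sub0r sqrrN expr1n oppr0 add0r.
have h := ln_ge1V z0; rewrite lnX //.
have : z ^+ 2 * (2 * (1 - z^-1)) <= z ^+ 2 * (2 * ln z).
  by rewrite ler_pM2l ?exprn_gt0 // ler_pM2l.
have -> : z ^+ 2 * (2 * (1 - z^-1)) = 2 * z ^+ 2 - 2 * z by field; rewrite gt_eqF.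
by move=> h2; nra.
Qed.

Lemma ln9_ge2 : 2 <= ln 9.
Proof.
rewrite -ler_exp exp_lnK //.
have e3 : exp 1 <= 3 by apply/RleP; have := exp_le_3; rewrite IZRposE INRE.
have -> : exp 2 = exp 1 ^+ 2 by rewrite exprX mulr1.
have -> : 9 = 3 ^+ 2 :> R by ring.
by rewrite lerXn2r ?nnegrE ?exp_ge0.
Qed.

(** [(ln y - 1) / y] decreases once [ln y >= 2]; 9 serves as a convenient number above [e^2]. *)
Lemma ln_ratio_decreasing (y z : R) : 9 <= y -> y <= z -> (ln z - 1) * y <= (ln y - 1) * z.
Proof.
move=> y9 yz; have y0 : 0 < y by lra.
have z0 : 0 < z by lra.
have l2 : 2 <= ln y by apply: le_trans ln9_ge2 _; apply: ler_ln => //; lra.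
have h : ln z <= ln y + (z / y - 1).
  have -> : z = y * (z / y) by rewrite mulrC divfK // gt_eqF.
  rewrite lnD ?divr_gt0 // lerD2l mulrAC mulfV ?gt_eqF // mul1r.
  by apply: ln_le_sub1; rewrite divr_gt0.
apply: (@le_trans _ _ ((ln y + (z / y - 1) - 1) * y)).
  by rewrite ler_pM2r //; lra.
have -> : (ln y + (z / y - 1) - 1) * y = (ln y - 1) * y + (z - y) by field; rewrite gt_eqF.
nra.
Qed.

(* Near the uniform overlap both sides are quadratic; away from it the left side is
   largest, relative to the right, at the identical-colouring end [y = k]. *)
Lemma overlap_key (r k : nat) (A : R) : (1 < r)%N -> (9 <= k)%N -> 0 <= A ->
  A * (1 + k%:R^-1) ^+ r.-1 <= ln k%:R - 1 ->
  A * (r%:R ^+ 2 * 9 ^+ r * 16) <= k%:R ^+ r.-1 ->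
  forall y : R, 0 <= y <= k%:R + 1 ->
    A / k%:R ^+ r.-1 * bern_gap r y <= y * ln y - y + 1.
Proof.
move=> r1 k9 A0 hC1 hC2 y /andP[y0 yk].
have kR : (9 : R) <= k%:R by rewrite (ler_nat R 9).
have k0 : (0 : R) < k%:R by apply: lt_le_trans kR.
set D := k%:R ^+ r.-1; have D0 : 0 < D by rewrite exprn_gt0.
case: (lerP y 9) => y9.
  have [z z0 yz] : exists2 z, 0 <= z & y = z ^+ 2.
    by exists (Num.sqrt y); rewrite ?sqrtr_ge0 ?sqr_sqrtr.
  have b := @bern_gap_le_sqr r y 9 (_ : 0 <= y <= 9) (_ : 1 <= 9).
  have {}b : bern_gap r y <= r%:R ^+ 2 * 9 ^+ r * (y - 1) ^+ 2.
    by apply: b; rewrite ?y0 //; lra.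
  (* As [z <= 3] here, [(z + 1)^2 <= 16]. *)
  have h16 : (y - 1) ^+ 2 <= 16 * (z - 1) ^+ 2.
    have -> : (y - 1) ^+ 2 = (z + 1) ^+ 2 * (z - 1) ^+ 2 by rewrite yz; ring.
    rewrite ler_wpM2r ?sqr_ge0 //; have : z <= 3 by nra.
    by nra.
  have := entropy_ge_sqr z0; rewrite -yz; apply: le_trans.
  rewrite mulrAC ler_pdivrMr //.
  apply: (@le_trans _ _ (A * (r%:R ^+ 2 * 9 ^+ r * (16 * (z - 1) ^+ 2)))).
    rewrite ler_wpM2l //; apply: le_trans b _; rewrite ler_wpM2l //.
    by rewrite mulr_ge0 ?exprn_ge0.
  have -> : A * (r%:R ^+ 2 * 9 ^+ r * (16 * (z - 1) ^+ 2)) =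
     (z - 1) ^+ 2 * (A * (r%:R ^+ 2 * 9 ^+ r * 16)) by ring.
  by rewrite ler_wpM2l // sqr_ge0.
have y9' : 9 <= y by apply: ltW.
have y_gt0 : 0 < y by lra.
have b : bern_gap r y <= y ^+ r by apply: bern_gap_le_pow; lra.
apply: (@le_trans _ _ (y * (ln y - 1))); last by lra.
apply: (@le_trans _ _ (A / D * y ^+ r)); first by rewrite ler_wpM2l // divr_ge0 // ltW.
have er2 : r.-1 = r.-2.+1 by rewrite prednK // -subn1 subn_gt0.
have -> : y ^+ r = y * y ^+ r.-1 by rewrite -exprS prednK // ltnW.
rewrite mulrCA ler_pM2l //.
have zk := ln_ratio_decreasing y9' yk.
have k10 : 0 < k%:R + 1 :> R by lra.
rewrite -(ler_pM2r k10); apply: le_trans zk.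
(* After division by [y], the left side [y^(r-2)] grows and [(ln y - 1) / y] falls, so the endpoint
   [y = k + 1] is the worst case. *)
have hy : y ^+ r.-1 * (k%:R + 1) <= y * (k%:R + 1) ^+ r.-1.
  rewrite er2 !exprS -mulrA ler_pM2l // [leRHS]mulrC.
  by rewrite ler_wpM2r ?(ltW k10) // lerXn2r ?nnegrE ?(ltW k10).
rewrite -mulrA; apply: (@le_trans _ _ (A / D * (y * (k%:R + 1) ^+ r.-1))).
  by rewrite ler_wpM2l // divr_ge0 // ltW.
have -> : A / D * (y * (k%:R + 1) ^+ r.-1) = A * (1 + k%:R^-1) ^+ r.-1 * y.
  have -> : 1 + k%:R^-1 = (k%:R + 1) / k%:R :> R by field; rewrite gt_eqF.
  by rewrite expr_div_n -/D; field; rewrite gt_eqF.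
rewrite ler_pM2r //; apply: le_trans hC1 _; rewrite lerD2r.
by apply: ler_ln => //; lra.
Qed.

(** * Choice of parameters *)

Lemma sqr_lt_contra (l y z : R) : 1 <= l -> l ^+ 2 / 54 <= z -> z < y -> 54 * y <= l -> False.
Proof. nra. Qed.

Lemma geometric_inverse_le (v : R) : 0 < v -> v <= 1 / 2 -> 1 <= (1 + 2 * v) * (1 - v).
Proof. nra. Qed.

Lemma quadratic_slack (a v : R) : 0 <= v -> v <= a / 4 -> a <= 1 -> 1 + v + 2 * v ^+ 2 <= 1 + a / 2.
Proof. nra. Qed.

Lemma ratio_slack (a : R) : 0 < a -> a <= 1 -> 1 + a / 2 <= (1 - a / 4) * (1 + a).
Proof. nra. Qed.

Section Asymptotics.
Variables (r d : nat).
Hypotheses (r_gt1 : (1 < r)%N) (L_ge1 : 1 <= ln d%:R).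
Let L := ln d%:R.
Let rr : R := r.-1%:R.
Let x : R := rr * d%:R / (r%:R * L).
Let t := chi_target r d.

Let d0 : (0 : R) < d%:R.
Proof.
case: d L_ge1 => [|d' _]; last by rewrite ltr0Sn.
(* [ln] is 0 at 0 by convention, so [L >= 1] excludes [d = 0]. *)
have -> : ln 0%:R = 0 by rewrite /ln; case: Rlt_dec => [h|//]; case: (Rlt_irrefl _ h).
by rewrite ler10.
Qed.

Let L0 : 0 < L. Proof. exact: lt_le_trans L_ge1. Qed.
Let rr1 : 1 <= rr. Proof. by rewrite ler1n -subn1 subn_gt0. Qed.
Let rr0 : 0 < rr. Proof. exact: lt_le_trans rr1. Qed.
Let er : r%:R = rr + 1 :> R. Proof. by rewrite natr1 prednK // ltnW. Qed.
Let r0 : (0 : R) < r%:R. Proof. by rewrite ltr0n ltnW. Qed.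
Let dE : d%:R = exp L. Proof. by rewrite exp_lnK. Qed.

Lemma target_base_gt0 : 0 < x.
Proof. by rewrite divr_gt0 ?mulr_gt0. Qed.

Lemma chi_targetE : t = exp (ln x / rr).
Proof.
rewrite /t /chi_target /Rpower !INRE; congr exp.
have -> : Rminus r%:R 1 = rr by rewrite RminusE er addrK.
by rewrite !RdivE !RmultE R1E div1r mulrC.
Qed.

Lemma target_gt0 : 0 < t.
Proof. by rewrite chi_targetE exp_gt0. Qed.

Lemma target_pow : t ^+ r.-1 = x.
Proof.
by rewrite chi_targetE exprX -/rr mulrC divfK ?gt_eqF // exp_lnK // target_base_gt0.
Qed.

(** The targets multiply to [n], which is what lets [n <= chi * alpha] exchange upper and lower
    bounds. *)
Lemma alpha_targetE n : alpha_target r d n = n%:R / t.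
Proof.
rewrite /alpha_target /Rpower !INRE RmultE mulrC chi_targetE -expRNE; congr (_ * exp _).
have -> : Rminus r%:R 1 = rr by rewrite RminusE er addrK.
rewrite !RdivE !RmultE R1E div1r -[ln (d%:R)]/L.
have -> : r%:R * L / (rr * d%:R) = x^-1 by rewrite /x invf_div.
by rewrite lnV ?target_base_gt0 // mulrN mulrC.
Qed.

Lemma ln_target : ln t = ln x / rr.
Proof. by rewrite chi_targetE; apply: ln_exp. Qed.

Lemma base_le : x <= d%:R.
Proof.
rewrite ler_pdivrMr ?mulr_gt0 // [leRHS]mulrC ler_wpM2r ?(ltW d0) //.
by rewrite (le_trans _ (ler_peMr (ltW r0) L_ge1)) // er lerDl.
Qed.

Lemma base_ge_half : d%:R / (2 * L) <= x.
Proof.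
rewrite ler_pdivrMr ?mulr_gt0 // /x mulrAC ler_pdivlMr ?mulr_gt0 //.
have h : r%:R <= 2 * rr by rewrite er; have := rr1; lra.
have -> : rr * d%:R * (2 * L) = d%:R * L * (2 * rr) by ring.
have -> : d%:R * (r%:R * L) = d%:R * L * r%:R by ring.
by rewrite ler_wpM2l ?mulr_ge0 // ltW.
Qed.

(** From [d = exp L >= (L / 3)^3]; with [x >= d / (2 L)] this is the source of the constant 54
    below. *)
Lemma cube_le : L ^+ 3 / 27 <= d%:R.
Proof.
rewrite dE; apply: le_trans (exp_ge_pow 2 (ltW L0)).
by rewrite expr_div_n; have -> : 3 ^+ 3 = 27 :> R by ring.
Qed.

Lemma base_ge_sqr : L ^+ 2 / 54 <= x.
Proof.
apply: le_trans base_ge_half; rewrite ler_pdivlMr ?mulr_gt0 //.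
apply: le_trans cube_le.
by rewrite le_eqVlt; apply/orP; left; apply/eqP; field.
Qed.

Lemma ln_base_ge : L - ln (2 * L) <= ln x.
Proof.
have L2 : 0 < 2 * L by rewrite mulr_gt0.
have iL : 0 < (2 * L)^-1 by rewrite invr_gt0.
have -> : L - ln (2 * L) = ln (d%:R / (2 * L)) by rewrite (lnD d0 iL) lnV.
by apply: ler_ln base_ge_half; rewrite divr_gt0.
Qed.

Lemma target_ge (K : R) : 0 <= K -> 54 * K ^+ r.-1 <= L -> K <= t.
Proof.
move=> K0 h; rewrite leNgt; apply/negP => tK.
have : t ^+ r.-1 < K ^+ r.-1.
  by rewrite ltrXn2r ?(ltW target_gt0) // -lt0n -subn1 subn_gt0.
by rewrite target_pow => h2; apply: sqr_lt_contra L_ge1 base_ge_sqr h2 h.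
Qed.

Section Threshold.
Variable e : R.
Hypotheses (e0 : 0 < e) (e1 : e <= 1).
(** What large [d] must provide: [L_log] absorbs the term [ln (2 L)] lost in [ln x] together with
    constants, [L_big] serves the quadratic regime near the uniform overlap, and [L_target] makes
    corrections of order [1 / k] at most [e / 4]. *)
Hypothesis L_log : ln (16 / e) + r%:R <= e * L / 8.
Hypothesis L_big : 27 * 128 * (r%:R ^+ 2 * 9 ^+ r) <= L.
Hypothesis L_target : 54 * (4 * (r%:R + 3) / e) ^+ r.-1 <= L.

Lemma target_large : 4 * (r%:R + 3) / e <= t.
Proof. by apply: target_ge => //; rewrite divr_ge0 ?mulr_ge0 ?addr_ge0 // ltW. Qed.

(** Apply [ln v <= v - 1] at [v = e L / 8], a multiple of [L] small enough to be paid for by the gap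
    [e]. *)
Lemma log_slack : ln (2 * L) <= e * L / 8 + ln (16 / e) - 1.
Proof.
have -> : 2 * L = (e * L / 8) * (16 / e) by field; rewrite gt_eqF.
rewrite lnD ?divr_gt0 ?mulr_gt0 //.
have := @ln_le_sub1 (e * L / 8); rewrite divr_gt0 ?mulr_gt0 // => /(_ isT) h.
by rewrite [leRHS]addrAC lerD2r.
Qed.

Variable k : nat.
Hypothesis hk : (1 + e) * t <= k%:R.
(** One of the two factors [1 / k^(r-1)] of the overlap coefficient is included in [A], as
    [overlap_key] expects; so [A] is comparable with [ln k]. *)
Let A : R := d%:R / (r%:R * (1 - k%:R / k%:R ^+ r) ^+ 2) / k%:R ^+ r.-1.

Let tk : t <= k%:R.
Proof. by apply: le_trans hk; rewrite ler_peMl ?(ltW target_gt0) // lerDl ltW. Qed.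

Let kbig : 4 * (r%:R + 3) / e <= k%:R. Proof. exact: le_trans target_large tk. Qed.

Let k20 : 20 <= k%:R :> R.
Proof.
apply: le_trans kbig; rewrite ler_pdivlMr //.
by have := rr1; rewrite er; have := e1; nra.
Qed.

Let k0 : 0 < k%:R :> R. Proof. by apply: lt_le_trans k20. Qed.

Lemma k_ge9 : (9 <= k)%N.
Proof. by rewrite -(ler_nat R); apply: le_trans k20; rewrite ler_nat. Qed.

Lemma mono_probE : k%:R / k%:R ^+ r = (k%:R ^+ r.-1)^-1 :> R.
Proof.
have -> : k%:R ^+ r = k%:R * k%:R ^+ r.-1 :> R by rewrite -exprS prednK // ltnW.
by rewrite invfM mulrA mulfV ?mul1r // gt_eqF.
Qed.

Let u : R := k%:R^-1.
Let u0 : 0 < u. Proof. by rewrite invr_gt0. Qed.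

Let u_small : (r%:R + 3) * u <= e / 4.
Proof.
rewrite /u ler_pdivrMr // mulrAC ler_pdivlMr // [leLHS]mulrC.
by move: kbig; rewrite ler_pdivrMr // [k%:R * e]mulrC.
Qed.

Let u_le : u <= 1 / 2.
Proof. by rewrite /u div1r lef_pV2 ?posrE //; apply: le_trans k20; rewrite ler_nat. Qed.

Lemma mono_prob_le : k%:R / k%:R ^+ r <= u.
Proof.
rewrite mono_probE lef_pV2 ?posrE ?exprn_gt0 // -[leLHS]expr1.
rewrite ler_weXn2l //; first by apply: le_trans k20; rewrite ler1n.
by rewrite -subn1 subn_gt0.
Qed.

Lemma mono_prob_lt1 : k%:R / k%:R ^+ r < 1 :> R.
Proof. by apply: le_lt_trans mono_prob_le _; have := u_le; lra. Qed.

Let kpow : (1 + e) * x <= k%:R ^+ r.-1.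
Proof.
apply: (@le_trans _ _ (((1 + e) * t) ^+ r.-1)).
  rewrite exprMn target_pow ler_wpM2r ?(ltW target_base_gt0) // -[leLHS]expr1.
  rewrite ler_weXn2l // ?lerDl ?(ltW e0) //.
  by rewrite -subn1 subn_gt0.
by rewrite lerXn2r ?nnegrE ?(ltW k0) // mulr_ge0 ?(ltW target_gt0) // addr_ge0 // ltW.
Qed.

(** Here the excess of [k] over the target is spent: since [d / (r x) = L / (r - 1)], [A] is smaller
    than [L / (r - 1)] by a factor close to [1 + e], while [ln k] is about [L / (r - 1)]. *)
Let A_le : A <= L / rr / (1 + e) * (1 - u)^-1 ^+ 2.
Proof.
have D0 : 0 < k%:R ^+ r.-1 :> R by rewrite exprn_gt0.
have e10 : 0 < 1 + e by rewrite addr_gt0.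
pose q : R := k%:R / k%:R ^+ r.
have q1 : 0 < 1 - q by rewrite subr_gt0 mono_prob_lt1.
have u1 : 0 < 1 - u by have := u_le; lra.
have -> : A = d%:R / r%:R / k%:R ^+ r.-1 * (1 - q)^-1 ^+ 2.
  by rewrite /A -/q; field; rewrite !gt_eqF.
apply: ler_pM; rewrite ?divr_ge0 ?exprn_ge0 ?invr_ge0 ?(ltW q1) ?(ltW D0) //.
  have -> : L / rr / (1 + e) = d%:R / r%:R / ((1 + e) * x).
    by rewrite /x; field; rewrite !gt_eqF.
  rewrite ler_wpM2l ?divr_ge0 // lef_pV2 ?posrE // mulr_gt0 // target_base_gt0 //.
rewrite lerXn2r ?nnegrE ?invr_ge0 ?(ltW q1) ?(ltW u1) // lef_pV2 ?posrE //.
by rewrite lerB // mono_prob_le.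
Qed.

Let inv1u : (1 - u)^-1 <= exp (2 * u).
Proof.
have u1 : 0 < 1 - u by have := u_le; lra.
apply: (@le_trans _ _ (1 + 2 * u)); last exact: exp_ge1D.
rewrite -[leLHS]mul1r ler_pdivrMr //.
exact: geometric_inverse_le u0 u_le.
Qed.

Lemma overlap_coef_ge0 : 0 <= A.
Proof.
by rewrite /A !divr_ge0 ?exprn_ge0 ?(ltW k0) // mulr_ge0 ?sqr_ge0.
Qed.

Lemma overlap_cond1 : A * (1 + k%:R^-1) ^+ r.-1 <= ln k%:R - 1.
Proof.
rewrite -/u.
have e10 : 0 < 1 + e by rewrite addr_gt0.
have u1 : 0 < 1 - u by have := u_le; lra.
have LR0 : 0 <= L / rr / (1 + e) by rewrite !divr_ge0 ?(ltW L0) ?(ltW e10).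
(* The left side is at most [exp (4 u + (r - 1) u)], the origin of [r + 3] in [L_target]. *)
have hu : (1 - u)^-1 ^+ 2 * (1 + u) ^+ r.-1 <= 1 + e / 2.
  apply: (@le_trans _ _ (exp (2 * u) ^+ 2 * exp u ^+ r.-1)).
    rewrite ler_pM ?exprn_ge0 ?invr_ge0 ?(ltW u1) ?addr_ge0 ?(ltW u0) //.
      by rewrite lerXn2r ?nnegrE ?invr_ge0 ?exp_ge0 ?(ltW u1).
    by rewrite lerXn2r ?nnegrE ?exp_ge0 ?addr_ge0 ?(ltW u0) ?exp_ge1D.
  rewrite !exprX -expRDE.
  have -> : 2%:R * (2 * u) + r.-1%:R * u = (r%:R + 3) * u by rewrite er /rr; ring.
  have v0 : 0 <= (r%:R + 3) * u by rewrite mulr_ge0 ?addr_ge0 // ltW.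
  move: u_small v0; set v := _ * u => v1 v0.
  apply: le_trans (exp_le_quadratic _) _; last exact: quadratic_slack v0 v1 e1.
  by rewrite ger0_norm //; apply: le_trans v1 _; have := e1; lra.
(* The remaining margin [e L / 4] is halved by [log_slack]; [L_log] pays the constants with the
   other half. *)
apply: (@le_trans _ _ (L / rr * (1 - e / 4))).
  apply: (@le_trans _ _ (L / rr / (1 + e) * (1 - u)^-1 ^+ 2 * (1 + u) ^+ r.-1)).
    by rewrite ler_wpM2r ?A_le // exprn_ge0 // addr_ge0 // ltW.
  rewrite -[leLHS]mulrA; apply: (le_trans (ler_wpM2l LR0 hu)).
  rewrite -[leLHS]mulrA ler_wpM2l ?divr_ge0 ?(ltW L0) // mulrC ler_pdivrMr //.
  exact: ratio_slack e0 e1.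
have l1 : ln t <= ln k%:R by apply: ler_ln tk; apply: target_gt0.
apply: (@le_trans _ _ (ln t - 1)); last by rewrite lerD2r.
rewrite ln_target.
have -> : ln x / rr - 1 = (ln x - rr) / rr by field; rewrite gt_eqF.
rewrite mulrAC ler_wpM2r ?invr_ge0 ?(ltW rr0) //.
have h1 := ln_base_ge; have h2 := log_slack; have h3 := L_log; rewrite er in h3.
by lra.
Qed.

(** [A] is of order [L], whereas [k^(r-1) >= x >= L^2 / 54]. With [A <= 4 L] the condition reads
    [64 * 54] times [r^2 9^r] at most [L], and [64 * 54 = 27 * 128]. *)
Lemma overlap_cond2 : A * (r%:R ^+ 2 * 9 ^+ r * 16) <= k%:R ^+ r.-1.
Proof.
have B0 : 0 <= r%:R ^+ 2 * 9 ^+ r :> R by rewrite mulr_ge0 ?exprn_ge0.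
have u1 : 0 < 1 - u by have := u_le; lra.
have e10 : 0 < 1 + e by rewrite addr_gt0.
have hA : A <= 4 * L.
  apply: le_trans A_le _; rewrite mulrC; apply: ler_pM; rewrite ?exprn_ge0 ?invr_ge0 ?(ltW u1) //.
  - by rewrite !divr_ge0 ?(ltW L0) ?(ltW e10).
  - have -> : 4 = 2 ^+ 2 :> R by ring.
    rewrite lerXn2r ?nnegrE ?invr_ge0 ?(ltW u1) // -[leLHS]mul1r ler_pdivrMr //.
    by have := u_le; lra.
  - rewrite -mulrA ler_piMr ?(ltW L0) //.
    rewrite mulr_ile1 ?invr_ge0 ?(ltW rr0) ?(ltW e10) // invf_le1 // lerDl ltW //.
apply: (@le_trans _ _ (4 * L * (r%:R ^+ 2 * 9 ^+ r * 16))).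
  by rewrite ler_wpM2r // mulr_ge0.
apply: (@le_trans _ _ x); last first.
  by apply: le_trans kpow; rewrite ler_peMl ?(ltW target_base_gt0) // lerDl ltW.
apply: le_trans base_ge_half; rewrite ler_pdivlMr ?mulr_gt0 //; apply: le_trans cube_le.
rewrite ler_pdivlMr //.
have -> : 4 * L * (r%:R ^+ 2 * 9 ^+ r * 16) * (2 * L) * 27 =
   L ^+ 2 * (27 * 128 * (r%:R ^+ 2 * 9 ^+ r)) by ring.
have -> : L ^+ 3 = L ^+ 2 * L by ring.
by rewrite ler_wpM2l ?sqr_ge0.
Qed.

Lemma target_overlap_key (y : R) : 0 <= y <= k%:R + 1 ->
  d%:R / (r%:R * (1 - k%:R / k%:R ^+ r) ^+ 2) * (k%:R ^+ 2 / (k%:R ^+ 2) ^+ r) * bern_gap r y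
    <= y * ln y - y + 1.
Proof.
have := overlap_key r_gt1 k_ge9 overlap_coef_ge0 overlap_cond1 overlap_cond2.
move=> h hy; have := h y hy; apply: le_trans.
rewrite /A; set q : R := k%:R / k%:R ^+ r.
have D0 : 0 < k%:R ^+ r.-1 :> R by rewrite exprn_gt0.
have q1 : 0 < 1 - q by rewrite subr_gt0 mono_prob_lt1.
have -> : k%:R ^+ 2 / (k%:R ^+ 2) ^+ r = (k%:R ^+ r.-1)^-1 ^+ 2 :> R.
  have -> : (k%:R ^+ 2) ^+ r = k%:R ^+ 2 * (k%:R ^+ r.-1) ^+ 2 :> R.
    by rewrite -exprMn -exprS prednK ?(ltnW r_gt1) // -!exprM mulnC.
  by rewrite invfM mulrA mulfV ?mul1r ?exprVn // gt_eqF // exprn_gt0.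
by rewrite le_eqVlt; apply/orP; left; apply/eqP; field; rewrite !gt_eqF.
Qed.

End Threshold.

(** The left side is at most [1 + L / (r - 1)] and the right side at least [(1 + e) L / (r - 1)];
    the hypothesis says that the difference [e L / (r - 1)] exceeds 1. *)
Lemma alpha_threshold (e : R) : 0 < e -> rr < e * L ->
  1 - ln ((1 + e) / t) < d%:R / r%:R * ((1 + e) / t) ^+ r.-1.
Proof.
move=> e0 he; have t0 := target_gt0; have e10 : 0 < 1 + e by rewrite addr_gt0.
rewrite lnD ?invr_gt0 // lnV // ln_target expr_div_n target_pow.
have -> : d%:R / r%:R * ((1 + e) ^+ r.-1 / x) = (1 + e) ^+ r.-1 * (L / rr).
  by rewrite /x; field; rewrite !gt_eqF.
have LR : 0 < L / rr by rewrite divr_gt0.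
have h1 : 0 <= ln (1 + e) by apply: le_trans (ln_ge1V e10); rewrite subr_ge0 invf_le1 // lerDl ltW.
have h2 : ln x / rr <= L / rr.
  by rewrite ler_wpM2r ?invr_ge0 ?(ltW rr0) //; apply: ler_ln base_le; apply: target_base_gt0.
have h3 : (1 + e) * (L / rr) <= (1 + e) ^+ r.-1 * (L / rr).
  rewrite ler_wpM2r ?(ltW LR) // -[leLHS]expr1 ler_weXn2l // ?lerDl ?(ltW e0) //.
  by rewrite -subn1 subn_gt0.
have h4 : 1 < e * (L / rr) by rewrite mulrA ltr_pdivlMr // mul1r.
apply: lt_le_trans h3; rewrite mulrDl mul1r opprB addrCA addrA.
move: h1 h2 h4; set a := ln _; set b := ln x / rr; set c := L / rr; lra.
Qed.

End Asymptotics.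

(** * Choice of [d0] and conclusion *)

Lemma ln_nat_large (x : R) : exists d0 : nat, forall d : nat, (d0 <= d)%N -> x <= ln d%:R.
Proof.
have [d0 h0] := archimedean_nat (exp x); exists d0 => d hd.
have hx : exp x <= d%:R by apply: le_trans h0 _; rewrite ler_nat.
by rewrite -ler_exp exp_lnK //; apply: lt_le_trans hx; apply: exp_gt0.
Qed.

Lemma Rle_b_of_le (x y : R) : x <= y -> Rle_b x y.
Proof. by rewrite /Rle_b; case: Rle_dec => // h /RleP. Qed.

(** The lower bound is multiplicative, the form in which [n <= chi * alpha] delivers it;
    [1 / (1 + e) >= 1 - e] makes it two-sided. *)
Lemma relative_error_le (t c e eps : R) : 0 < t -> 0 < e -> e <= eps ->
  c <= (1 + e) * t -> t <= c * (1 + e) -> Rle_b (Rabs ((c - t) / t)%R) eps.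
Proof.
move=> t0 e0 he h1 h2; apply: Rle_b_of_le.
rewrite RabsE ler_norml ler_pdivrMr // ler_pdivlMr //.
have h3 : e * t <= eps * t by rewrite ler_wpM2r // ltW.
apply/andP; split; last by lra.
case: (lerP c t) => ct; last by nra.
have : c * e <= t * e by rewrite ler_wpM2r // ltW.
lra.
Qed.

Lemma good_event_intro (n r d : nat) (e eps : R) (H : hgraph n) :
  (1 < r)%N -> 1 <= ln d%:R -> (0 < n)%N -> 0 < e -> e <= eps ->
  (chi H)%:R <= (1 + e) * chi_target r d ->
  (alpha H)%:R <= (1 + e) / chi_target r d * n%:R ->
  (n <= chi H * alpha H)%N -> good_event r d eps H.
Proof.
move=> r1 L1 n0 e0 he hchi halpha; rewrite -(ler_nat R) natrM => hn.
have t0 := target_gt0 d r1; have nR : (0 : R) < n%:R by rewrite ltr0n.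
have e10 : 0 < 1 + e by rewrite addr_gt0.
have c0 : (0 : R) <= (chi H)%:R by []. have a0 : (0 : R) <= (alpha H)%:R by [].
rewrite /good_event !INRE !RdivE !RminusE (alpha_targetE r1 L1); set t := chi_target r d in t0 hchi halpha *.
apply/andP; split; apply: (relative_error_le _ e0 he) => //.
- rewrite -(ler_pM2l nR); apply: (@le_trans _ _ ((chi H)%:R * (alpha H)%:R * t)).
    by rewrite ler_pM2r.
  apply: (@le_trans _ _ ((chi H)%:R * ((1 + e) / t * n%:R) * t)).
    by rewrite ler_pM2r // ler_wpM2l.
  by rewrite le_eqVlt; apply/orP; left; apply/eqP; field; rewrite gt_eqF.
- by rewrite divr_gt0.
- by rewrite [n%:R / t]mulrC mulrA.
- rewrite ler_pdivrMr //; apply: le_trans hn _.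
  apply: (@le_trans _ _ ((1 + e) * t * (alpha H)%:R)); first by rewrite ler_wpM2r.
  by rewrite le_eqVlt; apply/orP; left; apply/eqP; ring.
Qed.

Lemma exists_nat_between (x : R) : 0 < x -> exists k : nat, x <= k%:R <= x + 1.
Proof.
move=> x0; case: (ex_minnP (archimedean_nat x)) => k hk kmin; exists k; rewrite hk /=.
case: k hk kmin => [|k] hk kmin; first by rewrite addr_ge0 ?ltW.
rewrite -natr1 lerD2r; case: (lerP k%:R x) => // hx.
by have := kmin k (ltW hx); rewrite ltnn.
Qed.

Lemma prob_good_event_large (r : nat) (eps : R) : (1 < r)%N -> 0 < eps ->
  exists d0 : nat, forall d : nat, (d0 <= d)%N ->
  forall delta : R, 0 < delta ->
  exists N : nat, forall n : nat, (N <= n)%N -> (r %| n * d)%N ->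
    1 - delta <= prob r d (@good_event n r d eps).
Proof.
move=> r1 eps0.
(* The tolerance [f] is split: one half places [k] above the target, the other pays for rounding [k]
   up and for the [2 r] extra colours. *)
pose f : R := Num.min eps 1; pose e : R := f / 2.
have f0 : 0 < f by rewrite lt_min eps0 ltr01.
have f1 : f <= 1 by rewrite ge_min lexx orbT.
have feps : f <= eps by rewrite ge_min lexx.
have e0 : 0 < e by rewrite divr_gt0.
have e1 : e <= 1 by rewrite ler_pdivrMr //; lra.
have r0 : (0 : R) < r%:R by rewrite ltr0n ltnW.
have [d1 h1] := ln_nat_large 1.
have [d2 h2] := ln_nat_large ((ln (16 / e) + r%:R) * 8 / e).
have [d3 h3] := ln_nat_large (27 * 128 * (r%:R ^+ 2 * 9 ^+ r)).
have [d4 h4] := ln_nat_large (54 * (4 * (r%:R + 3) / e) ^+ r.-1).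
have [d5 h5] := ln_nat_large (r%:R / f).
exists (maxn d1 (maxn d2 (maxn d3 (maxn d4 d5)))) => d.
rewrite !geq_max => /and5P[/h1 L1 /h2 L2 /h3 L3 /h4 L4 /h5 L5] delta dl0.
set L := ln d%:R in L1 L2 L3 L4 L5.
have {}L2 : ln (16 / e) + r%:R <= e * L / 8.
  by rewrite ler_pdivlMr // [e * L]mulrC -ler_pdivrMr.
have hd : (0 < d)%N.
  case: (posnP d) => // d00; move: L1; rewrite /L d00.
  have -> : ln 0%:R = 0 by rewrite /ln; case: Rlt_dec => [h|//]; case: (Rlt_irrefl _ h).
  by rewrite ler10.
have t0 := target_gt0 d r1.
have tl := target_large r1 L1 e0 L4.
set t := chi_target r d in t0 tl.
have [k /andP[hk1 hk2]] := exists_nat_between (mulr_gt0 (addr_gt0 ltr01 e0) t0).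
have k9 := k_ge9 r1 L1 e0 e1 L4 hk1.
have tlarge : 4 * (r%:R + 3) <= e * t.
  by move: tl; rewrite ler_pdivrMr // [t * e]mulrC.
(* With [f <= 1] this makes the independence threshold [(1 + f) / t] at most 1. *)
have tl2 : 2 <= t.
  apply: le_trans tl; rewrite ler_pdivlMr //; nra.
have p00 : 0 < (1 + f) / t by rewrite divr_gt0 // addr_gt0.
have p01 : (1 + f) / t <= 1 by rewrite ler_pdivrMr // mul1r; lra.
have rf : r.-1%:R < f * L.
  apply: (@lt_le_trans _ _ r%:R); first by rewrite ltr_nat prednK // ltnW.
  by move: L5; rewrite ler_pdivrMr // [L * f]mulrC.
have [n0 hn0] := prob_colorable_alpha r1 hd (leq_trans (isT : (2 < 9)%N) k9) erefl
  (mono_prob_lt1 r1 L1 e0 e1 L4 hk1) (target_overlap_key r1 L1 e0 e1 L2 L3 L4 hk1)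
  p00 p01 (alpha_threshold r1 L1 f0 rf) dl0.
(* [chi] searches only up to [n] colours, so [n] must be at least [k + 2 r]. *)
exists (maxn n0 (k + 2 * r)) => n; rewrite geq_max => /andP[hn hnk] hdvd.
apply: hn0 => // H hH hcol hal.
have chik : (chi H)%:R <= (1 + f) * t.
  apply: (@le_trans _ _ (k + 2 * r)%:R); first by rewrite ler_nat (chi_le hcol).
  rewrite natrD natrM; have -> : f = 2 * e by rewrite /e; field.
  by move: hk2 tlarge r0; set y := e * t; rewrite mulrDl mul1r -/y [(1 + _) * _]mulrDl mul1r -mulrA -/y; lra.
apply: (good_event_intro r1 L1 _ f0 feps chik (ltW hal) (leq_chi_alpha r1 hH)).
by apply: leq_trans hnk; rewrite addn_gt0 (leq_trans _ k9).
Qed.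

Delimit Scope R_scope with R.

Theorem theorem1 :
  forall r : nat, (2 <= r)%N ->
  forall eps : R, (0 < eps)%R ->
  exists d0 : nat, forall d : nat, (d0 <= d)%N ->
    forall delta : R, (0 < delta)%R ->
    exists N : nat, forall n : nat, (N <= n)%N -> (r %| n * d)%N ->
      (1 - delta <= @prob n r d (@good_event n r d eps))%R.
Proof.
move=> r r1 eps /RltP eps0; have [d0 h0] := prob_good_event_large r1 eps0.
exists d0 => d hd delta /RltP dl0; have [N hN] := h0 d hd delta dl0.
by exists N => n hn hdvd; apply/RleP; apply: hN.
Qed.
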